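(* Consider the two-component Gaussian mixture model $$\xi \sim \alpha^* N(0,\sigma^{*2}) + (1-\alpha^* ) N(\mu^*,\sigma^{*2})$$ with unknown parameters $\theta^*=(\alpha^*,\mu^*,\sigma^{*2})\in\Omega=(0.5,1)\times\mathbb{R}\times\mathbb{R}^+$, and let $\xi_1,\ldots,\xi_n$ be an i.i.d. sample of size $n$ from it. Let $r>0$, $\delta\in(0,1)$, let $\omega$ be an arbitrarily small positive number, and set $$\nu=\min\left\{\left(\frac{1}{(\alpha^*+r)^2}\vee 1\right),\ \frac{\sigma^{*2}-r}{2(\sigma^{*2}+r)^3}-\frac{(1-\alpha^* )r}{(\sigma^{*2}-r)^2},\ \frac{1-\alpha^*}{\sigma^{*2}+r}-\frac{(1-\alpha^* )r}{(\sigma^{*2}-r)^2}\right\},$$ $$L=\max\left\{\frac{\alpha^*}{\big((\alpha^*-r)\vee 0.5\big)^2}+\frac{1-\alpha^*}{\big((1-\alpha^*-r)\vee\omega\big)^2},\ \frac{(1-\alpha^* )\sigma^{*2}}{(\sigma^{*2}-r)^2},\ \frac{\sigma^{*2}+r}{2(\sigma^{*2}-r)^3}+\frac{1-\alpha^*}{\sigma^{*2}-r}\right\}.$$ Then there is a quantity $\gamma=\gamma(\alpha^*,\mu^*,\sigma^{*2})\ge 0$ with $$\gamma(\alpha^*,\mu^*,\sigma^{*2}) = O\left(\frac{\mu^{*5}}{\sigma^{*8}}\exp\left(-\frac{\mu^*-r}{\sigma^{*2}+r}\right)\right)$$ as $\mu^*/\sigma^{*2}\to\infty$ (with $\alpha^*$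 and $r$ fixed), such that, whenever $0\le\gamma<\nu\le L$, the following holds. There is a sequence $(\epsilon_n)$, not depending on the iteration index $t$, with $\epsilon_n\to 0$ almost surely as $n\to\infty$, such that, given any initialization $\theta_0\in\mathbb{B}_2(r;\theta^* )$, with probability at least $1-\delta$ the finite-sample first-order EM iterates $\{\theta_t\}_{t=0}^\infty$ with step size $s=2/(L+\nu)$ satisfy $$\|\theta_t-\theta^*\|_2\le\left(1-\frac{2\nu-2\gamma}{L+\nu}\right)^t\|\theta_0-\theta^*\|_2+\epsilon_n\qquad\text{for all }t.$$
   Context: Notation: $a\vee b=\max\{a,b\}$; $\phi(\cdot\,;m,v)$ is the density of the normal distribution $N(m,v)$ with mean $m$ and variance $v$; $\mathbb{B}_2(r;\theta^* )$ is the Euclidean ($L_2$) ball of radius $r$ centered at $\theta^*$, parameters being understood to lie in $\Omega$. A parameter is written $\theta=(\alpha,\mu,\sigma^2)$, the third coordinate being the variance. Finite-sample first-order EM: for $\theta'=(\alpha',\mu',\sigma'^2)$ let $$w(\theta';\xi)=\frac{\alpha'\phi(\xi;0,\sigma'^2)}{\alpha'\phi(\xi;0,\sigma'^2)+(1-\alpha')\phi(\xi;\mu',\sigma'^2)}$$ be the posterior probability, under $\theta'$, that $\xi$ comes from the zero-mean component. Define $$Q_n(\theta|\theta')=\frac1n\sum_{i=1}^n\Big[w(\theta';\xi_i)\log\big(\alpha\,\phi(\xi_i;0,\sigma^2)\big)+(1-w(\theta';\xi_i))\log\big((1-\alpha)\,\phi(\xi_i;\mu,\sigma^2)\big)\Big].$$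 With step size $s>0$, the finite-sample first-order EM iterates are $$\theta_{t+1}=\theta_t+s\,\nabla Q_n(\theta|\theta_t)\big|_{\theta=\theta_t},\qquad t=0,1,\ldots,$$ where $\nabla$ is the gradient in the first argument $\theta=(\alpha,\mu,\sigma^2)$.
   Formalization: ''ω arbitrarily small'' is read as ω ≤ (1−α* )/2 and ω ≤ 1−α₀ for the initialization (for fixed ω the claim fails as α₀→1), and the probability bound is asserted for all sufficiently large n, uniformly in θ₀ (for small n the iterates can leave the parameter space). *)

(* Defs.v *)
From HB Require Import structures.
From mathcomp Require Import all_boot all_order all_algebra.
From mathcomp Require Import all_classical all_reals all_analysis.

Set Implicit Arguments.
Unset Strict Implicit.
Unset Printing Implicit Defensive.

Import Order.TTheory GRing.Theory Num.Theory.
Import numFieldNormedType.Exports.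

Local Open Scope classical_set_scope.
Local Open Scope ring_scope.

(* A parameter theta = (alpha, mu, sigma^2) is a row vector of R^3; its third
   coordinate [pvar] is the variance, not the standard deviation. *)
Section ParamSpace.
Context {R : realType}.
Implicit Type theta : 'rV[R]_3.

Definition palpha theta : R := theta ord0 (@Ordinal 3 0 isT).
Definition pmu theta : R := theta ord0 (@Ordinal 3 1 isT).
Definition pvar theta : R := theta ord0 (@Ordinal 3 2 isT).

Definition Omega theta : Prop := 2^-1 < palpha theta < 1 /\ 0 < pvar theta.

(* The norm that the library puts on ['rV[R]_3] is the sup norm. *)
Definition norm2 theta : R := Num.sqrt (\sum_i theta ord0 i ^+ 2).

(* Closed Euclidean ball, restricted to the parameter space. *)
Definition ball2 (r : R) (theta_s : 'rV[R]_3) : set 'rV[R]_3 :=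
  [set theta | Omega theta /\ norm2 (theta - theta_s) <= r].

Definition gradient (f : 'rV[R]_3 -> R) theta : 'rV[R]_3 :=
  \row_i 'D_(delta_mx ord0 i) f theta.

End ParamSpace.

Section EM.
Context {R : realType}.
Implicit Types theta : 'rV[R]_3.

(* The library's [normal_pdf] and [normal_prob] take the standard deviation. *)
Definition phi (x m v : R) : R := normal_pdf m (Num.sqrt v) x.

Definition mixture theta (A : set R) : \bar R :=
  ((palpha theta)%:E * normal_prob 0 (Num.sqrt (pvar theta)) A +
   (1 - palpha theta)%:E *
     normal_prob (pmu theta) (Num.sqrt (pvar theta)) A)%E.

Definition weight theta' (x : R) : R :=
  let a := palpha theta' in
  let m := pmu theta' in
  let v := pvar theta' in
  a * phi x 0 v / (a * phi x 0 v + (1 - a) * phi x m v).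

(* [Qn n x theta' theta] is Q_n(theta | theta') for the sample
   x 0, ..., x (n - 1). *)
Definition Qn (n : nat) (x : nat -> R) theta' theta : R :=
  n%:R^-1 * \sum_(i < n)
    (weight theta' (x i) *
       ln (palpha theta * phi (x i) 0 (pvar theta)) +
     (1 - weight theta' (x i)) *
       ln ((1 - palpha theta) * phi (x i) (pmu theta) (pvar theta))).

Definition em_step (s : R) (n : nat) (x : nat -> R) theta : 'rV[R]_3 :=
  theta + s *: gradient (Qn n x theta) theta.

Definition em_iter (s : R) (n : nat) (x : nat -> R) theta0 (t : nat) :
  'rV[R]_3 := iter t (em_step s n x) theta0.

Definition nu_const (r : R) theta : R :=
  let a := palpha theta in
  let v := pvar theta in
  Num.min (Num.max (1 / (a + r) ^+ 2) 1)
    (Num.min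
      ((v - r) / (2 * (v + r) ^+ 3) - (1 - a) * r / (v - r) ^+ 2)
      ((1 - a) / (v + r) - (1 - a) * r / (v - r) ^+ 2)).

Definition L_const (r om : R) theta : R :=
  let a := palpha theta in
  let v := pvar theta in
  Num.max
    (a / Num.max (a - r) 2^-1 ^+ 2 + (1 - a) / Num.max (1 - a - r) om ^+ 2)
    (Num.max
      ((1 - a) * v / (v - r) ^+ 2)
      ((v + r) / (2 * (v - r) ^+ 3) + (1 - a) / (v - r))).

(* [g m v] is O(m^5 / v^4 * exp(- (m - r) / (v + r))) as m / v -> +oo, where
   v > 0 stands for sigma^2, so that sigma^8 = v^4. The bound is uniform in
   (m, v): only the ratio m / v is required to be large. *)
Definition bigO_rate (r : R) (g : R -> R -> R) : Prop :=
  exists C K : R, forall m v : R, 0 < v -> K < m / v ->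
    `|g m v| <= C * `|m ^+ 5 / v ^+ 4 * expR (- ((m - r) / (v + r)))|.

End EM.

Section Sampling.
Context {R : realType} {d : measure_display} {T : measurableType d}
  (P : probability T R).

Definition mutually_independent (X : nat -> {RV P >-> R}) : Prop :=
  forall (J : seq nat) (B : nat -> set R), uniq J ->
    (forall i, measurable (B i)) ->
    P (\bigcap_(i in [set` J]) (X i @^-1` B i)) =
    (\prod_(i <- J) P (X i @^-1` B i))%E.

Definition iid_mixture (X : nat -> {RV P >-> R}) (theta : 'rV[R]_3) : Prop :=
  mutually_independent X /\
  forall i (A : set R), measurable A ->
    distribution P (X i) A = mixture theta A.

(* The set [A] itself is not required to be measurable. *)
Definition with_prob_ge (p : R) (A : set T) : Prop :=
  exists E : set T, [/\ measurable E, E `<=` A & (p%:E <= P E)%E].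

End Sampling.

(* Main.v *)
(* Write the gradient of Q_n at theta through three empirical statistics: the
   means of resp, resp * xi and xi^2, where resp = 1 - w(theta; .).  If these
   equalled their values at theta* (namely b, b mu* and sigma*^2 + b mu*^2 with
   b = 1 - alpha* ), the step would act on theta - theta* as I - s A for an
   explicit symmetric matrix A, whose diagonal dominance puts its spectrum in
   [nu, L]; so it would contract by (L - nu) / (L + nu).  The statistics differ
   from these values in two ways.  The population means of resp and resp * xi
   depend on theta in a Lipschitz way, with a constant that is exponentially
   small in mu*^2 / sigma*^2, since the logistic weight varies only where the
   components overlap; this is the source of gamma.  The sampling error is
   uniformly small by a law of large numbers over a finite net.  Since the
   probability bound is required for each n separately, convergence in
   probability suffices and epsilon_n can be taken deterministic. *)

Require Import Defs.
From HB Require Import structures.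
From mathcomp Require Import all_boot all_order all_algebra.
From mathcomp Require Import all_classical all_reals all_analysis.
From mathcomp Require Import measurable_realfun ring lra.
Set Implicit Arguments.
Unset Strict Implicit.
Unset Printing Implicit Defensive.

Import Order.TTheory GRing.Theory Num.Theory.
Import numFieldNormedType.Exports.
Local Open Scope classical_set_scope.
Local Open Scope ring_scope.

(** * The gradient of the surrogate function *)

(** The overlap is measured by the square root of the odds, not by the odds themselves: under the
    zero-mean component the ratio of the two densities integrates to one however far apart they are,
    while its square root integrates to a factor of order exp(- c mu^2 / sigma^2). For large mu /
    sigma^2 this is far below the rate demanded, and the surplus pays for every polynomial factor in
    mu, coming from the Lipschitz constant of the log odds, from second moments, and from the
    passage from statistics to gradient. Two obstacles shape the rest. The gradient formulas need
    alpha strictly between 0 and 1, and contraction in the Euclidean norm does not ensure this when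
    r is large; hence an invariant region with margin [om], and an extra factor in gamma that keeps
    the perturbation below nu times the available margin. Moreover each iterate is a function of the
    very sample that enters the next step, so a law of large numbers at a fixed parameter says
    nothing about it: the law must hold simultaneously over a compact region that contains all
    iterates. *)

Definition slog {R : realType} (u : R) : R := (1 + expR (- u))^-1.

(** Log posterior odds of the component with mean mu against the zero-mean one. The common variance
    cancels the terms in x^2, so it is affine in x. *)
Definition lodds {R : realType} (t : 'rV[R]_3) (x : R) : R :=
  ln ((1 - palpha t) / palpha t) +
  (2 * pmu t * x - pmu t ^+ 2) / (2 * pvar t).

Definition resp {R : realType} (t : 'rV[R]_3) (x : R) : R := slog (lodds t x).

Definition smean {R : realType} (n : nat) (x : nat -> R) (h : R -> R) : R :=
  n%:R^-1 * \sum_(i < n) h (x i).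

Section LogisticWeight.
Context {R : realType}.
Implicit Types (t : 'rV[R]_3) (x m v : R).

Lemma phiE x m v : 0 < v ->
  phi x m v = (Num.sqrt (v * (2 * pi)))^-1 * expR (- (x - m) ^+ 2 / (2 * v)).
Proof.
move=> v0; rewrite /phi normal_pdfE ?gt_eqF ?sqrtr_gt0// /normal_peak /normal_fun.
rewrite sqr_sqrtr ?ltW//; congr (_ * expR _).
  by rewrite -mulrnAr; congr (Num.sqrt (v * _))^-1; rewrite mulr_natl.
by congr (_ / _); rewrite mulr_natl.
Qed.

Lemma phi_gt0 x m v : 0 < v -> 0 < phi x m v.
Proof.
move=> v0; rewrite phiE// mulr_gt0 ?expR_gt0// invr_gt0 sqrtr_gt0.
by rewrite !mulr_gt0 ?pi_gt0.
Qed.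

Lemma ln_phi x m v : 0 < v ->
  ln (phi x m v) = - (ln v + ln (2 * pi)) / 2 - (x - m) ^+ 2 / (2 * v).
Proof.
move=> v0; have p0 : 0 < v * (2 * pi) :> R by rewrite !mulr_gt0// pi_gt0.
rewrite phiE// [LHS]lnM ?posrE ?invr_gt0 ?sqrtr_gt0 ?expR_gt0// expRK mulNr.
rewrite lnV ?posrE ?sqrtr_gt0// mulNr; congr (_ - _).
have -> : ln (Num.sqrt (v * (2 * pi))) = ln (v * (2 * pi)) / 2 :> R.
  rewrite -[X in ln X / 2](sqr_sqrtr (ltW p0)) lnXn ?sqrtr_gt0//.
  by rewrite mulr2n; field.
by rewrite lnM ?posrE ?mulr_gt0 ?pi_gt0// mulNr.
Qed.

Lemma weightE t x : 0 < palpha t < 1 -> 0 < pvar t ->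
  weight t x = 1 - resp t x.
Proof.
move=> /andP[a0 a1] v0; rewrite /weight /resp /slog /lodds.
set a := palpha t; set m := pmu t; set v := pvar t.
have p0 : 0 < phi x 0 v by exact: phi_gt0.
have pm : 0 < phi x m v by exact: phi_gt0.
have b0 : 0 < 1 - a by rewrite subr_gt0.
have E : expR (- (ln ((1 - a) / a) + (2 * m * x - m ^+ 2) / (2 * v))) =
    a * phi x 0 v / ((1 - a) * phi x m v).
  rewrite opprD expRD expRN lnK ?posrE ?divr_gt0//.
  rewrite !phiE//.
  have s0 : 0 < Num.sqrt (v * (2 * pi)) :> R.
    by rewrite sqrtr_gt0 !mulr_gt0 ?pi_gt0.
  have -> : - ((2 * m * x - m ^+ 2) / (2 * v)) =
     - (x - 0) ^+ 2 / (2 * v) - (- (x - m) ^+ 2 / (2 * v)).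
    by field; rewrite gt_eqF.
  rewrite expRD expRN.
  have := expR_gt0 (- (x - m) ^+ 2 / (2 * v)).
  set e1 := expR (- (x - m) ^+ 2 / (2 * v)); move=> e10.
  by field; rewrite !gt_eqF.
rewrite E; field.
by rewrite !gt_eqF//= ?addr_gt0 ?mulr_gt0.
Qed.

End LogisticWeight.

Section LogLikelihoodDerivative.
Context {R : realType}.
Implicit Types (t : 'rV[R]_3) (x m v : R).

Lemma is_derive_affine (a d : R) :
  is_derive (0 : R) (1 : R) (fun h : R => a + h * d) d.
Proof.
have -> : (fun h : R => a + h * d) = cst a + d \*: (@id R).
  by apply/funext => h /=; rewrite /GRing.scale/= mulrC.
by apply: is_derive_eq; rewrite add0r /GRing.scale/= mulr1.
Qed.

Lemma is_derive_ln_affine (a d : R) : 0 < a ->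
  is_derive (0 : R) (1 : R) (fun h : R => ln (a + h * d)) (d / a).
Proof.
move=> a0; have Ha := is_derive_affine a d.
have Hl : is_derive (a + 0 * d) (1 : R) (@ln R) (a + 0 * d)^-1.
  by apply: is_derive1_ln; rewrite mul0r addr0.
have := @is_derive1_comp R (@ln R) (fun h : R => a + h * d) 0 _ _ Hl Ha.
by rewrite mul0r addr0 mulrC.
Qed.

Lemma is_derive_inv_affine (a d : R) : 0 < a ->
  is_derive (0 : R) (1 : R) (fun h : R => (a + h * d)^-1) (- d / a ^+ 2).
Proof.
move=> a0; have Ha := is_derive_affine a d.
have n0 : a + 0 * d != 0 by rewrite mul0r addr0 gt_eqF.
have := @is_deriveV R (fun h : R => a + h * d) 0 _ _ n0 Ha.
by rewrite mul0r addr0 /GRing.scale/= mulNr [X in - X]mulrC mulNr.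
Qed.

Lemma is_derive_gauss_affine (x m v dm dv : R) : 0 < v ->
  is_derive (0 : R) (1 : R)
    (fun h : R => (x - (m + h * dm)) ^+ 2 / (2 * (v + h * dv)))
    (- (x - m) * dm / v - (x - m) ^+ 2 * dv / (2 * v ^+ 2)).
Proof.
move=> v0; have Hi := is_derive_inv_affine dv v0.
have Hm := is_derive_affine (x - m) (- dm).
have H := is_deriveZ 2^-1 (is_deriveM (is_deriveX 2 Hm) Hi).
have -> : (fun h : R => (x - (m + h * dm)) ^+ 2 / (2 * (v + h * dv))) =
  2^-1 \*: ((fun h : R => x - m + h * - dm) ^+ 2 *
            (fun h : R => (v + h * dv)^-1)).
  apply/funext => h; rewrite !fctE -[RHS]/(_ * _) mulrN opprD addrA invfM.
  by rewrite mulrCA.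
move: H; set d1 := (X in is_derive _ _ _ X -> _) => H.
set d0 := (X in is_derive _ _ _ X); suff <- : d1 = d0 by exact: H.
rewrite /d1 /d0 !fctE !mul0r !addr0 /= -![_ *: _]/(_ * _).
by field; rewrite gt_eqF.
Qed.

(** Restriction to a line turns each partial derivative into a one-variable derivative at 0, to
    which the affine rules above apply. *)
Lemma derive_line (f : 'rV[R]_3 -> R) t w :
  'D_w f t = 'D_(1 : R) (fun h : R => f (h *: w + t)) (0 : R).
Proof.
rewrite /derive; set f1 := (X in lim (X @ _) = _).
set f2 := (X in _ = lim (X @ _)); suff -> : f1 = f2 by [].
apply/funext => h; rewrite /f1 /f2 /=.
by rewrite -![_ *: (1 : R)]/(_ * _) mulr1 !addr0 scale0r add0r.
Qed.

Definition sample_loglik (W x c a m v : R) : R :=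
  W * (ln a - (ln v + c) / 2 - (x - 0) ^+ 2 / (2 * v)) +
  (1 - W) * (ln (1 - a) - (ln v + c) / 2 - (x - m) ^+ 2 / (2 * v)).

Lemma is_derive_sample_loglik (W x c a m v da dm dv : R) : 0 < a < 1 -> 0 < v ->
  is_derive (0 : R) (1 : R)
   (fun h : R => sample_loglik W x c (a + h * da) (m + h * dm) (v + h * dv))
   (W * (da / a) - (1 - W) * (da / (1 - a)) - dv / v / 2
    + (1 - W) * ((x - m) * dm / v)
    + (W * x ^+ 2 + (1 - W) * (x - m) ^+ 2) * dv / (2 * v ^+ 2)).
Proof.
move=> /andP[a0 a1] v0.
have H1 := is_derive_ln_affine da a0.
have b0 : 0 < 1 - a by rewrite subr_gt0.
have H2 := is_derive_ln_affine (- da) b0.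
have H3 := is_derive_ln_affine dv v0.
have H4 := is_derive_gauss_affine x 0 0 dv v0.
have H5 := is_derive_gauss_affine x m dm dv v0.
have Hc := is_derive_cst c (0 : R) (1 : R).
have H3' := is_deriveZ 2^-1 (is_deriveD H3 Hc).
have HA := is_deriveZ W (is_deriveB (is_deriveB H1 H3') H4).
have HB := is_deriveZ (1 - W) (is_deriveB (is_deriveB H2 H3') H5).
have := is_deriveD HA HB.
set f1 := (X in is_derive _ _ X _ -> _); set d1 := (X in is_derive _ _ _ X -> _).
set f2 := (X in _ -> is_derive _ _ X _); set d2 := (X in _ -> is_derive _ _ _ X).
have -> : f1 = f2.
  apply/funext => h; rewrite /f1 /f2 /sample_loglik.
  rewrite -[LHS]/(W * (ln (a + h * da) - 2^-1 * (ln (v + h * dv) + c) -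
     (x - (0 + h * 0)) ^+ 2 / (2 * (v + h * dv))) + (1 - W) *
     (ln (1 - a + h * - da) - 2^-1 * (ln (v + h * dv) + c) -
     (x - (m + h * dm)) ^+ 2 / (2 * (v + h * dv)))).
  have -> : 1 - a + h * - da = 1 - (a + h * da) by ring.
  by rewrite mulr0 addr0 ![2^-1 * _]mulrC.
suff -> : d1 = d2 by [].
rewrite /d1 /d2 -![_ *: _]/(_ * _); field.
by rewrite !gt_eqF.
Qed.

End LogLikelihoodDerivative.

Section QnGradient.
Context {R : realType}.
Implicit Types (t : 'rV[R]_3) (x : nat -> R).

(** The increments [da], [dm], [dv] are the coordinates of the i-th basis vector, so one computation
    serves all three partial derivatives. *)
Lemma gradient_coord n x t (i : 'I_3) (da dm dv : R) :
    0 < palpha t < 1 -> 0 < pvar t ->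
    da = (i == @Ordinal 3 0 isT)%:R -> dm = (i == @Ordinal 3 1 isT)%:R ->
    dv = (i == @Ordinal 3 2 isT)%:R ->
  gradient (Qn n x t) t ord0 i = n%:R^-1 * \sum_(j < n)
   ((1 - resp t (x j)) * (da / palpha t) - resp t (x j) * (da / (1 - palpha t))
     - dv / pvar t / 2 + resp t (x j) * ((x j - pmu t) * dm / pvar t)
     + ((1 - resp t (x j)) * x j ^+ 2 + resp t (x j) * (x j - pmu t) ^+ 2)
       * dv / (2 * pvar t ^+ 2)).
Proof.
move=> a01 v0 daE dmE dvE; rewrite /gradient mxE derive_line.
have [a0 a1] := andP a01.
set a := palpha t in a0 a1 a01 *; set m := pmu t; set v := pvar t in v0 *.
pose c : R := ln (2 * pi).
pose F (h : R) := n%:R^-1 * \sum_(j < n)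
  sample_loglik (1 - resp t (x j)) (x j) c (a + h * da) (m + h * dm) (v + h * dv).
have HF : is_derive (0 : R) (1 : R) F (n%:R^-1 * \sum_(j < n)
   ((1 - resp t (x j)) * (da / a) - resp t (x j) * (da / (1 - a))
     - dv / v / 2 + resp t (x j) * ((x j - m) * dm / v)
     + ((1 - resp t (x j)) * x j ^+ 2 + resp t (x j) * (x j - m) ^+ 2)
       * dv / (2 * v ^+ 2))).
  have H := is_deriveZ n%:R^-1 (is_derive_sum (fun j : 'I_n =>
    is_derive_sample_loglik (1 - resp t (x j)) (x j) c m da dm dv a01 v0)).
  move: H; set f1 := (X in is_derive _ _ X _ -> _).
  set d1 := (X in is_derive _ _ _ X -> _).
  set d2 := (X in _ -> is_derive _ _ _ X).
  have -> : f1 = F.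
    by apply/funext => h; rewrite /f1 /F -[LHS]/(_ * _) fct_sumE.
  suff -> : d1 = d2 by [].
  rewrite /d1 /d2 -[LHS]/(_ * _); congr (_ * _); apply: eq_bigr => j _.
  by rewrite opprB addrCA subrr addr0.
rewrite -[RHS](@derive_val _ _ _ _ _ _ _ HF); apply: near_eq_derive.
(* [Qn] and [F] agree only where each logarithm splits into a sum, so h is kept small enough for
   alpha + h to stay in (0, 1) and for the variance to stay positive. *)
pose e : R := Num.min a (Num.min (1 - a) v).
have e0 : 0 < e by rewrite !lt_min a0 v0 subr_gt0 a1.
have He : \forall h \near (0 : R), `|h| < e by exact: nbhs0_lt.
near=> h.
have he : `|h| < e by near: h; exact: He.
have {he} [ha h1 hv] : [/\ - h < a, h < 1 - a & - h < v].
  move: he; rewrite !lt_min => /and3P[h1 h2 h3]; split.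
  - by rewrite (le_lt_trans _ h1)// -normrN ler_norm.
  - by rewrite (le_lt_trans _ h2)// ler_norm.
  - by rewrite (le_lt_trans _ h3)// -normrN ler_norm.
have A0 : 0 < a + h * da.
  by rewrite daE; case: (_ == _); rewrite ?mulr1 ?mulr0 ?addr0//; lra.
have A1 : a + h * da < 1.
  by rewrite daE; case: (_ == _); rewrite ?mulr1 ?mulr0 ?addr0//; lra.
have V0 : 0 < v + h * dv.
  by rewrite dvE; case: (_ == _); rewrite ?mulr1 ?mulr0 ?addr0//; lra.
have B0 : 0 < 1 - (a + h * da) by lra.
rewrite /F /Qn; congr (_ * _); apply: eq_bigr => j _.
have Ea : palpha (h *: delta_mx ord0 i + t) = a + h * da.
  by rewrite /palpha !mxE addrC daE eq_sym.
have Em : pmu (h *: delta_mx ord0 i + t) = m + h * dm.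
  by rewrite /pmu !mxE addrC dmE eq_sym.
have Ev : pvar (h *: delta_mx ord0 i + t) = v + h * dv.
  by rewrite /pvar !mxE addrC dvE eq_sym.
rewrite Ea Em Ev weightE// /sample_loglik.
rewrite !lnM ?posrE ?phi_gt0// !ln_phi// /c.
by rewrite !mulNr !addrA.
Unshelve. all: by end_near. Qed.

Section Stats.
Variables (n : nat) (x : nat -> R) (t : 'rV[R]_3).
Let S0 := smean n x (resp t).
Let S1 := smean n x (fun y => resp t y * y).
Let S2 := smean n x (fun y => y ^+ 2).
Hypotheses (n0 : (0 < n)%N) (a01 : 0 < palpha t < 1) (v0 : 0 < pvar t).

Let smeanE (f : 'I_n -> R) (A B C K : R) :
  (forall j, f j = A * resp t (x j) + B * (resp t (x j) * x j) +
    C * x j ^+ 2 + K) ->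
  n%:R^-1 * \sum_(j < n) f j = A * S0 + B * S1 + C * S2 + K.
Proof.
move=> fE; rewrite (eq_bigr _ (fun j _ => fE j)).
rewrite !big_split/= -!mulr_sumr sumr_const card_ord !mulrDr.
rewrite /S0 /S1 /S2 /smean -[K *+ n]mulr_natl mulKf ?pnatr_eq0 -?lt0n//.
by rewrite ![n%:R^-1 * (_ * _)]mulrCA.
Qed.

Lemma gradient_alpha : gradient (Qn n x t) t ord0 (@Ordinal 3 0 isT) =
  (1 - palpha t - S0) / (palpha t * (1 - palpha t)).
Proof.
rewrite (@gradient_coord n x t _ 1 0 0)//.
have [a0 a1] := andP a01; have b0 : 0 < 1 - palpha t by rewrite subr_gt0.
rewrite (@smeanE _ (- ((palpha t)^-1 + (1 - palpha t)^-1)) 0 0 (palpha t)^-1).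
  by field; rewrite !gt_eqF.
by move=> j; field; rewrite !gt_eqF.
Qed.

Lemma gradient_mu : gradient (Qn n x t) t ord0 (@Ordinal 3 1 isT) =
  (S1 - pmu t * S0) / pvar t.
Proof.
rewrite (@gradient_coord n x t _ 0 1 0)//.
have [a0 a1] := andP a01; have b0 : 0 < 1 - palpha t by rewrite subr_gt0.
rewrite (@smeanE _ (- (pmu t / pvar t)) (pvar t)^-1 0 0).
  by field; rewrite !gt_eqF.
by move=> j; field; rewrite !gt_eqF.
Qed.

Lemma gradient_var : gradient (Qn n x t) t ord0 (@Ordinal 3 2 isT) =
  (S2 - 2 * pmu t * S1 + pmu t ^+ 2 * S0 - pvar t) / (2 * pvar t ^+ 2).
Proof.
rewrite (@gradient_coord n x t _ 0 0 1)//.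
have [a0 a1] := andP a01; have b0 : 0 < 1 - palpha t by rewrite subr_gt0.
rewrite (@smeanE _ (pmu t ^+ 2 / (2 * pvar t ^+ 2))
  (- (2 * pmu t / (2 * pvar t ^+ 2))) (2 * pvar t ^+ 2)^-1 (- (2 * pvar t)^-1)).
  by field; rewrite !gt_eqF.
by move=> j; field; rewrite !gt_eqF.
Qed.

End Stats.
End QnGradient.

(** * The deterministic iteration *)

Section IdealStep.
Context {R : realType}.

(** Schur test for a symmetric matrix: weighted Cauchy-Schwarz bounds the square of each row by its
    absolute row sum times a weighted sum of squares; adding the rows produces the absolute column
    sums, which by symmetry obey the same bound. No eigenvalue is computed. *)
Lemma schur_test2 (p q w h y z : R) : `|p| + `|q| <= h -> `|q| + `|w| <= h ->
  (p * y + q * z) ^+ 2 + (q * y + w * z) ^+ 2 <= h ^+ 2 * (y ^+ 2 + z ^+ 2).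
Proof.
move=> h1 h2.
have key (c d : R) : (c * y + d * z) ^+ 2 <=
    (`|c| + `|d|) * (`|c| * y ^+ 2 + `|d| * z ^+ 2).
  rewrite -[leLHS]real_normK ?num_real// -[y ^+ 2]real_normK ?num_real//.
  rewrite -[z ^+ 2]real_normK ?num_real//.
  have le1 : `|c * y + d * z| <= `|c| * `|y| + `|d| * `|z|.
    by rewrite -!normrM ler_normD.
  apply: (@le_trans _ _ ((`|c| * `|y| + `|d| * `|z|) ^+ 2)).
    by apply: lerXn2r; rewrite ?nnegrE//; apply: addr_ge0; apply: mulr_ge0.
  rewrite -subr_ge0.
  have -> : (`|c| + `|d|) * (`|c| * `|y| ^+ 2 + `|d| * `|z| ^+ 2) -
     (`|c| * `|y| + `|d| * `|z|) ^+ 2 = `|c| * `|d| * (`|y| - `|z|) ^+ 2 by ring.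
  by apply: mulr_ge0; [exact: mulr_ge0|exact: sqr_ge0].
have k1 := key p q; have k2 := key q w.
have h0 : 0 <= h by apply: le_trans h1; rewrite addr_ge0.
have y2 := sqr_ge0 y; have z2 := sqr_ge0 z.
have [np nq nw] : [/\ 0 <= `|p|, 0 <= `|q| & 0 <= `|w|] by [].
have l1 : (`|p| + `|q|) * (`|p| * y ^+ 2 + `|q| * z ^+ 2) <=
   h * (`|p| * y ^+ 2 + `|q| * z ^+ 2).
  by apply: ler_wpM2r => //; apply: addr_ge0; apply: mulr_ge0.
have l2 : (`|q| + `|w|) * (`|q| * y ^+ 2 + `|w| * z ^+ 2) <=
   h * (`|q| * y ^+ 2 + `|w| * z ^+ 2).
  by apply: ler_wpM2r => //; apply: addr_ge0; apply: mulr_ge0.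
have l3 : (`|p| + `|q|) * y ^+ 2 <= h * y ^+ 2 by rewrite ler_wpM2r.
have l4 : (`|q| + `|w|) * z ^+ 2 <= h * z ^+ 2 by rewrite ler_wpM2r.
have l5 : h * ((`|p| + `|q|) * y ^+ 2 + (`|q| + `|w|) * z ^+ 2) <=
   h * (h * y ^+ 2 + h * z ^+ 2) by rewrite ler_wpM2l// lerD.
lra.
Qed.

Section Consts.
Variables (r om : R) (ts : 'rV[R]_3).
Hypotheses (r0 : 0 < r) (om0 : 0 < om) (Ots : Omega ts).
Hypothesis om_le : om <= (1 - palpha ts) / 2.
Let a := palpha ts.
Let b := 1 - a.
Let V := pvar ts.
Let nu := nu_const r ts.
Let L := L_const r om ts.
Hypothesis nu0 : 0 < nu.

Let a_gt : 2^-1 < a. Proof. by have [/andP[]] := Ots. Qed.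
Let b_gt0 : 0 < b. Proof. by rewrite subr_gt0; have [/andP[]] := Ots. Qed.
Let V_gt0 : 0 < V. Proof. by have [] := Ots. Qed.

Lemma nu_const_bounds :
  [/\ nu <= Num.max (1 / (a + r) ^+ 2) 1,
      nu <= (V - r) / (2 * (V + r) ^+ 3) - b * r / (V - r) ^+ 2 &
      nu <= b / (V + r) - b * r / (V - r) ^+ 2].
Proof. by have := lexx nu; rewrite {2}/nu /nu_const !le_min => /and3P. Qed.

Lemma L_const_bounds :
  [/\ a / Num.max (a - r) 2^-1 ^+ 2 + b / Num.max (b - r) om ^+ 2 <= L,
      b * V / (V - r) ^+ 2 <= L &
      (V + r) / (2 * (V - r) ^+ 3) + b / (V - r) <= L].
Proof. by have := lexx L; rewrite {1}/L /L_const !ge_max => /and3P. Qed.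

Lemma nu_const_le4 : nu <= 4.
Proof.
have [h _ _] := nu_const_bounds; apply: (le_trans h).
rewrite ge_max; apply/andP; split; last by rewrite ler1n.
rewrite ler_pdivrMr; last by rewrite exprn_gt0// addr_gt0// (lt_trans _ a_gt).
have h1 : 2^-1 <= a + r by rewrite (le_trans (ltW a_gt))// lerDl ltW.
have h2 : (2^-1 : R) ^+ 2 <= (a + r) ^+ 2.
  by rewrite lerXn2r ?nnegrE// (le_trans _ h1).
by lra.
Qed.

(** The second entry of nu cannot be positive when V <= r. Then positivity of the third reads (V -
    r)^2 > r (V + r), that is, V (V - 3 r) > 0. *)
Lemma var_gt3r : 3 * r < V.
Proof.
have [_ h2 h3] := nu_const_bounds.
have Vr : r < V.
  have p3 : 0 < (V + r) ^+ 3 by rewrite exprn_gt0// addr_gt0.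
  rewrite ltNge; apply/negP => Vr.
  have : nu <= 0.
    apply: (le_trans h2); rewrite subr_le0; apply: (@le_trans _ _ 0).
      by rewrite mulr_le0_ge0 ?subr_le0// invr_ge0 mulr_ge0// ltW.
    by rewrite !mulr_ge0 ?invr_ge0 ?sqr_ge0// ltW.
  by rewrite leNgt nu0.
have p2 : 0 < (V - r) ^+ 2 by rewrite exprn_gt0// subr_gt0.
have p1 : 0 < V + r by rewrite addr_gt0.
have := lt_le_trans nu0 h3; rewrite subr_gt0 -mulrA ltr_pM2l//.
rewrite ltr_pdivrMr// mulrC ltr_pdivlMr// => h.
have : 0 < V * (V - 3 * r) by move: h; lra.
by rewrite pmulr_rgt0// subr_gt0.
Qed.

(** Split 1 / (al (1 - al)) as 1 / al + 1 / (1 - al), and compare each term with the matching one of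
    L through 1 / y <= c / e^2 for e <= y <= c. When y lies beyond the true coordinate c, first
    replace it by c. *)
Lemma alpha_secant_le al : om <= al <= 1 - om -> `|al - a| <= r ->
  (al * (1 - al))^-1 <= L.
Proof.
move=> /andP[ol lo] ar; have [h1 _ _] := L_const_bounds; apply: le_trans h1.
have [b0 ag] := (b_gt0, a_gt); have om1 : om <= b / 2 := om_le.
have ba : b = 1 - a by [].
have om0' := om0.
have aux x : 2^-1 <= x <= 1 - om -> `|x - a| <= r -> (x * (1 - x))^-1 <=
   a / Num.max (a - r) 2^-1 ^+ 2 + b / Num.max (b - r) om ^+ 2.
  move=> /andP[x1 x2] xr.
  have x0 : 0 < x by apply: lt_le_trans x1.
  have y0 : 0 < 1 - x by move: x2 om0; lra.
  have [xr1 xr2] : x - a <= r /\ a - x <= r.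
    by split; [rewrite (le_trans (ler_norm _))|rewrite distrC in xr;
      rewrite (le_trans (ler_norm _))].
  have -> : (x * (1 - x))^-1 = x^-1 + (1 - x)^-1 by field; rewrite !gt_eqF.
  have m1 : 0 < Num.max (a - r) 2^-1 by rewrite lt_max invr_gt0 ltr0n orbT.
  have m2 : 0 < Num.max (b - r) om by rewrite lt_max om0 orbT.
  have sq (c e y : R) : 0 < e -> 0 < y -> e <= y -> y <= c -> y^-1 <= c / e ^+ 2.
    move=> e0 yy ey yc; rewrite ler_pdivlMr ?exprn_gt0// ler_pdivrMl//.
    rewrite expr2; apply: ler_pM => //; [exact: ltW|exact: ltW|].
    exact: le_trans yc.
  have rr := r0; have oo := om0.
  have [xa|ax] := leP x a.
    apply: lerD.
      by apply: sq => //; rewrite ge_max x1 andbT; lra.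
    apply: (@le_trans _ _ b^-1); first by rewrite lef_pV2 ?posrE//; lra.
    by apply: sq => //; rewrite ge_max; apply/andP; split; lra.
  have a0 : 0 < a by lra.
  apply: lerD.
    apply: (@le_trans _ _ a^-1); first by rewrite lef_pV2 ?posrE//; lra.
    by apply: sq => //; rewrite ge_max; apply/andP; split; lra.
  apply: sq => //; last lra.
  by rewrite ge_max; apply/andP; split; lra.
have [a2|a2] := leP 2^-1 al; first by apply: aux => //; apply/andP.
(* The expression is symmetric under al -> 1 - al, and since al < 1/2 < a the reflected point is no
   farther from a. *)
have -> : al * (1 - al) = (1 - al) * (1 - (1 - al)) by ring.
apply: aux; first by apply/andP; split; lra.
have a3 : 0 <= a - al by lra.
move: ar; rewrite (distrC al) (ger0_norm a3) => ar.
by rewrite ler_norml; apply/andP; split; lra.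
Qed.

(** The two sides meet at 4, the minimum of 1 / (al (1 - al)) over (0, 1). *)
Lemma alpha_secant_ge al : 0 < al < 1 -> nu <= (al * (1 - al))^-1.
Proof.
move=> /andP[h0 h1]; apply: (le_trans nu_const_le4).
rewrite -[leLHS]invrK lef_pV2 ?posrE ?invr_gt0 ?mulr_gt0 ?subr_gt0//.
have := sqr_ge0 (al - 2^-1); lra.
Qed.

Variables (s : R).
Hypothesis (s0 : 0 < s).
Hypothesis (sE : s * (L + nu) = 2).
Let kap := 1 - s * nu.

(** By [sE] the factor [kap] is both 1 - s nu and s L - 1, so |1 - s x| <= kap for every x in
    [nu, L]. *)
Lemma alpha_contract al : om <= al <= 1 - om -> `|al - a| <= r ->
  `|1 - s / (al * (1 - al))| <= kap.
Proof.
move=> h ar; have h1 := alpha_secant_le h ar.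
have h2 : nu <= (al * (1 - al))^-1.
  by apply: alpha_secant_ge; move: h => /andP[]; have := om0; lra.
have h3 : s * (al * (1 - al))^-1 <= s * L by rewrite ler_pM2l.
have h4 : s * nu <= s * (al * (1 - al))^-1 by rewrite ler_pM2l.
by rewrite ler_norml /kap; apply/andP; split; move: sE h3 h4; lra.
Qed.

Lemma muvar_contract v y : V - r <= v <= V + r -> `|y| <= r ->
  (y - s * (b * y / v)) ^+ 2 +
  (v - V + s * ((V + b * y ^+ 2 - v) / (2 * v ^+ 2))) ^+ 2
  <= kap ^+ 2 * (y ^+ 2 + (v - V) ^+ 2).
Proof.
move=> /andP[v1 v2] yr; have V3 := var_gt3r; have rr := r0.
have b1 : b <= 1 by rewrite lerBlDr lerDl (le_trans _ (ltW a_gt)).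
have bb := b_gt0.
have vr : 0 < v by lra.
have Vr : 0 < V - r by lra.
pose z := v - V.
pose i2 := (2 * v ^+ 2)^-1.
have i20 : 0 < i2 by rewrite invr_gt0 mulr_gt0// exprn_gt0.
(* The increment is (I - s A) (y, z) for A = [[A11, A12], [A12, i2]]: a
   symmetric secant matrix in closed form, instead of an averaged Hessian. *)
pose A11 := b / v + b * z * i2.
pose A12 := - (b * y * i2).
have [_ hn2 hn3] := nu_const_bounds.
have [_ hl2 hl3] := L_const_bounds.
pose w := (V - r)^-1.
have w0 : 0 < w by rewrite invr_gt0.
have vw : v^-1 <= w by rewrite lef_pV2 ?posrE.
have uv : (V + r)^-1 <= v^-1 by rewrite lef_pV2 ?posrE//; lra.
have vi0 : 0 < v^-1 by rewrite invr_gt0.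
have i2E : i2 = 2^-1 * v^-1 ^+ 2 by rewrite /i2 invfM exprVn.
have v2w : v^-1 ^+ 2 <= w ^+ 2.
  by apply: lerXn2r => //; rewrite nnegrE ltW.
have u2v : (V + r)^-1 ^+ 2 <= v^-1 ^+ 2.
  by apply: lerXn2r => //; rewrite nnegrE ltW// invr_gt0; lra.
have zr : `|z| <= r by rewrite ler_norml /z; apply/andP; split; lra.
have rw : r * w <= 2^-1 by rewrite ler_pdivrMr//; lra.
(* These are the corrections b r / (V - r)^2 in [nu_const]: y and z are at most r in absolute value
   and [i2] carries a factor 1/2. The first row deviates from b / v by both terms, the second from
   [i2] by the off-diagonal one alone. *)
have HA : `|b * z * i2| + `|b * y * i2| <= b * r * w ^+ 2.
  rewrite !normrM !(gtr0_norm bb) (gtr0_norm i20).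
  have e1 : b * `|z| * i2 <= b * r * i2 by rewrite ler_pM2r// ler_pM2l.
  have e2 : b * `|y| * i2 <= b * r * i2 by rewrite ler_pM2r// ler_pM2l.
  have : b * r * v^-1 ^+ 2 <= b * r * w ^+ 2 by rewrite ler_pM2l// mulr_gt0.
  by move: e1 e2; rewrite i2E; lra.
have HB : `|b * y * i2| <= 2^-1 * (b * r * w ^+ 2).
  rewrite !normrM (gtr0_norm bb) (gtr0_norm i20).
  have e2 : b * `|y| * i2 <= b * r * i2 by rewrite ler_pM2r// ler_pM2l.
  have : b * r * v^-1 ^+ 2 <= b * r * w ^+ 2 by rewrite ler_pM2l// mulr_gt0.
  by move: e2; rewrite i2E; lra.
have brw : 0 < b * r * w ^+ 2 by rewrite !mulr_gt0// exprn_gt0.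
have nA12 : `|A12| = `|b * y * i2| by rewrite normrN.
have lo1 : nu <= A11 - `|A12|.
  rewrite nA12 /A11; apply: (le_trans hn3).
  have e : b * (V + r)^-1 <= b * v^-1 by rewrite ler_pM2l.
  have := ler_norm (- (b * z * i2)); rewrite normrN.
  by move: HA e; rewrite /w -exprVn; lra.
have lo2 : nu <= i2 - `|A12|.
  rewrite nA12; apply: (le_trans hn2).
  have e : (V - r) / (2 * (V + r) ^+ 3) <= 2^-1 * (V + r)^-1 ^+ 2.
    have q0 : 0 < (V + r)^-1 by rewrite invr_gt0; lra.
    have q1 : (V - r) * (V + r)^-1 <= 1 by rewrite ler_pdivrMr; lra.
    have -> : (V - r) / (2 * (V + r) ^+ 3) =
        ((V - r) * (V + r)^-1) * (2^-1 * (V + r)^-1 ^+ 2).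
      by field; rewrite gt_eqF// -invr_gt0.
    by apply: ler_piMl => //; apply: mulr_ge0; rewrite // exprn_ge0// ltW.
  by move: HB e u2v brw; rewrite i2E /w -exprVn; lra.
have hi1 : A11 + `|A12| <= L.
  rewrite nA12 /A11; apply: le_trans hl2.
  have e : b * v^-1 <= b * w by rewrite ler_pM2l.
  have -> : b * V / (V - r) ^+ 2 = b * w + b * r * w ^+ 2.
    by rewrite /w; field; rewrite gt_eqF.
  have := ler_norm (b * z * i2).
  by move: HA e; lra.
have hi2 : i2 + `|A12| <= L.
  rewrite nA12; apply: le_trans hl3.
  have e : 2^-1 * w ^+ 2 <= (V + r) / (2 * (V - r) ^+ 3).
    have -> : (V + r) / (2 * (V - r) ^+ 3) = ((V + r) * w) * (2^-1 * w ^+ 2).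
      by rewrite /w; field; rewrite gt_eqF.
    apply: ler_peMl; first by apply: mulr_ge0; rewrite // exprn_ge0// ltW.
    by rewrite ler_pdivlMr//; lra.
  have e2 : b * r * w ^+ 2 <= b * w.
    have -> : b * r * w ^+ 2 = (b * w) * (r * w) by ring.
    by rewrite ler_piMr ?mulr_ge0 ?ltW//; lra.
  have bw : 0 < b * w by rewrite mulr_gt0.
  by move: HB e e2 v2w bw; rewrite i2E -/w; lra.
have E1 : y - s * (b * y / v) = (1 - s * A11) * y + (- s * A12) * z.
  by rewrite /A11 /A12 /z; field; rewrite /i2 !gt_eqF// ?mulr_gt0// exprn_gt0.
have E2 : v - V + s * ((V + b * y ^+ 2 - v) / (2 * v ^+ 2)) =
   (- s * A12) * y + (1 - s * i2) * z.
  by rewrite /A12 /z /i2; field; rewrite !gt_eqF// ?mulr_gt0// exprn_gt0.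
rewrite E1 E2 -/z.
have side A : nu <= A - `|A12| -> A + `|A12| <= L ->
    `|1 - s * A| + `|- s * A12| <= kap.
  move=> lo hi; rewrite normrM normrN (gtr0_norm s0).
  have e1 : s * nu <= s * (A - `|A12|) by rewrite ler_pM2l.
  have e2 : s * (A + `|A12|) <= s * L by rewrite ler_pM2l.
  have : `|1 - s * A| <= kap - s * `|A12|.
    by rewrite ler_norml /kap; apply/andP; split; move: sE e1 e2; lra.
  lra.
apply: schur_test2; first exact: side.
by rewrite addrC; apply: side.
Qed.

End Consts.
End IdealStep.

(** * The Euclidean norm of a parameter *)

Section Norm2.
Context {R : realType}.
Implicit Types t u : 'rV[R]_3.

Lemma norm2E t :
  norm2 t = Num.sqrt (palpha t ^+ 2 + pmu t ^+ 2 + pvar t ^+ 2).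
Proof.
rewrite /norm2 !big_ord_recl big_ord0 addr0 addrA; congr (Num.sqrt (_ + _ + _)).
- by congr (t _ _ ^+ 2); apply: val_inj.
- by congr (t _ _ ^+ 2); apply: val_inj.
- by congr (t _ _ ^+ 2); apply: val_inj.
Qed.

Lemma norm2_ge0 t : 0 <= norm2 t.
Proof. exact: sqrtr_ge0. Qed.

Lemma sqr_norm2 t :
  norm2 t ^+ 2 = palpha t ^+ 2 + pmu t ^+ 2 + pvar t ^+ 2.
Proof. by rewrite norm2E sqr_sqrtr// !addr_ge0 ?sqr_ge0. Qed.

Lemma norm2_le_sum t : norm2 t <= `|palpha t| + `|pmu t| + `|pvar t|.
Proof.
rewrite -(@ler_pXn2r _ 2)// ?nnegrE ?norm2_ge0 ?addr_ge0// sqr_norm2.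
rewrite -[palpha t ^+ 2]real_normK ?num_real// -[pmu t ^+ 2]real_normK ?num_real//.
rewrite -[pvar t ^+ 2]real_normK ?num_real//.
have h1 : 0 <= `|palpha t| * `|pmu t| by exact: mulr_ge0.
have h2 : 0 <= `|palpha t| * `|pvar t| by exact: mulr_ge0.
have h3 : 0 <= `|pmu t| * `|pvar t| by exact: mulr_ge0.
by lra.
Qed.

Lemma coord_le_norm2 t :
  [/\ `|palpha t| <= norm2 t, `|pmu t| <= norm2 t & `|pvar t| <= norm2 t].
Proof.
have h := sqr_norm2 t; have N := norm2_ge0 t.
have [h1 h2 h3] := And3 (sqr_ge0 (palpha t)) (sqr_ge0 (pmu t)) (sqr_ge0 (pvar t)).
by split; rewrite -(@ler_pXn2r _ 2)// ?nnegrE// real_normK ?num_real//; lra.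
Qed.

Lemma norm2_triangle t u : norm2 (t + u) <= norm2 t + norm2 u.
Proof.
rewrite -(@ler_pXn2r _ 2)// ?nnegrE ?norm2_ge0 ?addr_ge0 ?norm2_ge0//.
have ht := sqr_norm2 t; have hu := sqr_norm2 u.
rewrite sqrrD sqr_norm2 /palpha /pmu /pvar !mxE -/(palpha t) -/(palpha u).
rewrite -/(pmu t) -/(pmu u) -/(pvar t) -/(pvar u).
have : palpha t * palpha u + pmu t * pmu u + pvar t * pvar u <=
    norm2 t * norm2 u.
  have [|] := leP (palpha t * palpha u + pmu t * pmu u + pvar t * pvar u) 0.
    by move=> /le_trans; apply; rewrite mulr_ge0// norm2_ge0.
  move=> h0; rewrite -(@ler_pXn2r _ 2)// ?nnegrE ?(ltW h0)//; last first.
    by rewrite mulr_ge0// norm2_ge0.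
  rewrite exprMn ht hu.
  have := sqr_ge0 (palpha t * pmu u - pmu t * palpha u).
  have := sqr_ge0 (palpha t * pvar u - pvar t * palpha u).
  have := sqr_ge0 (pmu t * pvar u - pvar t * pmu u).
  by lra.
by move: ht hu; lra.
Qed.

Lemma norm2Z (s : R) t : 0 <= s -> norm2 (s *: t) = s * norm2 t.
Proof.
move=> s0; rewrite -[s in RHS](ger0_norm s0) -sqrtr_sqr /norm2 -sqrtrM ?sqr_ge0//.
by rewrite mulr_sumr; congr Num.sqrt; apply: eq_bigr => i _; rewrite mxE exprMn.
Qed.

Lemma palphaB t u : palpha (t - u) = palpha t - palpha u.
Proof. by rewrite /palpha !mxE. Qed.

Lemma pmuB t u : pmu (t - u) = pmu t - pmu u.
Proof. by rewrite /pmu !mxE. Qed.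

Lemma pvarB t u : pvar (t - u) = pvar t - pvar u.
Proof. by rewrite /pvar !mxE. Qed.

End Norm2.

(** Errors of the three statistics turned into errors of the gradient coordinates. The margin gives
    al (1 - al) >= om (1 - om) >= om / 2, and 1 + |mu| <= M absorbs the coefficients of the other
    two numerators, which sum to 1 + |mu| and (1 + |mu|)^2. *)
Lemma stat_error_bounds {R : realFieldType} (om r m al mu v w0 w1 w2 e : R) :
    0 < om -> om <= 4^-1 -> 0 < r ->
    om <= al <= 1 - om -> `|mu - m| <= r -> 2 * r <= v ->
    `|w0| <= e -> `|w1| <= e -> `|w2| <= e ->
    let M := 1 + `|m| + r in
  [/\ `|- w0 / (al * (1 - al))| <= 2 / om * e,
      `|(w1 - mu * w0) / v| <= M / r * e &
      `|(w2 - 2 * mu * w1 + mu ^+ 2 * w0) / (2 * v ^+ 2)| <= (M / r) ^+ 2 * e].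
Proof.
move=> om0 om4 r0 /andP[al1 al2] hmr v2r c0 c1 c2 M.
have e0 : 0 <= e by apply: le_trans c0.
have v0 : 0 < v by apply: lt_le_trans v2r; rewrite mulr_gt0.
have M1 : 1 <= M by rewrite /M -addrA lerDl addr_ge0// ltW.
have mum1 : 1 + `|mu| <= M.
  rewrite /M -addrA lerD2l -lerBlDl (le_trans _ hmr)//.
  exact: lerB_dist.
have mu1 : 0 <= 1 + `|mu| by rewrite addr_ge0.
split.
- have al0 : 0 < al by apply: lt_le_trans al1.
  have be0 : 0 < 1 - al by move: al2; clear -om0; lra.
  rewrite normrM normrN normfV (gtr0_norm (mulr_gt0 al0 be0)).
  rewrite ler_pdivrMr ?mulr_gt0//; apply: (le_trans c0).
  rewrite mulrAC; apply: ler_peMl => //.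
  rewrite mulrAC ler_pdivlMr// mul1r.
  have p1 : 0 <= al - om by rewrite subr_ge0.
  have p2 : 0 <= 1 - al - om by move: al2; clear; lra.
  have p3 : 0 <= om * (4^-1 - om).
    by apply: mulr_ge0; [exact: ltW|rewrite subr_ge0].
  by have := mulr_ge0 p1 p2; move: p3; clear -om0; lra.
- rewrite normrM normfV (gtr0_norm v0) ler_pdivrMr//.
  have h : `|w1 - mu * w0| <= M * e.
    rewrite (le_trans (ler_normB _ _))// normrM.
    have : `|mu| * `|w0| <= `|mu| * e by exact: ler_wpM2l.
    have : (1 + `|mu|) * e <= M * e by exact: ler_wpM2r.
    by move: c1; clear; lra.
  apply: (le_trans h).
  have -> : M / r * e * v = M * e * (v / r) by ring.
  apply: ler_peMr; first by rewrite mulr_ge0// (le_trans _ M1).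
  by rewrite ler_pdivlMr// mul1r (le_trans _ v2r)//; move: r0; clear; lra.
- have v20 : 0 < 2 * v ^+ 2 by rewrite mulr_gt0// exprn_gt0.
  rewrite normrM normfV (gtr0_norm v20) ler_pdivrMr//.
  have h : `|w2 - 2 * mu * w1 + mu ^+ 2 * w0| <= M ^+ 2 * e.
    rewrite (le_trans (ler_normD _ _))//.
    rewrite (le_trans (lerD (ler_normB _ _) (lexx _)))//.
    rewrite [in X in _ + X <= _]normrM normrX [`|2 * mu * w1|]normrM.
    rewrite [`|2 * mu|]normrM (ger0_norm (ler0n R 2)).
    have h1 : 2 * `|mu| * `|w1| <= 2 * `|mu| * e by rewrite ler_wpM2l// mulr_ge0.
    have h2 : `|mu| ^+ 2 * `|w0| <= `|mu| ^+ 2 * e by rewrite ler_wpM2l// exprn_ge0.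
    have h3 : (1 + `|mu|) ^+ 2 * e <= M ^+ 2 * e.
      apply: ler_wpM2r => //; apply: lerXn2r => //.
      by rewrite nnegrE (le_trans _ M1).
    by move: h1 h2 h3 c2; clear; lra.
  apply: (le_trans h); rewrite exprMn exprVn.
  have -> : M ^+ 2 / r ^+ 2 * e * (2 * v ^+ 2) =
    (M ^+ 2 * e) * (2 * (v / r) ^+ 2) by field; rewrite gt_eqF.
  apply: ler_peMr; first by rewrite mulr_ge0// sqr_ge0.
  have : 1 <= (v / r) ^+ 2.
    by rewrite exprn_ege1// ler_pdivlMr//; move: v2r r0; clear; lra.
  by clear; lra.
Qed.

(** * The step with inexact statistics and its invariant region *)

Section NoisyStep.
Context {R : realType}.
Variables (r om : R) (ts : 'rV[R]_3).
Let a := palpha ts.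
Let b := 1 - a.
Let m := pmu ts.
Let V := pvar ts.
Let nu := nu_const r ts.
Let L := L_const r om ts.

(** The constraint 1/2 < alpha of [Omega] is replaced by a margin [om] on both sides, which keeps
    log odds and gradient bounded. *)
Definition em_domain : set 'rV[R]_3 :=
  [set t | norm2 (t - ts) <= r /\ om <= palpha t <= 1 - om].

(** [lam] bounds the drift of the population means with t, [eta] the sampling error. The third
    statistic does not depend on t; it receives the same bound for uniformity. *)
Definition stats_close (n : nat) (x : nat -> R) (lam eta : R) : Prop :=
  forall t, em_domain t ->
  [/\ `|smean n x (resp t) - b| <= lam * norm2 (t - ts) + eta,
      `|smean n x (fun y => resp t y * y) - b * m| <=
        lam * norm2 (t - ts) + eta &
      `|smean n x (fun y => y ^+ 2) - (V + b * m ^+ 2)| <= 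
        lam * norm2 (t - ts) + eta].

(** Sum of the three factors of [stat_error_bounds], matching [norm2_le_sum]. *)
Definition noise_gain : R :=
  2 / om + (1 + `|m| + r) / r + ((1 + `|m| + r) / r) ^+ 2.

Hypotheses (r0 : 0 < r) (om0 : 0 < om) (Ots : Omega ts).
Hypothesis om_le : om <= (1 - palpha ts) / 2.
Hypotheses (nu0 : 0 < nu) (nuL : nu <= L).

Let a_gt : 2^-1 < a. Proof. by have [/andP[]] := Ots. Qed.
Let b_gt0 : 0 < b. Proof. by rewrite subr_gt0; have [/andP[]] := Ots. Qed.
Let V3r : 3 * r < V. Proof. exact: var_gt3r. Qed.
Let om_b : om <= b / 2. Proof. exact: om_le. Qed.

Lemma noise_gain_ge0 : 0 <= noise_gain.
Proof.
have m0 : 0 <= 1 + `|m| + r by rewrite !addr_ge0// ltW.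
by rewrite /noise_gain !addr_ge0 ?sqr_ge0// divr_ge0// ltW.
Qed.

Lemma em_domainP t : em_domain t ->
  [/\ om <= palpha t <= 1 - om, `|palpha t - a| <= r, `|pmu t - m| <= r &
      V - r <= pvar t <= V + r].
Proof.
move=> [tr tom]; have [h1 h2 h3] := coord_le_norm2 (t - ts).
move: h1 h2 h3; rewrite palphaB pmuB pvarB -/V => h1 h2 h3; split => //.
- exact: le_trans tr.
- exact: le_trans tr.
- by move: (le_trans h3 tr); rewrite ler_norml => /andP[? ?]; apply/andP; split; lra.
Qed.

Variables (n : nat) (x : nat -> R) (s : R).
Hypotheses (n0 : (0 < n)%N) (s0 : 0 < s) (sE : s * (L + nu) = 2).
Let kap := 1 - s * nu.

Let snu1 : s * nu <= 1.
Proof.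
have h : s * nu <= s * L by rewrite ler_pM2l.
by move: sE; rewrite mulrDr; lra.
Qed.

(** The second conjunct isolates alpha because its range has to be preserved, which the norm bound
    alone does not give. *)
Lemma em_step_bound t lam eta : em_domain t -> stats_close n x lam eta ->
  let e := lam * norm2 (t - ts) + eta in
  norm2 (em_step s n x t - ts) <= kap * norm2 (t - ts) + s * (noise_gain * e) /\
  `|palpha (em_step s n x t) - a -
    (palpha t - a) * (1 - s / (palpha t * (1 - palpha t)))| <=
  s * (noise_gain * e).
Proof.
move=> Dt close e; have [hom har hmr hvr] := em_domainP Dt.
have [c0 c1 c2] := close t Dt; rewrite -/e in c0 c1 c2.
have rr := r0; have VV := V3r; have oo := om0; have ob := om_b.
have [[al1 al2] [v1 v2]] := (andP hom, andP hvr).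
set al := palpha t in hom har al1 al2 *; set mu := pmu t in hmr *.
set v := pvar t in hvr v1 v2 *.
have e0 : 0 <= e by apply: le_trans c0.
have al0 : 0 < al by lra.
have be0 : 0 < 1 - al by lra.
have v0 : 0 < v by lra.
have al01 : 0 < al < 1 by apply/andP; split; lra.
set S0 := smean n x (resp t) in c0 *.
set S1 := smean n x (fun y => resp t y * y) in c1 *.
set S2 := smean n x (fun y => y ^+ 2) in c2 *.
pose w0 := S0 - b; pose w1 := S1 - b * m; pose w2 := S2 - (V + b * m ^+ 2).
(* [E] is the part of the gradient caused by the errors of the statistics; [I] is the displacement
   from [ts] that a step with exact statistics would give. *)
pose q i : R := if i == 0%N then - w0 / (al * (1 - al)) else
  if i == 1%N then (w1 - mu * w0) / v else
  (w2 - 2 * mu * w1 + mu ^+ 2 * w0) / (2 * v ^+ 2).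
pose E : 'rV[R]_3 := \row_i q i.
pose I := em_step s n x t - ts - s *: E.
have Ea : palpha E = - w0 / (al * (1 - al)) by rewrite /palpha mxE.
have Em : pmu E = (w1 - mu * w0) / v by rewrite /pmu mxE.
have Ev : pvar E = (w2 - 2 * mu * w1 + mu ^+ 2 * w0) / (2 * v ^+ 2).
  by rewrite /pvar mxE.
have sa : palpha (em_step s n x t) =
    al + s * ((1 - al - S0) / (al * (1 - al))).
  by rewrite /palpha !mxE -(gradient_alpha x n0 al01 v0) /gradient mxE.
have sm : pmu (em_step s n x t) = mu + s * ((S1 - mu * S0) / v).
  by rewrite /pmu !mxE -(gradient_mu x n0 al01 v0) /gradient mxE.
have sv : pvar (em_step s n x t) =
    v + s * ((S2 - 2 * mu * S1 + mu ^+ 2 * S0 - v) / (2 * v ^+ 2)).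
  by rewrite /pvar !mxE -(gradient_var x n0 al01 v0) /gradient mxE.
have Ia : palpha I = (al - a) * (1 - s / (al * (1 - al))).
  rewrite /I 2!palphaB sa [palpha (s *: E)]mxE -/(palpha E) Ea /w0 -/a /b.
  by field; rewrite !gt_eqF.
have Im : pmu I = (mu - m) - s * (b * (mu - m) / v).
  rewrite /I 2!pmuB sm [pmu (s *: E)]mxE -/(pmu E) Em /w1 /w0 -/m.
  by field; rewrite !gt_eqF.
have Iv : pvar I =
    v - V + s * ((V + b * (mu - m) ^+ 2 - v) / (2 * v ^+ 2)).
  rewrite /I 2!pvarB sv [pvar (s *: E)]mxE -/(pvar E) Ev /w2 /w1 /w0 -/V.
  by field; rewrite !gt_eqF.
have kap0 : 0 <= kap by rewrite /kap subr_ge0.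
have nI : norm2 I <= kap * norm2 (t - ts).
  rewrite -(@ler_pXn2r _ 2)// ?nnegrE ?mulr_ge0 ?norm2_ge0// exprMn !sqr_norm2.
  rewrite Ia Im Iv palphaB pmuB pvarB -/al -/mu -/v -/a -/m -/V.
  have h1 : `|1 - s / (al * (1 - al))| <= kap.
    exact: (alpha_contract r0 om0 Ots om_le s0 sE hom har).
  have := muvar_contract r0 Ots nu0 s0 sE hvr hmr.
  have : ((al - a) * (1 - s / (al * (1 - al)))) ^+ 2 <=
      kap ^+ 2 * (al - a) ^+ 2.
    rewrite exprMn mulrC ler_wpM2r ?sqr_ge0//.
    by rewrite -[leLHS]real_normK ?num_real//; apply: lerXn2r; rewrite ?nnegrE.
  rewrite -/nu -/kap -/V -/b; lra.
have om4 : om <= 4^-1 by move: a_gt; rewrite /b in ob; lra.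
have v2r : 2 * r <= v by lra.
have [nga ngm ngv] := stat_error_bounds om0 om4 r0 hom hmr v2r c0 c1 c2.
rewrite -/w0 -/w1 -/w2 -/b -/m -/V in nga ngm ngv.
rewrite -Ea in nga; rewrite -Em in ngm; rewrite -Ev in ngv.
have nE : norm2 E <= noise_gain * e.
  apply: (le_trans (norm2_le_sum E)); rewrite /noise_gain 2!mulrDl.
  exact: (lerD (lerD nga ngm) ngv).
have stepE : em_step s n x t - ts = I + s *: E by rewrite /I subrK.
split.
  rewrite stepE (le_trans (norm2_triangle _ _))// (norm2Z _ (ltW s0)).
  by apply: lerD => //; rewrite ler_pM2l.
have -> : palpha (em_step s n x t) - a - (al - a) * (1 - s / (al * (1 - al))) =
    palpha (s *: E).
  rewrite -Ia /I 2!palphaB -/a; ring.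
rewrite [palpha (s *: E)]mxE -/(palpha E) normrM (gtr0_norm s0) ler_pM2l//.
by apply: le_trans nE; have [] := coord_le_norm2 E.
Qed.

Definition em_invariant t := em_domain t /\
  (2^-1 <= palpha t \/ a - (b - om) <= palpha t).

Variables (g lam eta : R).
Hypotheses (g0 : 0 <= g) (gnu : g < nu).
Hypothesis (lam0 : 0 <= lam).
Hypothesis (close : stats_close n x lam eta).
Let G := noise_gain * lam.
Let H := noise_gain * eta.
Hypothesis (Gg : G <= g).
Hypothesis (GH : G * r + H <= nu * (b - om)).
Hypothesis (H0 : 0 <= H).
Hypothesis (Hr : H <= (nu - g) * r).
Let rho := 1 - s * (nu - g).

(* If |al - a| > b - om then al is on the left of a and r > b - om, so that
   L >= b / om^2 makes s too small to overshoot a; otherwise the contraction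
   keeps al below 1 - om.  The lower part of the invariant is only needed to
   stay above om, as al may leave Omega through 1/2. *)
Let alpha_step_bound (al al' : R) : om <= al <= 1 - om -> `|al - a| <= r ->
    2^-1 <= al \/ a - (b - om) <= al ->
    `|al' - a - (al - a) * (1 - s / (al * (1 - al)))| <= s * (nu * (b - om)) ->
  om <= al' <= 1 - om /\ (2^-1 <= al' \/ a - (b - om) <= al').
Proof.
move=> hom har hor hal.
have [al1 al2] := andP hom.
have aa := a_gt; have bb := b_gt0; have ob := om_b; have oo := om0.
have ab : a = 1 - b by rewrite /b; ring.
have con := alpha_contract r0 om0 Ots om_le s0 sE hom har.
rewrite -/nu -/kap in con.
set f := 1 - _ in con hal; rewrite mulrA in hal.
have [hal1 hal2] : al' - a - (al - a) * f <= s * nu * (b - om) /\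
    - (s * nu * (b - om)) <= al' - a - (al - a) * f.
  by move: hal; rewrite ler_norml => /andP[].
have bo0 : 0 < b - om by lra.
have suff1 : al' <= 1 - om /\ (2^-1 <= al' \/ a - (b - om) <= al') ->
    om <= al' <= 1 - om /\ (2^-1 <= al' \/ a - (b - om) <= al').
  move=> [h1 h2]; split => //; rewrite h1 andbT.
  by case: h2 => h2; lra.
apply: suff1.
have [xs|xs] := leP (`|al - a|) (b - om).
  have h : `|(al - a) * f| <= kap * (b - om).
    by rewrite normrM mulrC ler_pM.
  have [h1 h2] : (al - a) * f <= kap * (b - om) /\
      - (kap * (b - om)) <= (al - a) * f.
    by move: h; rewrite ler_norml => /andP[].
  rewrite /kap in h1 h2; split; first lra.
  by right; lra.
have alx : al - a <= b - om by lra.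
have ala : al < a - (b - om).
  move: xs; rewrite ltNge => xs; rewrite ltNge; apply: contra xs => xs.
  by rewrite ler_norml; apply/andP; split; lra.
have al_half : 2^-1 <= al.
  by case: hor => // h; move: ala; rewrite ltNge h.
have rb : b - om < r by apply: lt_le_trans har.
have [hL _ _] := L_const_bounds r om ts.
have h1 : b / om ^+ 2 <= L.
  apply: le_trans hL; rewrite -/a -/b.
  have -> : Num.max (b - r) om = om.
    by apply/max_idPr; lra.
  rewrite lerDr divr_ge0//; first lra.
  exact: sqr_ge0.
have s_om : s <= om.
  have h2 : s * (b / om ^+ 2) <= 2.
    have : s * (b / om ^+ 2) <= s * L by rewrite ler_pM2l.
    have : 0 < s * nu by rewrite mulr_gt0.
    by move: sE; rewrite mulrDr; lra.
  have h3 : s * b <= 2 * om ^+ 2.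
    by move: h2; rewrite mulrA ler_pdivrMr// exprn_gt0.
  have h4 : om * om <= om * (b / 2) by rewrite ler_pM2l.
  have : s * b <= om * b by move: h3 h4; rewrite expr2; lra.
  by rewrite ler_pM2r.
(* Here 1 - al > 2 b - om >= 3 om and al >= 1/2, so al (1 - al) exceeds om >= s. *)
have f0 : 0 <= f.
  have p0 : 0 < al * (1 - al) by rewrite mulr_gt0; lra.
  rewrite /f subr_ge0 ler_pdivrMr// mul1r.
  have : 2^-1 * (1 - al) <= al * (1 - al) by rewrite ler_wpM2r//; lra.
  lra.
have fk : f <= kap by rewrite (le_trans (ler_norm _)).
have h2 : (al - a) * f <= 0 by rewrite mulr_le0_ge0//; lra.
have h3 : (al - a) * kap <= (al - a) * f by rewrite ler_wnM2l//; lra.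
have h4 : s * nu * (b - om) <= b - om by rewrite ler_piMl// ltW.
split; first lra.
(* So far to the left of a, the pull s nu (a - al) outweighs the noise s nu (b - om): alpha does not
   decrease and remains at least 1/2. *)
left; have h5 : 0 <= s * nu * (a - (b - om) - al).
  by rewrite mulr_ge0//; [rewrite ltW// mulr_gt0|lra].
by move: h3; rewrite /kap; lra.
Qed.

Lemma em_invariant_step t : em_invariant t ->
  em_invariant (em_step s n x t) /\
  norm2 (em_step s n x t - ts) <= rho * norm2 (t - ts) + s * H.
Proof.
move=> [Dt hor]; have [hom har hmr hvr] := em_domainP Dt.
have [st1 st2] := em_step_bound Dt close.
have [tr _] := Dt; have N0 := norm2_ge0 (t - ts).
have GN : G * norm2 (t - ts) <= g * norm2 (t - ts) by rewrite ler_wpM2r.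
have Gr : G * norm2 (t - ts) <= G * r.
  by rewrite ler_wpM2l// mulr_ge0// noise_gain_ge0.
have eE : noise_gain * (lam * norm2 (t - ts) + eta) = G * norm2 (t - ts) + H.
  by rewrite mulrDr mulrA.
rewrite eE in st1 st2.
have bound : norm2 (em_step s n x t - ts) <= rho * norm2 (t - ts) + s * H.
  apply: (le_trans st1).
  have : s * (G * norm2 (t - ts)) <= s * (g * norm2 (t - ts)) by rewrite ler_pM2l.
  by rewrite /kap /rho; lra.
split=> //.
have hA : s * (G * norm2 (t - ts) + H) <= s * (nu * (b - om)).
  by rewrite ler_pM2l//; move: GH Gr; lra.
have [A1 A2] := alpha_step_bound hom har hor (le_trans st2 hA).
split=> //; split=> //; apply: (le_trans bound).
have : s * H <= s * ((nu - g) * r) by rewrite ler_pM2l.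
have sg : 0 <= s * g by rewrite mulr_ge0// ltW.
have : rho * norm2 (t - ts) <= rho * r.
  by rewrite ler_wpM2l// /rho; move: snu1; lra.
rewrite /rho; lra.
Qed.

(** H / (nu - g) is the fixed point of the recursion e -> rho e + s H, because 1 - rho = s (nu -
    g). *)
Lemma em_iter_bound t0 k : em_invariant t0 ->
  norm2 (em_iter s n x t0 k - ts) <=
    rho ^+ k * norm2 (t0 - ts) + H / (nu - g).
Proof.
move=> inv0.
have d0 : 0 < nu - g by rewrite subr_gt0.
have inv j : em_invariant (em_iter s n x t0 j).
  elim: j => //= j IH; exact: (em_invariant_step IH).1.
elim: k => [|k IH].
  by rewrite expr0 mul1r lerDl divr_ge0// ltW.
apply: (le_trans (em_invariant_step (inv k)).2).
have sg : 0 <= s * g by rewrite mulr_ge0// ltW.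
have rho0 : 0 <= rho by rewrite /rho; move: snu1; lra.
have := ler_wpM2l rho0 IH.
have -> : s * H = (s * (nu - g)) * (H / (nu - g)) by field; rewrite gt_eqF.
by rewrite exprS /rho; lra.
Qed.

End NoisyStep.

(** * Gaussian integrals *)

Section NormalIntegrals.
Context {R : realType}.
Local Notation leb := (@lebesgue_measure R).
Local Notation N m V := (normal_prob m (Num.sqrt V)).
Implicit Types (m V : R).

Lemma measurable_phi m V : measurable_fun [set: measurableTypeR R] (fun x => phi x m V).
Proof. exact: measurable_normal_pdf. Qed.

(** The Radon-Nikodym derivative of the normal law is identified with [normal_pdf] almost
    everywhere, as both have the same integral over every measurable set. *)
Lemma ge0_integral_normal_prob m (s : R) (f : R -> \bar R) :
    measurable_fun [set: measurableTypeR R] f -> (forall x, (0 <= f x)%E) ->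
  (\int[normal_prob m s]_x f x =
   \int[leb]_x (f x * (normal_pdf m s x)%:E))%E.
Proof.
move=> mf f0; have dom := @normal_prob_dominates R m s.
rewrite -(Radon_Nikodym_SigmaFinite.change_of_variables dom)//=.
have mR := measurable_int _ (Radon_Nikodym_SigmaFinite.f_integrable dom).
have mp : measurable_fun [set: measurableTypeR R] (fun x => (normal_pdf m s x)%:E).
  by apply/measurable_EFinP; exact: measurable_normal_pdf.
apply: ae_eq_integral => //.
- exact: emeasurable_funM.
- exact: emeasurable_funM.
- apply: ae_eqe_mul2l; apply: integral_ae_eq => //=.
  + exact: Radon_Nikodym_SigmaFinite.f_integrable.
  + by move=> E _ mE; rewrite -Radon_Nikodym_SigmaFinite.f_integral.
Qed.

Lemma ge0_integral_normal m V (f : R -> R) :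
    measurable_fun [set: measurableTypeR R] f -> (forall x, 0 <= f x) ->
  (\int[N m V]_x (f x)%:E = \int[leb]_x (f x * phi x m V)%:E)%E.
Proof.
move=> mf f0; rewrite ge0_integral_normal_prob//.
  by apply/measurable_EFinP.
Qed.

(** The integrand is a multiple of the density of N(m, W) with W = V / (1 - 2 t V). Both signs of t
    serve below. *)
Lemma integral_normal_square_exp m V (t : R) : 0 < V -> 2 * t * V < 1 ->
  (\int[N m V]_x (expR (t * (x - m) ^+ 2))%:E =
   ((Num.sqrt (1 - 2 * t * V))^-1)%:E)%E.
Proof.
move=> V0 tV; have d0 : 0 < 1 - 2 * t * V by rewrite subr_gt0.
have mf : measurable_fun [set: measurableTypeR R] (fun x : R => expR (t * (x - m) ^+ 2)).
  apply: measurableT_comp => //; apply: measurable_funM => //.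
  by apply: measurable_funX; exact: measurable_funB.
rewrite ge0_integral_normal//.
pose W := V / (1 - 2 * t * V).
have W0 : 0 < W by rewrite divr_gt0.
under eq_integral => x _.
  have -> : expR (t * (x - m) ^+ 2) * phi x m V =
      (Num.sqrt (1 - 2 * t * V))^-1 * phi x m W.
    rewrite !phiE// mulrCA -expRD [RHS]mulrA -invfM -sqrtrM ?ltW//.
    congr (_^-1 * expR _).
      by congr Num.sqrt; rewrite /W; field; rewrite gt_eqF.
    by rewrite /W; field; rewrite !gt_eqF//= d0.
  rewrite EFinM; over.
rewrite ge0_integralZl//.
- by rewrite integral_normal_pdf mule1.
- by apply/measurable_EFinP; exact: measurable_phi.
- by move=> x _; rewrite lee_fin normal_pdf_ge0.
Qed.

(** Completing the square: the exponential factor moves the mean by c V and keeps the variance. *)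
Lemma integral_normal_tilt m V (c : R) (f : R -> R) : 0 < V ->
    measurable_fun [set: measurableTypeR R] f -> (forall x, 0 <= f x) ->
  (\int[N m V]_x (f x * expR (c * x))%:E =
   (expR (c * m + c ^+ 2 * V / 2))%:E * \int[N (m + c * V)%R V]_x (f x)%:E)%E.
Proof.
move=> V0 mf f0.
have me : measurable_fun [set: measurableTypeR R] (fun x : R => expR (c * x)).
  by apply: measurableT_comp => //; exact: measurable_funM.
have mfe : measurable_fun [set: measurableTypeR R] (fun x : R => f x * expR (c * x)).
  exact: measurable_funM.
have fe0 x : 0 <= f x * expR (c * x) by rewrite mulr_ge0// expR_ge0.
rewrite !ge0_integral_normal//.
under eq_integral => x _.
  have -> : f x * expR (c * x) * phi x m V =
    expR (c * m + c ^+ 2 * V / 2) * (f x * phi x (m + c * V) V).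
    rewrite [RHS]mulrCA -mulrA; congr (_ * _).
    rewrite !phiE// !(mulrCA (expR _)) -!expRD; congr (_ * expR _).
    by field; rewrite gt_eqF.
  rewrite EFinM; over.
rewrite ge0_integralZl//.
- apply/measurable_EFinP; apply: measurable_funM => //; exact: measurable_phi.
- by move=> x _; rewrite lee_fin mulr_ge0// normal_pdf_ge0.
Qed.

End NormalIntegrals.

(** The limit u -> 0 taken by hand: if y < x, some u of order (x - y) / (|A| + 1) contradicts the
    bound. *)
Lemma le_of_small_slope {R : realFieldType} (x y A : R) :
  (forall u, 0 < u <= 2^-1 -> x <= y + u * A) -> x <= y.
Proof.
move=> h; rewrite leNgt; apply/negP => yx.
pose B := `|A| + 1; have B0 : 0 < B by rewrite ltr_wpDl.
pose u := Num.min 2^-1 ((x - y) / (2 * B)).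
have q0 : 0 < (x - y) / (2 * B) by rewrite divr_gt0 ?subr_gt0// mulr_gt0.
have u0 : 0 < u by rewrite lt_min q0 andbT invr_gt0.
have u1 : u <= 2^-1 by rewrite ge_min lexx.
have u2 : u <= (x - y) / (2 * B) by rewrite ge_min lexx orbT.
have := h u; rewrite u0 u1 => /(_ isT) hu.
have h1 : u * A <= u * B.
  by rewrite ler_pM2l// (le_trans (ler_norm A))// lerDl.
have : u * B <= (x - y) / 2.
  rewrite -ler_pdivlMr// (le_trans u2)// invfM mulrA; exact: lexx.
by lra.
Qed.

Section ProbIntegrable.
Context {d : measure_display} {T : measurableType d} {R : realType}.
Variable P : probability T R.

Lemma integrable_bounded_by (f g : T -> R) : measurable_fun setT f ->
    measurable_fun setT g -> (forall x, `|f x| <= g x) ->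
    (\int[P]_x (g x)%:E < +oo)%E ->
  P.-integrable setT (EFin \o f).
Proof.
move=> mf mg fg gy; apply: (@le_integrable _ _ _ P setT measurableT _ (EFin \o g)).
- exact/measurable_EFinP.
- by move=> x _ /=; rewrite lee_fin (le_trans (fg x))// ler_norm.
- apply/integrableP; split; first exact/measurable_EFinP.
  rewrite (le_lt_trans _ gy)//; apply: ge0_le_integral => //=.
  + by apply/measurable_EFinP; exact: measurableT_comp.
  + exact/measurable_EFinP.
  + by move=> x _; rewrite lee_fin ger0_norm// (le_trans _ (fg x)).
Qed.

Lemma Rintegral_prob_cst (c : R) : \int[P]_(x in setT) c = c.
Proof.
rewrite Rintegral_cst// -[RHS]mulr1; congr (_ * _).
exact: (congr1 fine (probability_setT P)).
Qed.

Lemma EFin_Rintegral (f : T -> R) : P.-integrable setT (EFin \o f) ->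
  ((\int[P]_x f x)%:E = \int[P]_x (f x)%:E)%E.
Proof. by move=> fi; rewrite fineK//; exact: integrable_fin_num. Qed.

End ProbIntegrable.

(** * Moments of a normal law, from its exponential integrals *)

Section NormalMoments.
Context {R : realType}.
Local Notation N m V := (normal_prob m (Num.sqrt V)).
Variables (m V : R).
Hypothesis V0 : 0 < V.

Let measurable_sqexp (t : R) :
  measurable_fun [set: measurableTypeR R] (fun x : R => expR (t * (x - m) ^+ 2)).
Proof.
apply: measurableT_comp => //; apply: measurable_funM => //.
by apply: measurable_funX; exact: measurable_funB.
Qed.

(** Quartic growth is what the squares of the statistics need for Chebyshev's inequality. The
    dominating function is exp (t (x - m)^2) with 2 t V = 1/2, whose integral is known. *)
Lemma normal_integrable (f : R -> R) (C : R) : measurable_fun [set: measurableTypeR R] f ->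
  (forall x, `|f x| <= C * (1 + x ^+ 2) ^+ 2) ->
  (N m V).-integrable setT (EFin \o f).
Proof.
move=> mf fC.
have C0 : 0 <= C.
  by have := le_trans (normr_ge0 _) (fC 0); rewrite expr0n/= addr0 expr1n mulr1.
pose t := (4 * V)^-1.
have t0 : 0 < t by rewrite invr_gt0 mulr_gt0.
(* With y = (x - m)^2 and c = 1 + 2 m^2, (1 + x^2)^2 <= (c + 2 y)^2 <= 2 c^2 + 8 y^2, and 8 y^2 <=
   (16 / t^2) exp (t y) by the quadratic term of the exponential series. *)
pose K := 2 * (1 + 2 * m ^+ 2) ^+ 2 + 16 / t ^+ 2.
have K0 : 0 <= K.
  apply: addr_ge0; first by apply: mulr_ge0 => //; exact: sqr_ge0.
  by apply: divr_ge0 => //; exact: sqr_ge0.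
apply: (@integrable_bounded_by _ _ R (N m V) _
  (fun x => C * (K * expR (t * (x - m) ^+ 2)))) => //.
- by do 2 apply: measurable_funM => //.
- move=> x; rewrite (le_trans (fC x))// ler_wpM2l//.
  set y := (x - m) ^+ 2; have y0 : 0 <= y by exact: sqr_ge0.
  have ty0 : 0 <= t * y by rewrite mulr_ge0// ltW.
  set e := expR (t * y).
  have eb : 1 + (t * y) ^+ 2 / 2 <= e by exact: (@expR_ge1Dxn R (t * y) 1 ty0).
  have tt : 0 < t ^+ 2 by rewrite exprn_gt0.
  have h1 : 16 / t ^+ 2 * ((t * y) ^+ 2 / 2) <= 16 / t ^+ 2 * e.
    have c0 : 0 <= 16 / t ^+ 2 by rewrite divr_ge0// ltW.
    by apply: ler_wpM2l => //; apply: le_trans eb; rewrite lerDr.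
  have E1 : 16 / t ^+ 2 * ((t * y) ^+ 2 / 2) = 8 * y ^+ 2.
    by field; rewrite gt_eqF.
  have e1 : 1 <= e by apply: le_trans eb; rewrite lerDl divr_ge0// sqr_ge0.
  have h2 : 2 * (1 + 2 * m ^+ 2) ^+ 2 <= 2 * (1 + 2 * m ^+ 2) ^+ 2 * e.
    by rewrite ler_peMr// mulr_ge0// sqr_ge0.
  have h3 : (1 + x ^+ 2) ^+ 2 <= (1 + 2 * m ^+ 2 + 2 * y) ^+ 2.
    apply: lerXn2r; rewrite ?nnegrE.
    + by rewrite addr_ge0// sqr_ge0.
    + by rewrite !addr_ge0// mulr_ge0// sqr_ge0.
    + by have := sqr_ge0 (x - 2 * m); rewrite /y; lra.
  have h4 := sqr_ge0 (1 + 2 * m ^+ 2 - 2 * y).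
  by rewrite /K mulrDl; lra.
- under eq_integral => x _ do rewrite mulrA EFinM.
  rewrite ge0_integralZl//; last 2 first.
  + by apply/measurable_EFinP.
  + by rewrite lee_fin mulr_ge0.
  rewrite integral_normal_square_exp//; first by rewrite -EFinM ltry.
  have -> : 2 * t * V = 2^-1 by rewrite /t; field; rewrite gt_eqF.
  lra.
Qed.

Let sqexp_integrable (t : R) : 2 * t * V < 1 ->
  (N m V).-integrable setT (fun x => (expR (t * (x - m) ^+ 2))%:E).
Proof.
move=> tV; apply: (@integrable_bounded_by _ _ R (N m V) _
  (fun x => expR (t * (x - m) ^+ 2))) => //.
- by move=> x; rewrite ger0_norm// expR_ge0.
- by rewrite integral_normal_square_exp// ltry.
Qed.

Lemma measurable_center : measurable_fun [set: measurableTypeR R] (fun x : R => x - m).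
Proof. exact: measurable_funB. Qed.

Lemma center_integrable : (N m V).-integrable setT (EFin \o (fun x : R => x - m)).
Proof.
apply: (@normal_integrable _ (2 + m ^+ 2)); first exact: measurable_center.
move=> x; have := sqr_ge0 (x - m); have := sqr_ge0 (x - m + 1).
have := sqr_ge0 (x - m - 1); have := sqr_ge0 x; have := sqr_ge0 m.
have : 0 <= m ^+ 2 * x ^+ 2 by rewrite mulr_ge0 ?sqr_ge0.
have : 0 <= m ^+ 2 * (x ^+ 2) ^+ 2 by rewrite mulr_ge0 ?sqr_ge0.
have := sqr_ge0 (x ^+ 2); have := sqr_ge0 (x + m).
by move=> *; rewrite ler_norml; apply/andP; split; lra.
Qed.

Lemma center2_integrable :
  (N m V).-integrable setT (EFin \o (fun x : R => (x - m) ^+ 2)).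
Proof.
apply: (@normal_integrable _ (2 + 2 * m ^+ 2)).
  by apply: measurable_funX; exact: measurable_center.
move=> x; rewrite ger0_norm ?sqr_ge0//.
have := sqr_ge0 (x + m); have := sqr_ge0 x; have := sqr_ge0 m.
have : 0 <= m ^+ 2 * x ^+ 2 by rewrite mulr_ge0 ?sqr_ge0.
have : 0 <= m ^+ 2 * (x ^+ 2) ^+ 2 by rewrite mulr_ge0 ?sqr_ge0.
have := sqr_ge0 (x ^+ 2).
by move=> *; lra.
Qed.

(* The variance is squeezed between difference quotients of the moment
   generating function of the squared deviation, by convexity of exp. *)
Lemma normal_variance : \int[N m V]_x ((x - m) ^+ 2) = V.
Proof.
set M := \int[N m V]_x ((x - m) ^+ 2).
have IE t : 2 * t * V < 1 ->
    \int[N m V]_x (expR (t * (x - m) ^+ 2)) = (Num.sqrt (1 - 2 * t * V))^-1.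
  by move=> tV; rewrite /Rintegral integral_normal_square_exp.
have bound t : 2 * t * V < 1 -> 1 + t * M <= (Num.sqrt (1 - 2 * t * V))^-1.
  move=> tV; rewrite -IE//.
  rewrite -[X in X + _](Rintegral_prob_cst (N m V)) -RintegralZl//; last first.
    exact: center2_integrable.
  have i1 : (N m V).-integrable setT (EFin \o (fun=> 1 : R)).
    exact: finite_measure_integrable_cst.
  have i2 : (N m V).-integrable setT (EFin \o (fun x => t * (x - m) ^+ 2)).
    exact: (integrableZl measurableT t center2_integrable).
  rewrite -RintegralD//; apply: le_Rintegral => //.
  - exact: (integrableD measurableT i1 i2).
  - exact: sqexp_integrable.
  - by move=> x _; exact: expR_ge1Dx.
have sq u : 0 < 1 + u :> R ->
    (Num.sqrt (1 + u))^-1 <= 1 - u / (2 * (1 + u)).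
  move=> u0; have s0 : 0 < Num.sqrt (1 + u) by rewrite sqrtr_gt0.
  have sE := sqr_sqrtr (ltW u0).
  have -> : u = Num.sqrt (1 + u) ^+ 2 - 1 by rewrite sE; ring.
  rewrite [1 + _](_ : _ = Num.sqrt (1 + u) ^+ 2); last by ring.
  rewrite (_ : Num.sqrt (Num.sqrt (1 + u) ^+ 2) = Num.sqrt (1 + u)); last first.
    by rewrite sqrtr_sqr ger0_norm// ltW.
  set s := Num.sqrt (1 + u) in s0 *.
  rewrite -subr_ge0 (_ : _ - _ = (s - 1) ^+ 2 / (2 * s ^+ 2)).
    apply: divr_ge0; first exact: sqr_ge0.
    by apply: mulr_ge0 => //; exact: sqr_ge0.
  by field; rewrite gt_eqF.
apply/eqP; rewrite eq_le; apply/andP; split.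
(* Positive t bounds the variance from above, negative t in the next branch from below. *)
- apply: (@le_of_small_slope _ _ _ M) => u /andP[u0 u1].
  pose t := u / (2 * V).
  have tE : 2 * t * V = u by rewrite /t; field; rewrite gt_eqF.
  have h := bound t; rewrite tE in h.
  have := sq (- u); rewrite mulNr opprK => /(_ _)/(le_trans (h _)).
  have u1' : u < 1 by lra.
  have p : 0 < 1 - u by lra.
  move=> /(_ u1' p); rewrite lerD2l /t ler_pdivlMr ?mulr_gt0//.
  have -> : u / (2 * V) * M * (2 * (1 - u)) = u * (M * (1 - u) / V).
    by field; rewrite gt_eqF.
  rewrite ger_pMr// ler_pdivrMr// mul1r; lra.
- apply: (@le_of_small_slope _ _ _ M) => u /andP[u0 u1].
  pose t := - u / (2 * V).
  have tE : 2 * t * V = - u by rewrite /t; field; rewrite gt_eqF.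
  have h := bound t; rewrite tE opprK in h.
  have p : 0 < 1 + u by lra.
  have n1 : - u < 1 by lra.
  have := le_trans (h n1) (sq _ p).
  rewrite lerD2l /t !mulNr lerN2 ler_pdivrMr ?mulr_gt0//.
  have -> : u / (2 * V) * M * (2 * (1 + u)) = u * (M * (1 + u) / V).
    by field; rewrite gt_eqF.
  rewrite ler_pMr// ler_pdivlMr// mul1r; lra.
Qed.

(** Integrating 1 + y <= exp y at y = c (x - m) gives 1 + c M <= exp (c^2 V / 2). The excess over 1
    is linear in c on the left and quadratic on the right, so small c of both signs force M = 0. *)
Lemma normal_centered : \int[N m V]_x (x - m) = 0.
Proof.
set M := \int[N m V]_x (x - m).
have mexp (c : R) : measurable_fun [set: measurableTypeR R] (fun x : R => expR (c * x)).
  by apply: measurableT_comp => //; exact: measurable_funM.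
have tilt c : (\int[N m V]_x (expR (c * (x - m)))%:E =
    (expR (c ^+ 2 * V / 2))%:E)%E.
  under eq_integral => x _.
    rewrite mulrBr expRD mulrC; over.
  under eq_integral => x _ do rewrite EFinM.
  have := @integral_normal_tilt R m V c (fun=> expR (- (c * m))) V0.
  rewrite integral_cst//= probability_setT mule1 => tiltE.
  rewrite tiltE//.
  by rewrite -EFinM -expRD; congr (expR _)%:E; ring.
have bound c : 1 + c * M <= expR (c ^+ 2 * V / 2).
  rewrite -[leRHS]/(fine (expR (c ^+ 2 * V / 2))%:E) -tilt -/(Rintegral _ _ _).
  have i0 : (N m V).-integrable setT (fun x => (expR (c * (x - m)))%:E).
    apply: (@integrable_bounded_by _ _ R (N m V) _ (fun x => expR (c * (x - m)))) => //.
    - apply: measurableT_comp => //; apply: measurable_funM => //.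
      exact: measurable_center.
    - apply: measurableT_comp => //; apply: measurable_funM => //.
      exact: measurable_center.
    - by move=> x; rewrite ger0_norm// expR_ge0.
    - by rewrite tilt ltry.
  rewrite -[X in X + _](Rintegral_prob_cst (N m V)) -RintegralZl//; last first.
    exact: center_integrable.
  have i1 : (N m V).-integrable setT (EFin \o (fun=> 1 : R)).
    exact: finite_measure_integrable_cst.
  have i2 : (N m V).-integrable setT (EFin \o (fun x => c * (x - m))).
    exact: (integrableZl measurableT c center_integrable).
  rewrite -RintegralD//; apply: le_Rintegral => //.
  - exact: (integrableD measurableT i1 i2).
  - by move=> x _; exact: expR_ge1Dx.
(* With y = c^2 V, exp (y / 2) <= 1 / (1 - y / 2) <= 1 + y for y in [0, 1]. *)
have small c : c ^+ 2 * V <= 1 -> c * M <= c ^+ 2 * V.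
  move=> cV; set y := c ^+ 2 * V in cV *.
  have y0 : 0 <= y by apply: mulr_ge0; [exact: sqr_ge0|exact: ltW].
  have := bound c; rewrite -/y.
  have := expR_ge1Dx (- (y / 2)); have := expRN (y / 2).
  have := expR_gt0 (y / 2); set e := expR (y / 2) => e0 -> h1 h2.
  have : (1 - y / 2) * e <= 1 by rewrite -ler_pdivlMr// mul1r.
  have : (1 + y - e) * (1 - y / 2) = 1 + (y / 2) * (1 - y) - e * (1 - y / 2) by field.
  have : 0 <= (y / 2) * (1 - y) by rewrite mulr_ge0//; lra.
  move=> h3 h4 h5.
  have : 0 <= (1 + y - e) * (1 - y / 2) by rewrite h4; lra.
  have q0 : 0 < 1 - y / 2 by lra.
  rewrite (pmulr_lge0 _ q0) => h6.
  lra.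
have VV := V0; have V1 : 0 < 1 + V by lra.
have key u : 0 < u <= 2^-1 -> forall sg : R, sg ^+ 2 = 1 -> sg * M <= 0 + u * 1.
  move=> /andP[u0 u1] sg s1.
  (* This choice makes c^2 V at most both 1 and u |c|, so dividing by |c| leaves sg M <= u. *)
  pose c := sg * u / (1 + V).
  have c2 : c ^+ 2 * V = u ^+ 2 * V / (1 + V) ^+ 2.
    by rewrite /c !exprMn s1 exprVn; ring.
  have h : c ^+ 2 * V <= u * (u / (1 + V)).
    rewrite c2 (_ : u ^+ 2 * V / (1 + V) ^+ 2 =
      u * (u / (1 + V)) * (V / (1 + V))); last by field; rewrite gt_eqF.
    apply: ler_piMr; last by rewrite ler_pdivrMr//; lra.
    by apply: mulr_ge0; [exact: ltW|apply: divr_ge0; exact: ltW].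
  have hu : u / (1 + V) <= u.
    by rewrite ler_pdivrMr//; apply: ler_peMr; lra.
  have k0 : 0 <= u / (1 + V) by apply: divr_ge0; exact: ltW.
  have uu : u * (u / (1 + V)) <= 1.
    by rewrite -[leRHS]mulr1; apply: ler_pM => //; lra.
  have := le_trans (small c (le_trans h uu)) h.
  rewrite (_ : c * M = (u / (1 + V)) * (sg * M)); last by rewrite /c; ring.
  rewrite [leRHS]mulrC ler_pM2l ?divr_gt0//; lra.
apply/eqP; rewrite eq_le; apply/andP; split.
- apply: (@le_of_small_slope _ _ _ 1) => u hu.
  by have := key u hu 1 (expr1n _ _); rewrite mul1r.
- rewrite -oppr_le0; apply: (@le_of_small_slope _ _ _ 1) => u hu.
  by have := key u hu (-1) (etrans (sqrrN 1) (expr1n _ 2)); rewrite mulN1r.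
Qed.

Lemma normal_quadratic (A B C : R) :
  \int[N m V]_x (A + B * x + C * x ^+ 2) = A + B * m + C * (V + m ^+ 2).
Proof.
have -> : (fun x : R => A + B * x + C * x ^+ 2) =
    (fun x : R => (A + B * m + C * m ^+ 2) +
      ((B + 2 * C * m) * (x - m) + C * (x - m) ^+ 2)).
  by apply/funext => x; ring.
have i1 : (N m V).-integrable setT (EFin \o (fun=> (A + B * m + C * m ^+ 2))).
  exact: finite_measure_integrable_cst.
have i2 : (N m V).-integrable setT
    (EFin \o (fun x : R => (B + 2 * C * m) * (x - m))).
  exact: (integrableZl measurableT _ center_integrable).
have i3 : (N m V).-integrable setT (EFin \o (fun x : R => C * (x - m) ^+ 2)).
  exact: (integrableZl measurableT _ center2_integrable).
have i4 : (N m V).-integrable setT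
  (EFin \o (fun x : R => (B + 2 * C * m) * (x - m) + C * (x - m) ^+ 2)).
  exact: (integrableD measurableT i2 i3).
have e1 : \int[N m V]_x ((B + 2 * C * m) * (x - m)) = 0.
  rewrite (RintegralZl _ measurableT center_integrable) normal_centered.
  by rewrite mulr0.
have e2 : \int[N m V]_x (C * (x - m) ^+ 2) = C * V.
  by rewrite (RintegralZl _ measurableT center2_integrable) normal_variance.
rewrite (RintegralD measurableT i1 i4) (RintegralD measurableT i2 i3).
by rewrite e1 e2 Rintegral_prob_cst; ring.
Qed.

End NormalMoments.

(** * Expectations under the mixture *)

Section RespMeasurable.
Context {R : realType}.
Implicit Types t : 'rV[R]_3.

Lemma measurable_slog : measurable_fun [set: R] (@slog R).
Proof.
apply: continuous_measurable_fun => u; rewrite /slog.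
apply: cvgV; first by rewrite gt_eqF// ltr_wpDr ?expR_ge0.
apply: cvgD; first exact: cvg_cst.
apply: (@cvg_comp _ _ _ (fun u : R => - u) expR) (@continuous_expR R _).
by apply: cvgN; exact: cvg_id.
Qed.

Lemma measurable_resp t : measurable_fun [set: R] (resp t).
Proof.
apply: (measurableT_comp measurable_slog); rewrite /lodds.
apply: measurable_funD => //; apply: measurable_funM => //.
by apply: measurable_funB => //; apply: measurable_funM.
Qed.

Lemma slog_gt0 (u : R) : 0 < slog u.
Proof. by rewrite invr_gt0 ltr_pwDl// expR_ge0. Qed.

Lemma slog_lt1 (u : R) : slog u < 1.
Proof. by rewrite invf_lt1 ?ltrDl ?expR_gt0// ltr_pwDl// expR_ge0. Qed.

Lemma resp_ge0 t x : 0 <= resp t x.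
Proof. exact/ltW/slog_gt0. Qed.

Lemma resp_le1 t x : resp t x <= 1.
Proof. exact/ltW/slog_lt1. Qed.

(** Bayes' rule: multiplying the mixture density by [resp] leaves the share of the second component.
    At [ts] it turns each expectation weighted by [resp] into a plain normal integral, whence the
    values b and b m. *)
Lemma resp_posterior t x : 0 < palpha t < 1 -> 0 < pvar t ->
  palpha t * (resp t x * phi x 0 (pvar t)) +
  (1 - palpha t) * (resp t x * phi x (pmu t) (pvar t)) =
  (1 - palpha t) * phi x (pmu t) (pvar t).
Proof.
move=> a01 v0; have -> : resp t x = 1 - weight t x by rewrite weightE// opprB addrC subrK.
have [a0 a1] := andP a01.
have p0 := phi_gt0 x 0 v0; have pm := phi_gt0 x (pmu t) v0.
have b0 : 0 < 1 - palpha t by rewrite subr_gt0.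
rewrite /weight; field.
by rewrite gt_eqF// addr_gt0 ?mulr_gt0.
Qed.

End RespMeasurable.

Section MixtureLaw.
Context {R : realType} {d : measure_display} {T : measurableType d}.
Variables (P : probability T R) (X : {RV P >-> R}) (ts : 'rV[R]_3).
Hypothesis Ots : Omega ts.
Hypothesis law : forall A : set R, measurable A ->
  distribution P X A = mixture ts A.
Local Notation N m V := (normal_prob m (Num.sqrt V)).
Let a := palpha ts.
Let b := 1 - a.
Let m := pmu ts.
Let V := pvar ts.

Let a01 : 0 < a < 1.
Proof.
by have [/andP[h1 h2] _] := Ots; rewrite h2 andbT (lt_trans _ h1)// invr_gt0.
Qed.
Let a_ge0 : 0 <= a. Proof. by have /andP[/ltW] := a01. Qed.
Let b_ge0 : 0 <= b. Proof. by rewrite subr_ge0; have /andP[_ /ltW] := a01. Qed.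
Let V_gt0 : 0 < V. Proof. by have [] := Ots. Qed.

Lemma ge0_integral_mixture (f : R -> \bar R) :
    measurable_fun [set: R] f -> (forall x, (0 <= f x)%E) ->
  (\int[P]_w f (X w) =
   a%:E * \int[N 0 V]_x f x + b%:E * \int[N m V]_x f x)%E.
Proof.
move=> mf f0; pose GR := measurableTypeR R.
pose Y : T -> GR := X.
have mY : measurable_fun setT Y by exact: (measurable_funPT X).
pose na : {nonneg R} := NngNum a_ge0; pose nb : {nonneg R} := NngNum b_ge0.
transitivity (\int[pushforward P Y]_(x in setT) f x)%E.
  by rewrite ge0_integral_pushforward.
rewrite (@eq_measure_integral _ _ _ _
  (measure_add (mscale na (N 0 V)) (mscale nb (N m V)))); last first.
  move=> A mA _; rewrite [LHS](law mA) /mixture.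
  exact: (esym (measure_addE (mscale na (N 0 V)) (mscale nb (N m V)) A)).
rewrite ge0_integral_measure_add//; last first.
by rewrite !ge0_integral_mscale.
Qed.

Lemma integral_mixture_resp (q : R -> R) :
    measurable_fun [set: R] q -> (forall x, 0 <= q x) ->
  (\int[P]_w (resp ts (X w) * q (X w))%:E =
   b%:E * \int[N m V]_x (q x)%:E)%E.
Proof.
move=> mq q0.
have mr := measurable_resp ts.
have mrq : measurable_fun [set: R] (fun x => resp ts x * q x).
  exact: measurable_funM.
have rq0 x : 0 <= resp ts x * q x by rewrite mulr_ge0// resp_ge0.
rewrite (@ge0_integral_mixture (fun x => (resp ts x * q x)%:E))//; last first.
  exact/measurable_EFinP.
rewrite !ge0_integral_normal//.
have mp m' : measurable_fun [set: measurableTypeR R] (fun x => phi x m' V).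
  exact: measurable_phi.
have p0 m' x : 0 <= phi x m' V by exact: normal_pdf_ge0.
have rqp0 m' x : 0 <= resp ts x * q x * phi x m' V by rewrite mulr_ge0.
pose leb := @lebesgue_measure R.
have mE m' : measurable_fun [set: measurableTypeR R]
    (fun x => (resp ts x * q x * phi x m' V)%:E).
  by apply/measurable_EFinP; apply: measurable_funM => //; exact: mp.
have mqE m' : measurable_fun [set: measurableTypeR R]
    (fun x => (q x * phi x m' V)%:E).
  by apply/measurable_EFinP; apply: measurable_funM => //; exact: mp.
have E0 m' x : setT x -> (0 <= (resp ts x * q x * phi x m' V)%:E)%E.
  by move=> _; rewrite lee_fin.
have qE0 m' x : setT x -> (0 <= (q x * phi x m' V)%:E)%E.
  by move=> _; rewrite lee_fin mulr_ge0.
rewrite -(ge0_integralZl_EFin leb measurableT (E0 0) (mE 0) a_ge0).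
rewrite -(ge0_integralZl_EFin leb measurableT (E0 m) (mE m) b_ge0).
rewrite -(ge0_integralZl_EFin leb measurableT (qE0 m) (mqE m) b_ge0).
have F0 (k : R) (k0 : 0 <= k) m' x :
    setT x -> (0 <= k%:E * (resp ts x * q x * phi x m' V)%:E)%E.
  by move=> _; rewrite -EFinM lee_fin mulr_ge0.
have mF (k : R) m' : measurable_fun [set: measurableTypeR R]
    (fun x => k%:E * (resp ts x * q x * phi x m' V)%:E)%E.
  exact: measurable_funeM.
rewrite -(ge0_integralD leb measurableT (F0 a a_ge0 0) (mF a 0)
  (F0 b b_ge0 m) (mF b m)).
apply: eq_integral => x _; rewrite -!EFinM -EFinD; congr (_%:E).
have := resp_posterior x a01 V_gt0; rewrite -/a -/b -/m -/V => E.
by rewrite [RHS]mulrCA -E; ring.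
Qed.

End MixtureLaw.

Section MixtureExpectation.
Context {R : realType} {d : measure_display} {T : measurableType d}.
Variables (P : probability T R) (X : {RV P >-> R}) (ts : 'rV[R]_3).
Hypothesis Ots : Omega ts.
Hypothesis law : forall A : set R, measurable A ->
  distribution P X A = mixture ts A.
Local Notation N m V := (normal_prob m (Num.sqrt V)).
Let a := palpha ts.
Let b := 1 - a.
Let m := pmu ts.
Let V := pvar ts.

Let a01 : 0 < a < 1.
Proof.
by have [/andP[h1 h2] _] := Ots; rewrite h2 andbT (lt_trans _ h1)// invr_gt0.
Qed.
Let a_ge0 : 0 <= a. Proof. by have /andP[/ltW] := a01. Qed.
Let b_ge0 : 0 <= b. Proof. by rewrite subr_ge0; have /andP[_ /ltW] := a01. Qed.
Let V_gt0 : 0 < V. Proof. by have [] := Ots. Qed.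

Let quartic_lty m' (C : R) : 0 <= C ->
  (\int[N m' V]_x (C * (1 + x ^+ 2) ^+ 2)%:E < +oo)%E.
Proof.
move=> C0; have q0 (x : R) : 0 <= C * (1 + x ^+ 2) ^+ 2.
  by apply: mulr_ge0 => //; exact: sqr_ge0.
apply: integrable_lty => //; apply: (@normal_integrable _ _ _ V_gt0 _ C) => //.
  apply: measurable_funM => //; apply: measurable_funX.
  by apply: measurable_funD => //; exact: measurable_funX.
by move=> x; rewrite ger0_norm.
Qed.

Lemma mixture_integrable (f : R -> R) (C : R) : measurable_fun [set: R] f ->
  (forall x, `|f x| <= C * (1 + x ^+ 2) ^+ 2) ->
  P.-integrable setT (fun w => (f (X w))%:E).
Proof.
move=> mf fC.
have C0 : 0 <= C.
  by have := le_trans (normr_ge0 _) (fC 0); rewrite expr0n/= addr0 expr1n mulr1.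
have mq : measurable_fun [set: R] (fun x : R => C * (1 + x ^+ 2) ^+ 2).
  apply: measurable_funM => //; apply: measurable_funX.
  by apply: measurable_funD => //; exact: measurable_funX.
apply: (@integrable_bounded_by _ _ R P (f \o X)
  (fun w => C * (1 + X w ^+ 2) ^+ 2)).
- exact: measurableT_comp.
- exact: (measurableT_comp mq).
- by move=> w; exact: fC.
- rewrite (@ge0_integral_mixture _ _ _ P X ts Ots law
    (fun x => (C * (1 + x ^+ 2) ^+ 2)%:E)).
  + by rewrite lte_add_pinfty// lte_mul_pinfty// ?lee_fin// quartic_lty.
  + exact/measurable_EFinP.
  + by move=> x; rewrite lee_fin; apply: mulr_ge0 => //; exact: sqr_ge0.
Qed.

Lemma Rintegral_mixture_resp (q : R -> R) (C : R) :
    measurable_fun [set: R] q -> (forall x, 0 <= q x) ->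
    (forall x, q x <= C * (1 + x ^+ 2) ^+ 2) ->
  \int[P]_w (resp ts (X w) * q (X w)) = b * \int[N m V]_x q x.
Proof.
move=> mq q0 qC; rewrite /Rintegral.
rewrite (integral_mixture_resp Ots law mq q0) fineM//.
apply: integrable_fin_num => //.
apply: (@normal_integrable _ _ _ V_gt0 _ C) => //.
by move=> x; rewrite ger0_norm.
Qed.

Let quad_le (x : R) : 1 + x ^+ 2 <= 1 * (1 + x ^+ 2) ^+ 2.
Proof.
rewrite mul1r expr2 ler_peMr//; last by rewrite lerDl sqr_ge0.
by rewrite addr_ge0// sqr_ge0.
Qed.

Lemma resp_mean : \int[P]_w (resp ts (X w)) = b.
Proof.
have := @Rintegral_mixture_resp (fun=> 1) 1 _ _ _.
under eq_Rintegral do rewrite mulr1.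
move=> ->//; first by rewrite Rintegral_prob_cst mulr1.
move=> x; have := quad_le x; have := sqr_ge0 x; lra.
Qed.

Lemma resp_first_moment : \int[P]_w (resp ts (X w) * X w) = b * m.
Proof.
have mX2 : measurable_fun [set: R] (fun x : R => x ^+ 2) by exact: measurable_funX.
(* The collapse to one component is available for nonnegative functions only, so x is written as the
   difference of two nonnegative quadratics, shaped for [normal_quadratic]. *)
pose q1 (x : R) : R := 1 + 1 * x + 1 * x ^+ 2.
pose q2 (x : R) : R := 1 + 0 * x + 1 * x ^+ 2.
have mq1 : measurable_fun [set: R] q1.
  apply: measurable_funD; last exact: measurable_funM.
  by apply: measurable_funD => //; exact: measurable_funM.
have mq2 : measurable_fun [set: R] q2.
  apply: measurable_funD; last exact: measurable_funM.
  by apply: measurable_funD => //; exact: measurable_funM.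
have q10 x : 0 <= q1 x.
  by have := sqr_ge0 (x + 2^-1); rewrite /q1; lra.
have q20 x : 0 <= q2 x by have := sqr_ge0 x; rewrite /q2; lra.
have q1C x : q1 x <= 2 * (1 + x ^+ 2) ^+ 2.
  have := sqr_ge0 (x - 1); have := sqr_ge0 x; have := quad_le x; rewrite /q1; lra.
have q2C x : q2 x <= 2 * (1 + x ^+ 2) ^+ 2.
  have := sqr_ge0 x; have := quad_le x; rewrite /q2; lra.
have mr := measurable_resp ts.
have i (q : R -> R) : measurable_fun [set: R] q -> (forall x, 0 <= q x) ->
    (forall x, q x <= 2 * (1 + x ^+ 2) ^+ 2) ->
    P.-integrable setT (EFin \o (fun w => resp ts (X w) * q (X w))).
  move=> mq q0 qC; apply: (@mixture_integrable (fun x => resp ts x * q x) 2).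
    exact: measurable_funM.
  move=> x; rewrite normrM !ger0_norm ?resp_ge0//.
  by rewrite (le_trans _ (qC x))// ler_piMl// resp_le1.
have -> : \int[P]_w (resp ts (X w) * X w) =
    \int[P]_w (resp ts (X w) * q1 (X w) - resp ts (X w) * q2 (X w)).
  by apply: eq_Rintegral => w _; rewrite /q1 /q2; ring.
rewrite RintegralB//; [|exact: i|exact: i].
rewrite (Rintegral_mixture_resp mq1 q10 q1C) (Rintegral_mixture_resp mq2 q20 q2C).
by rewrite !normal_quadratic//; ring.
Qed.

Lemma mixture_second_moment : \int[P]_w (X w ^+ 2) = V + b * m ^+ 2.
Proof.
have mX2 : measurable_fun [set: R] (fun x : R => x ^+ 2) by exact: measurable_funX.
have e m' : (\int[N m' V]_x (x ^+ 2)%:E = (V + m' ^+ 2)%:E)%E.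
  rewrite -EFin_Rintegral.
    have := @normal_quadratic R m' V V_gt0 0 0 1.
    under eq_Rintegral do rewrite mul0r !add0r mul1r.
    by move=> ->; congr (_%:E); ring.
  apply: (@normal_integrable _ _ _ V_gt0 _ 1) => // x.
  rewrite ger0_norm ?sqr_ge0//; have := quad_le x; have := sqr_ge0 x; lra.
rewrite /Rintegral (@ge0_integral_mixture _ _ _ P X ts Ots law
  (fun x => (x ^+ 2)%:E)).
- by rewrite !e -!EFinM -EFinD/= /b /V /m /a; ring.
- exact/measurable_EFinP.
- by move=> x; rewrite lee_fin sqr_ge0.
Qed.

(** The two components keep separate bounds because a different tail of the logistic function is
    small on each. *)
Lemma Rintegral_mixture_diff (f g : R -> R) (C k0 k1 : R) :
    measurable_fun [set: R] f -> measurable_fun [set: R] g ->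
    (forall x, `|f x| <= C * (1 + x ^+ 2) ^+ 2) ->
    (forall x, `|g x| <= C * (1 + x ^+ 2) ^+ 2) ->
    (\int[N 0 V]_x (`|f x - g x|)%:E <= k0%:E)%E ->
    (\int[N m V]_x (`|f x - g x|)%:E <= k1%:E)%E ->
  `|\int[P]_w f (X w) - \int[P]_w g (X w)| <= a * k0 + b * k1.
Proof.
move=> mf mg fC gC h0 h1.
have i1 := mixture_integrable mf fC; have i2 := mixture_integrable mg gC.
rewrite -RintegralB//.
have i3 : P.-integrable setT (EFin \o (fun w => f (X w) - g (X w))).
  exact: (integrableB measurableT i1 i2).
apply: (le_trans (le_normr_Rintegral measurableT i3)).
have i4 : P.-integrable setT (EFin \o (fun w => `|f (X w) - g (X w)|)).
  exact: (integrable_norm i3).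
rewrite -lee_fin EFin_Rintegral// (@ge0_integral_mixture _ _ _ P X ts Ots law
  (fun x => (`|f x - g x|)%:E)).
- rewrite [leRHS]EFinD !EFinM.
  by apply: leeD; apply: lee_wpmul2l => //; rewrite lee_fin.
- by apply/measurable_EFinP; apply: measurableT_comp => //; exact: measurable_funB.
- by move=> x; rewrite lee_fin.
Qed.

End MixtureExpectation.

(** * Lipschitz dependence on the parameter *)

Section SlogLipschitz.
Context {R : realType}.
Implicit Types p q u x : R.

Lemma slogN u : slog (- u) = 1 - slog u.
Proof.
rewrite /slog opprK expRN; have := expR_gt0 u; set e := expR u => e0.
by field; rewrite !gt_eqF// addr_gt0.
Qed.

(** Completing the square gives exp (- u / 2) <= 1 + exp (- u). The halved exponent later yields the
    overlap of the two Gaussians. *)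
Lemma slog_le_expR_half u : slog u <= expR (u / 2).
Proof.
rewrite /slog invf_ple ?posrE ?expR_gt0 ?ltr_wpDr ?expR_ge0// -expRN.
have -> : - u = - (u / 2) + - (u / 2) by field.
by rewrite expRD; have := sqr_ge0 (expR (- (u / 2)) - 2^-1); lra.
Qed.

Lemma slog_nondecreasing p q : p <= q -> slog p <= slog q.
Proof.
move=> pq; rewrite lef_pV2 ?posrE ?ltr_wpDr ?expR_ge0//.
by rewrite lerD2l ler_expR lerN2.
Qed.

(** An integrated form of slog' = slog (1 - slog) <= slog; it follows from 1 + y <= exp y at y = p -
    q. *)
Lemma slog_increment p q : p <= q -> slog q - slog p <= (q - p) * slog q.
Proof.
move=> pq; suff h : slog q * (1 + (p - q)) <= slog p by lra.
have ep := expR_gt0 (- p); have eq := expR_gt0 (- q).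
rewrite /slog mulrC ler_pdivrMr ?addr_gt0// mulrC ler_pdivlMr ?addr_gt0//.
apply: (@le_trans _ _ (expR (p - q) * (1 + expR (- p)))).
  by apply: ler_wpM2r; [rewrite addr_ge0// ltW|exact: expR_ge1Dx].
rewrite mulrDr mulr1 -expRD (_ : p - q + - p = - q); last by ring.
by rewrite lerD2r -expR0 ler_expR subr_le0.
Qed.

Let slog_lip_aux (c : R -> R) p q : (forall u, slog u <= c u) ->
  (forall u, 0 <= c u) -> `|slog p - slog q| <= `|p - q| * (c p + c q).
Proof.
move=> sc c0; wlog pq : p q / p <= q.
  move=> H; have [/H//|/ltW/H] := leP p q.
  by rewrite distrC (distrC q p) (addrC (c q)).
have s0 := slog_nondecreasing pq.
rewrite distrC (distrC p) !ger0_norm ?subr_ge0//.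
apply: (le_trans (slog_increment pq)); apply: ler_wpM2l; rewrite ?subr_ge0//.
by rewrite (le_trans (sc q))// lerDr.
Qed.

Lemma slog_lipschitz p q : `|slog p - slog q| <= 2 * `|p - q|.
Proof.
have h := @slog_lip_aux (fun=> 1) p q (fun u => ltW (slog_lt1 u)) (fun=> ler01).
by apply: (le_trans h); rewrite mulrC.
Qed.

(** Useful where both log odds are very negative, as is typical under the zero-mean component; the
    mirror image below serves the other one. *)
Lemma slog_lipschitz_left p q :
  `|slog p - slog q| <= `|p - q| * (expR (p / 2) + expR (q / 2)).
Proof. by apply: slog_lip_aux (fun u => expR (u / 2)) _ _ _ _ => u; [exact: slog_le_expR_half|exact: expR_ge0]. Qed.

Lemma slog_lipschitz_right p q :
  `|slog p - slog q| <= `|p - q| * (expR (- p / 2) + expR (- q / 2)).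
Proof.
have := slog_lipschitz_left (- p) (- q); rewrite !slogN.
rewrite (_ : 1 - slog p - (1 - slog q) = - (slog p - slog q)); last by ring.
by rewrite normrN (_ : - p - - q = - (p - q)) ?normrN//; ring.
Qed.

Lemma ln_lipschitz (om y y' : R) : 0 < om -> om <= y -> om <= y' ->
  `|ln y - ln y'| <= `|y - y'| / om.
Proof.
move=> om0; wlog yy : y y' / y' <= y.
  move=> H h h'; have [yy|/ltW yy] := leP y' y; first exact: H.
  by rewrite distrC (distrC y); exact: H.
move=> h h'; have y0 : 0 < y by apply: lt_le_trans h.
have y'0 : 0 < y' by apply: lt_le_trans h'.
rewrite !ger0_norm ?subr_ge0 ?ler_ln ?posrE//.
rewrite -ln_div ?posrE//.
have -> : y / y' = 1 + (y - y') / y' by field; rewrite gt_eqF.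
apply: (@le_trans _ _ ((y - y') / y')).
  apply: le_ln1Dx; rewrite (lt_le_trans (ltrN10 _))//.
  by rewrite divr_ge0 ?subr_ge0// ltW.
by apply: ler_wpM2l; rewrite ?subr_ge0// lef_pV2 ?posrE.
Qed.

End SlogLipschitz.

Section LoddsLipschitz.
Context {R : realType}.
Variables (om r B B' : R).
Hypotheses (om0 : 0 < om) (r0 : 0 < r).

(** A product of compact intervals, so that a finite net is a product of interval nets. *)
Definition param_box (t : 'rV[R]_3) : Prop :=
  [/\ om <= palpha t <= 1 - om, `|pmu t| <= B & r <= pvar t <= B'].

(** The summands are Lipschitz constants on the box of ln ((1 - alpha) / alpha), mu / v and mu^2 /
    (2 v). *)
Definition lodds_gain : R :=
  2 / om + (B' + B) / r ^+ 2 + (2 * B * B' + B ^+ 2) / (2 * r ^+ 2).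

Lemma param_box_palpha t : param_box t -> 0 < palpha t < 1.
Proof.
by move=> [/andP[h1 h2] _ _]; have := om0; move=> h; apply/andP; split; lra.
Qed.

Lemma lodds_gain_ge0 t : param_box t -> 0 <= lodds_gain.
Proof.
move=> [_ h /andP[h1 h2]]; have B0 : 0 <= B by apply: le_trans h.
have B'0 : 0 <= B' by rewrite (le_trans _ (le_trans h1 h2))// ltW.
have r2 : 0 < r ^+ 2 by rewrite exprn_gt0.
rewrite /lodds_gain; apply: addr_ge0; first apply: addr_ge0.
- by rewrite divr_ge0// ltW.
- by rewrite divr_ge0 ?addr_ge0// ltW.
- apply: divr_ge0; last by rewrite mulr_ge0// ltW.
  by apply: addr_ge0; [rewrite !mulr_ge0|exact: sqr_ge0].
Qed.

Lemma lodds_lipschitz t t' x : param_box t -> param_box t' ->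
  `|lodds t x - lodds t' x| <=
    norm2 (t - t') * lodds_gain * (1 + `|x|).
Proof.
move=> bt bt'; have [al1 al2] := andP (param_box_palpha bt).
have [al1' al2'] := andP (param_box_palpha bt').
have [/andP[a1 a2] mB /andP[v1 v2]] := bt.
have [/andP[a1' a2'] mB' /andP[v1' v2']] := bt'.
have [] := coord_le_norm2 (t - t'); rewrite palphaB pmuB pvarB.
rewrite /lodds; set D := norm2 _.
set al := palpha t in al1 al2 a1 a2 *; set al' := palpha t' in al1' al2' a1' a2' *.
set mu := pmu t in mB *; set mu' := pmu t' in mB' *.
set v := pvar t in v1 v2 *; set v' := pvar t' in v1' v2' *.
move=> da dm dv.
have D0 : 0 <= D by exact: norm2_ge0.
have oo := om0; have rr := r0.
have v0 : 0 < v by lra.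
have v'0 : 0 < v' by lra.
have B0 : 0 <= B by apply: le_trans mB.
have r2 : 0 < r ^+ 2 by rewrite exprn_gt0.
have vv : r ^+ 2 <= v * v' by rewrite expr2; apply: ler_pM => //; exact: ltW.
have vvi : (v * v')^-1 <= (r ^+ 2)^-1 by rewrite lef_pV2 ?posrE ?mulr_gt0.
have vv0 : 0 < v * v' by rewrite mulr_gt0.
pose T1 := ln ((1 - al) / al) - ln ((1 - al') / al').
pose N2 := (mu - mu') * v' + mu' * (v' - v).
pose N3 := (mu - mu') * (mu + mu') * v' + mu' ^+ 2 * (v' - v).
have E : ln ((1 - al) / al) + (2 * mu * x - mu ^+ 2) / (2 * v) -
  (ln ((1 - al') / al') + (2 * mu' * x - mu' ^+ 2) / (2 * v')) =
  T1 + x * (N2 / (v * v')) - N3 / (2 * (v * v')).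
  by rewrite /T1 /N2 /N3; field; rewrite !gt_eqF.
rewrite E.
have dvB : `|v' - v| <= D by rewrite distrC.
have v'B : `|v'| <= B' by rewrite gtr0_norm.
have H1 : `|T1| <= D * (2 / om).
  rewrite /T1 !ln_div ?posrE ?subr_gt0//.
  have -> : ln (1 - al) - ln al - (ln (1 - al') - ln al') =
    (ln (1 - al) - ln (1 - al')) - (ln al - ln al') by ring.
  rewrite (le_trans (ler_normB _ _))//.
  have e1 : `|ln (1 - al) - ln (1 - al')| <= `|1 - al - (1 - al')| / om.
    by apply: ln_lipschitz => //; lra.
  have e2 : `|ln al - ln al'| <= `|al - al'| / om by exact: ln_lipschitz.
  rewrite (_ : 1 - al - (1 - al') = - (al - al')) ?normrN in e1; last by ring.
  have : `|al - al'| / om <= D / om by rewrite ler_pM2r ?invr_gt0.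
  by rewrite mulrCA (_ : 2 * (D / om) = D / om + D / om); [lra|ring].
have H2 : `|N2 / (v * v')| <= D * ((B' + B) / r ^+ 2).
  rewrite normrM normfV (gtr0_norm vv0) mulrA; apply: ler_pM => //.
    by rewrite invr_ge0 ltW.
  rewrite (le_trans (ler_normD _ _))// !normrM mulrDr; apply: lerD.
    exact: ler_pM.
  by rewrite mulrC; exact: ler_pM.
have H3 : `|N3 / (2 * (v * v'))| <=
    D * ((2 * B * B' + B ^+ 2) / (2 * r ^+ 2)).
  have v20 : 0 < 2 * (v * v') by rewrite mulr_gt0.
  rewrite normrM normfV (gtr0_norm v20) [leRHS]mulrA; apply: ler_pM => //.
  - by rewrite invr_ge0 ltW.
  - rewrite (le_trans (ler_normD _ _))// 3!normrM normrX mulrDr; apply: lerD.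
      have -> : D * (2 * B * B') = D * (2 * B) * B' by ring.
      apply: ler_pM => //; apply: ler_pM => //.
      by rewrite (le_trans (ler_normD _ _))//; lra.
    by rewrite mulrC; apply: ler_pM => //; apply: lerXn2r.
  - by rewrite lef_pV2 ?posrE ?mulr_gt0// ler_pM2l.
have x0 := normr_ge0 x.
have B'0 : 0 <= B' by apply: le_trans v'B.
have p2 : 0 <= D * ((B' + B) / r ^+ 2) by apply: le_trans H2.
have p1 : 0 <= D * (2 / om) by apply: le_trans H1.
have p3 : 0 <= D * ((2 * B * B' + B ^+ 2) / (2 * r ^+ 2)) by apply: le_trans H3.
rewrite (le_trans (ler_normB _ _))// (le_trans (lerD (ler_normD _ _) (lexx _)))//.
rewrite [`|x * _|]normrM.
have H2' : `|x| * `|N2 / (v * v')| <= `|x| * (D * ((B' + B) / r ^+ 2)).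
  exact: ler_wpM2l.
have q1 := mulr_ge0 x0 p1; have q3 := mulr_ge0 x0 p3.
rewrite /lodds_gain.
set c1 := 2 / om in H1 p1 q1 *; set c2 := (B' + B) / _ in H2 p2 H2' *.
set c3 := _ / (2 * _) in H3 p3 q3 *.
move: H1 H2' H3 q1 q3 p2; lra.
Qed.

Lemma resp_lipschitz t t' x : param_box t -> param_box t' ->
  `|resp t x - resp t' x| <= norm2 (t - t') * (2 * lodds_gain) * (1 + `|x|).
Proof.
move=> bt bt'; apply: (le_trans (slog_lipschitz _ _)).
rewrite [norm2 _ * _]mulrCA -mulrA ler_pM2l//; exact: lodds_lipschitz.
Qed.

End LoddsLipschitz.

(** * Exponentially small overlap of the two components *)

Section PopulationLipschitz.
Context {R : realType}.
Local Notation N m V := (normal_prob m (Num.sqrt V)).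

Lemma integral_normal_quad_tilt (m V c : R) : 0 < V ->
  (\int[N m V]_x ((1 + x ^+ 2) * expR (c * x))%:E =
   (expR (c * m + c ^+ 2 * V / 2) * (1 + V + (m + c * V) ^+ 2))%:E)%E.
Proof.
move=> V0; have mX2 : measurable_fun [set: measurableTypeR R] (fun x : R => x ^+ 2).
  exact: measurable_funX.
rewrite (integral_normal_tilt m c V0 (f := fun x => 1 + x ^+ 2)); last 2 first.
- exact: measurable_funD.
- by move=> x; rewrite addr_ge0// sqr_ge0.
rewrite EFinM; congr (_ * _)%E.
rewrite -EFin_Rintegral.
  have := @normal_quadratic R (m + c * V) V V0 1 0 1.
  under eq_Rintegral do rewrite mul0r addr0 mul1r.
  by move=> ->; congr (_%:E); ring.
apply: (@normal_integrable _ _ _ V0 _ 1); first exact: measurable_funD.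
move=> x; rewrite ger0_norm; last by rewrite addr_ge0// sqr_ge0.
by have h := sqr_ge0 x; have := mulr_ge0 h h; lra.
Qed.

(** The left-hand sides are the exponents left by the tilt with slope mu / (2 v) under N(0, V) and,
    with opposite sign, under N(m, V). Since v and V differ, they do not simplify exactly. Both
    equal - Y / (8 v^2) with Y >= m^2 V / 12, and v <= 4/3 V turns this into 1/12 * 1/8 * 9/16 =
    3/512. *)
Lemma tilt_exponents (r m V mu v : R) : 0 < r -> 3 * r < V -> 24 * r <= m ->
    `|mu - m| <= r -> V - r <= v <= V + r ->
  [/\ - (mu ^+ 2 / (4 * v)) + (mu / (2 * v)) ^+ 2 * V / 2 <=
        - (3 / 512 * (m ^+ 2 / V)),
      mu ^+ 2 / (4 * v) - mu / (2 * v) * m + (mu / (2 * v)) ^+ 2 * V / 2 <=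
        - (3 / 512 * (m ^+ 2 / V)) &
      0 <= mu / (2 * v) * V <= 3 / 2 * m].
Proof.
move=> r0 Vr mr; rewrite ler_norml => /andP[mu1 mu2] /andP[v1 v2].
have V0 : 0 < V by lra.
have v0 : 0 < v by lra.
have m0 : 0 < m by lra.
have mu0 : 0 < mu by lra.
have d0 : 0 < 8 * v ^+ 2 * V by rewrite !mulr_gt0// exprn_gt0.
have vV : v ^+ 2 <= 16 / 9 * V ^+ 2.
  have -> : 16 / 9 * V ^+ 2 = (4 / 3 * V) ^+ 2 by field.
  by apply: lerXn2r; rewrite ?nnegrE; lra.
have mV : 3 / 512 * (8 * m ^+ 2 * v ^+ 2) <= m ^+ 2 * V ^+ 2 / 12.
  have : m ^+ 2 * v ^+ 2 <= m ^+ 2 * (16 / 9 * V ^+ 2).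
    by rewrite ler_wpM2l// sqr_ge0.
  lra.
have key Y : m ^+ 2 * V ^+ 2 / 12 <= Y * V -> 
    - (Y / (8 * v ^+ 2)) <= - (3 / 512 * (m ^+ 2 / V)).
  move=> h; rewrite lerN2.
  have -> : 3 / 512 * (m ^+ 2 / V) =
      3 / 512 * (8 * m ^+ 2 * v ^+ 2) / (8 * v ^+ 2 * V).
    by field; rewrite !gt_eqF.
  have -> : Y / (8 * v ^+ 2) = Y * V / (8 * v ^+ 2 * V).
    by field; rewrite !gt_eqF.
  by rewrite ler_pM2r ?invr_gt0// (le_trans mV).
split.
- have -> : - (mu ^+ 2 / (4 * v)) + (mu / (2 * v)) ^+ 2 * V / 2 =
     - (mu ^+ 2 * (2 * v - V) / (8 * v ^+ 2)) by field; rewrite gt_eqF.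
  apply: key.
  have h1 : m ^+ 2 / 4 <= mu ^+ 2.
    have -> : m ^+ 2 / 4 = (m / 2) ^+ 2 by field.
    by apply: lerXn2r; rewrite ?nnegrE; lra.
  have h2 : V / 3 <= 2 * v - V by lra.
  have h3 : m ^+ 2 / 4 * (V / 3) <= mu ^+ 2 * (2 * v - V).
    by apply: ler_pM => //; [rewrite divr_ge0// sqr_ge0|lra].
  have : m ^+ 2 / 4 * (V / 3) * V <= mu ^+ 2 * (2 * v - V) * V.
    by rewrite ler_pM2r.
  lra.
- have -> : mu ^+ 2 / (4 * v) - mu / (2 * v) * m + (mu / (2 * v)) ^+ 2 * V / 2 =
     - (mu * (4 * v * m - 2 * v * mu - mu * V) / (8 * v ^+ 2)).
    by field; rewrite gt_eqF.
  apply: key.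
  have h1 : m / 2 <= mu by lra.
  have h2 : m * V / 6 <= 4 * v * m - 2 * v * mu - mu * V.
    have e1 : (2 * v + V) * mu <= (2 * v + V) * (m + r).
      by apply: ler_wpM2l; lra.
    have e2 : (V / 3) * m <= (2 * v - V) * m by apply: ler_wpM2r; lra.
    have e3 : (2 * v + V) * r <= (11 / 3 * V) * r by apply: ler_wpM2r; lra.
    have e4 : V * (24 * r) <= V * m by apply: ler_wpM2l; lra.
    have e5 : 0 <= V * r by rewrite mulr_ge0// ltW.
    lra.
  have h3 : m / 2 * (m * V / 6) <= mu * (4 * v * m - 2 * v * mu - mu * V).
    apply: ler_pM => //; first by lra.
    by rewrite divr_ge0// mulr_ge0// ltW.
  have : m / 2 * (m * V / 6) * V <= mu * (4 * v * m - 2 * v * mu - mu * V) * V.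
    by rewrite ler_pM2r.
  lra.
- rewrite !mulr_ge0 ?invr_ge0 ?mulr_ge0 ?(ltW v0) ?(ltW V0) ?(ltW mu0)//=.
  rewrite mulrAC ler_pdivrMr ?mulr_gt0//.
  have e1 : mu * V <= (2 * m) * V by apply: ler_wpM2r; lra.
  have e2 : m * (2 / 3 * V) <= m * v by apply: ler_wpM2l; lra.
  lra.
Qed.

Variables (r om : R) (ts : 'rV[R]_3).
Hypotheses (r0 : 0 < r) (om0 : 0 < om) (Ots : Omega ts).
Hypothesis om_le : om <= (1 - palpha ts) / 2.
Let a := palpha ts.
Let b := 1 - a.
Let m := pmu ts.
Let V := pvar ts.
Hypotheses (V3r : 3 * r < V) (mV : 8 * V <= m).

Let a_gt : 2^-1 < a. Proof. by have [/andP[]] := Ots. Qed.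
Let b_gt0 : 0 < b. Proof. by rewrite subr_gt0; have [/andP[]] := Ots. Qed.
Let V_gt0 : 0 < V. Proof. by have [] := Ots. Qed.
Let om_b : om <= b / 2. Proof. exact: om_le. Qed.
Let m24 : 24 * r <= m.
Proof. by have h1 := V3r; have h2 := mV; lra. Qed.

(** The first factor bounds the square root of the prior odds, the last one 1 + V plus the square of
    the tilted mean. *)
Definition tilt_bound : R :=
  om^-1 * expR (- (3 / 512 * (m ^+ 2 / V))) * (3 * (1 + m) ^+ 2).

Lemma half_log_odds_le (y : R) : 0 < y -> y <= om^-1 -> expR (ln y / 2) <= om^-1.
Proof.
move=> y0 yo; have oi : 0 < om^-1 by rewrite invr_gt0.
have w1 : om <= 1.
  by have := om_b; have := a_gt; rewrite /b; have := om0; lra.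
have l1 : ln y <= ln om^-1 by rewrite ler_ln ?posrE.
have l0 : 0 <= ln om^-1 by rewrite ln_ge0// -invr1 lef_pV2 ?posrE.
by rewrite -[leRHS](@lnK _ om^-1) ?posrE// ler_expR; lra.
Qed.

Lemma ts_domain : em_domain r om ts ts.
Proof.
rewrite /em_domain /= subrr norm2E /palpha /pmu /pvar !mxE expr0n/= !addr0.
have ob := om_b; have aa := a_gt; have oo := om0; have bb := b_gt0.
have ba : b = 1 - ts ord0 (Ordinal (isT : (0 < 3)%N)) by [].
rewrite sqrtr0; split; first exact: ltW.
move: aa ba ob; rewrite /a /palpha; set c := ts _ _; move=> aa ba ob.
by apply/andP; split; lra.
Qed.

Lemma em_domain_odds t : em_domain r om ts t ->
  [/\ 0 < (1 - palpha t) / palpha t, (1 - palpha t) / palpha t <= om^-1,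
      0 < palpha t / (1 - palpha t) & palpha t / (1 - palpha t) <= om^-1].
Proof.
move=> [_ /andP[h1 h2]]; have oo := om0.
have p0 : 0 < palpha t by lra.
have q0 : 0 < 1 - palpha t by lra.
have oi : 1 <= om^-1 * palpha t by rewrite mulrC ler_pdivlMr// mul1r.
have oj : 1 <= om^-1 * (1 - palpha t) by rewrite mulrC ler_pdivlMr// mul1r; lra.
by split; [exact: divr_gt0|rewrite ler_pdivrMr//; lra|exact: divr_gt0|
  rewrite ler_pdivrMr//; lra].
Qed.

Let poly_bound (z : R) : - (3 / 2 * m) <= z <= 3 / 2 * m ->
  1 + V + z ^+ 2 <= 3 * (1 + m) ^+ 2.
Proof.
move=> /andP[h1 h2]; have Vm := mV; have V0 := V_gt0.
have : z ^+ 2 <= (3 / 2 * m) ^+ 2.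
  rewrite -real_normK ?num_real//; apply: lerXn2r; rewrite ?nnegrE//; first lra.
  by rewrite ler_norml h1.
by have := sqr_ge0 m; lra.
Qed.

Lemma tilt_integral_zero t : em_domain r om ts t ->
  (\int[N 0 V]_x ((1 + x ^+ 2) * expR (lodds t x / 2))%:E <= tilt_bound%:E)%E.
Proof.
move=> Dt; have [hom har hmr hvr] := em_domainP Dt.
have [w1 w2 w3 w4] := em_domain_odds Dt.
have [e1 e2 /andP[e3 e4]] := tilt_exponents r0 V3r m24 hmr hvr.
set al := palpha t in w1 w2 w3 w4; set mu := pmu t in e1 e2 e3 e4 hmr.
set v := pvar t in e1 e2 e3 e4 hvr.
have v0 : 0 < v by have h : 3 * r < pvar ts := V3r; have h' := r0; move: hvr => /andP[]; lra.
pose A := expR (ln ((1 - al) / al) / 2); pose c := mu / (2 * v).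
pose k := A * expR (- (mu ^+ 2 / (4 * v))).
have k0 : 0 <= k by rewrite mulr_ge0// expR_ge0.
under eq_integral => x _.
  have -> : (1 + x ^+ 2) * expR (lodds t x / 2) =
      k * ((1 + x ^+ 2) * expR (c * x)).
    rewrite mulrCA; congr (_ * _); rewrite /k /A -!expRD; congr expR.
    by rewrite /lodds -/al -/mu -/v /c; field; rewrite gt_eqF.
  rewrite EFinM; over.
rewrite ge0_integralZl//; last 2 first.
- apply/measurable_EFinP; apply: measurable_funM.
    by apply: measurable_funD => //; exact: measurable_funX.
  by apply: measurableT_comp => //; exact: measurable_funM.
- by move=> x _; rewrite lee_fin mulr_ge0 ?expR_ge0// addr_ge0// sqr_ge0.
rewrite integral_normal_quad_tilt// -EFinM lee_fin mulr0 !add0r.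
rewrite mulrA /tilt_bound; apply: ler_pM.
- by rewrite mulr_ge0// expR_ge0.
- by rewrite !addr_ge0 ?sqr_ge0// ltW.
- rewrite /k -(mulrA A) -expRD; apply: ler_pM; rewrite ?expR_ge0//.
    exact: (half_log_odds_le w1 w2).
  by rewrite ler_expR.
- apply: poly_bound; rewrite e4 andbT (le_trans _ e3)// oppr_le0.
  by have h := m24; have h' := r0; lra.
Qed.

Lemma tilt_integral_mu t : em_domain r om ts t ->
  (\int[N m V]_x ((1 + x ^+ 2) * expR (- lodds t x / 2))%:E <= tilt_bound%:E)%E.
Proof.
move=> Dt; have [hom har hmr hvr] := em_domainP Dt.
have [w1 w2 w3 w4] := em_domain_odds Dt.
have [e1 e2 /andP[e3 e4]] := tilt_exponents r0 V3r m24 hmr hvr.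
set al := palpha t in w1 w2 w3 w4; set mu := pmu t in e1 e2 e3 e4 hmr.
set v := pvar t in e1 e2 e3 e4 hvr.
have v0 : 0 < v by have h : 3 * r < pvar ts := V3r; have h' := r0; move: hvr => /andP[]; lra.
pose A := expR (ln (al / (1 - al)) / 2); pose c := mu / (2 * v).
have lnE : ln (al / (1 - al)) = - ln ((1 - al) / al).
  by rewrite -lnV ?posrE// invf_div.
pose k := A * expR (mu ^+ 2 / (4 * v)).
have k0 : 0 <= k by rewrite mulr_ge0// expR_ge0.
under eq_integral => x _.
  have -> : (1 + x ^+ 2) * expR (- lodds t x / 2) =
      k * ((1 + x ^+ 2) * expR (- c * x)).
    rewrite mulrCA; congr (_ * _); rewrite /k /A -!expRD; congr expR.
    by rewrite lnE /lodds -/al -/mu -/v /c; field; rewrite gt_eqF.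
  rewrite EFinM; over.
rewrite ge0_integralZl//; last 2 first.
- apply/measurable_EFinP; apply: measurable_funM.
    by apply: measurable_funD => //; exact: measurable_funX.
  by apply: measurableT_comp => //; exact: measurable_funM.
- by move=> x _; rewrite lee_fin mulr_ge0 ?expR_ge0// addr_ge0// sqr_ge0.
rewrite integral_normal_quad_tilt// -EFinM lee_fin.
rewrite mulrA /tilt_bound; apply: ler_pM.
- by rewrite mulr_ge0// expR_ge0.
- by rewrite !addr_ge0 ?sqr_ge0// ltW.
- rewrite /k -(mulrA A) -expRD; apply: ler_pM; rewrite ?expR_ge0//.
    exact: (half_log_odds_le w3 w4).
  rewrite ler_expR; apply: le_trans e2; rewrite -/c -/m -/V; lra.
- apply: poly_bound; rewrite mulNr -/c; have h := m24; have h' := r0.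
  by move: e3 e4; rewrite -/c => e3 e4; apply/andP; split; lra.
Qed.

(** The 4 is a 2 from (1 + |x|)^2 <= 2 (1 + x^2) times a 2 for the exponentials at t and at [ts].
    The box bounds 2 m hold because r and V are small fractions of m. *)
Definition pop_gain : R := 4 * lodds_gain om r (2 * m) (2 * m) * tilt_bound.

Lemma em_domain_box t : em_domain r om ts t ->
  param_box om r (2 * m) (2 * m) t.
Proof.
move=> Dt; have [hom har hmr hvr] := em_domainP Dt.
have h1 := r0; have h2 := V3r; have h3 := mV; have h4 := m24.
move: hmr hvr; rewrite !ler_norml -/m -/V => /andP[m1 m2] /andP[v1 v2].
by split => //; rewrite ?ler_norml; apply/andP; split; lra.
Qed.

Let normX_le (x : R) : (1 + `|x|) ^+ 2 <= 2 * (1 + x ^+ 2).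
Proof.
rewrite -[x ^+ 2]real_normK ?num_real//.
by have := sqr_ge0 (`|x| - 1); lra.
Qed.

(** [sg] selects the logistic tail: 1 under the zero-mean component, -1 under the other. The
    increment of the log odds and [q] each contribute a factor 1 + |x|, which explains the weight 1
    + x^2 in the tilted integrals. *)
Lemma resp_diff_integral (mm : R) (sg : R) t (q : R -> R) :
    (forall u u', `|slog u - slog u'| <=
       `|u - u'| * (expR (sg * u / 2) + expR (sg * u' / 2))) ->
    (forall t', em_domain r om ts t' ->
      (\int[N mm V]_x ((1 + x ^+ 2) * expR (sg * lodds t' x / 2))%:E <=
        tilt_bound%:E)%E) ->
    em_domain r om ts t -> measurable_fun [set: R] q ->
    (forall x, `|q x| <= 1 + `|x|) ->
  (\int[N mm V]_x (`|resp t x * q x - resp ts x * q x|)%:E <=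
    (norm2 (t - ts) * pop_gain)%:E)%E.
Proof.
move=> slip tint Dt mq q1.
have bt := em_domain_box Dt; have bs := em_domain_box ts_domain.
pose M := lodds_gain om r (2 * m) (2 * m).
have M0 : 0 <= M by exact: lodds_gain_ge0 bt.
pose D := norm2 (t - ts); have D0 : 0 <= D by exact: norm2_ge0.
pose k := 2 * (D * M); have k0 : 0 <= k by rewrite mulr_ge0// mulr_ge0.
pose F t' x := (1 + x ^+ 2) * expR (sg * lodds t' x / 2).
have mlodds t' : measurable_fun [set: R] (lodds t').
  rewrite /lodds; apply: measurable_funD => //; apply: measurable_funM => //.
  by apply: measurable_funB => //; apply: measurable_funM.
have mF t' : measurable_fun [set: R] (F t').
  apply: measurable_funM.
    by apply: measurable_funD => //; exact: measurable_funX.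
  apply: measurableT_comp => //; apply: measurable_funM => //.
  exact: measurable_funM.
have F0 t' x : 0 <= F t' x.
  by rewrite mulr_ge0 ?expR_ge0// addr_ge0// sqr_ge0.
have pw x : `|resp t x * q x - resp ts x * q x| <= k * (F t x + F ts x).
  rewrite -mulrBl normrM.
  apply: (@le_trans _ _ ((D * M * (1 + `|x|) * (expR (sg * lodds t x / 2) +
     expR (sg * lodds ts x / 2))) * (1 + `|x|))).
    apply: ler_pM => //; apply: (le_trans (slip _ _)).
    apply: ler_wpM2r; first by rewrite addr_ge0 ?expR_ge0.
    exact: (lodds_lipschitz om0 r0).
  rewrite /F -mulrDr /k; set e := expR _ + expR _.
  have e0 : 0 <= e by rewrite addr_ge0 ?expR_ge0.
  have -> : D * M * (1 + `|x|) * e * (1 + `|x|) =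
    (D * M * e) * (1 + `|x|) ^+ 2 by ring.
  have -> : 2 * (D * M) * ((1 + x ^+ 2) * e) = 
    (D * M * e) * (2 * (1 + x ^+ 2)) by ring.
  by apply: ler_wpM2l => //; rewrite mulr_ge0// mulr_ge0.
apply: (@le_trans _ _ (\int[N mm V]_x (k * (F t x + F ts x))%:E)%E).
  apply: ge0_le_integral => //.
  - apply/measurable_EFinP; apply: measurableT_comp => //.
    by apply: measurable_funB; apply: measurable_funM => //; exact: measurable_resp.
  - apply/measurable_EFinP; apply: measurable_funM => //.
    by apply: measurable_funD; exact: mF.
  - by move=> x _; rewrite lee_fin.
under eq_integral => x _ do rewrite EFinM EFinD.
have mFE t' : measurable_fun [set: measurableTypeR R] (fun x => (F t' x)%:E).
  by apply/measurable_EFinP; exact: mF.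
rewrite ge0_integralZl//; last 2 first.
- by apply: emeasurable_funD.
- by move=> x _; rewrite -EFinD lee_fin addr_ge0.
rewrite ge0_integralD//; last 2 first.
- by move=> x _; rewrite lee_fin.
- by move=> x _; rewrite lee_fin.
apply: (@le_trans _ _ (k%:E * (tilt_bound%:E + tilt_bound%:E))%E).
  apply: lee_wpmul2l; first by rewrite lee_fin.
  by apply: leeD; apply: tint => //; exact: ts_domain.
by rewrite -EFinD -EFinM lee_fin /k /pop_gain -/M -/D; lra.
Qed.

End PopulationLipschitz.

Section PopulationStats.
Context {R : realType} {d : measure_display} {T : measurableType d}.
Variables (P : probability T R) (X : {RV P >-> R}).
Variables (r om : R) (ts : 'rV[R]_3).
Hypotheses (r0 : 0 < r) (om0 : 0 < om) (Ots : Omega ts).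
Hypothesis om_le : om <= (1 - palpha ts) / 2.
Hypothesis law : forall A : set R, measurable A ->
  distribution P X A = mixture ts A.
Hypotheses (V3r : 3 * r < pvar ts) (mV : 8 * pvar ts <= pmu ts).

Lemma population_resp_lipschitz t (q : R -> R) : em_domain r om ts t ->
    measurable_fun [set: R] q -> (forall x, `|q x| <= 1 + `|x|) ->
  `|\int[P]_w (resp t (X w) * q (X w)) -
    \int[P]_w (resp ts (X w) * q (X w))| <=
  pop_gain r om ts * norm2 (t - ts).
Proof.
move=> Dt mq q1.
have C t' x : `|resp t' x * q x| <= 2 * (1 + x ^+ 2) ^+ 2.
  rewrite normrM (ger0_norm (resp_ge0 _ _)).
  apply: (@le_trans _ _ (1 * (1 + `|x|))).
    by apply: ler_pM => //; [exact: resp_ge0|exact: resp_le1].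
  have y2 := sqr_ge0 `|x|; have y4 := mulr_ge0 y2 y2.
  by have := sqr_ge0 (`|x| - 1); rewrite -[x ^+ 2]real_normK ?num_real//; lra.
have mrq t' : measurable_fun [set: R] (fun x => resp t' x * q x).
  by apply: measurable_funM => //; exact: measurable_resp.
have := Rintegral_mixture_diff Ots law (mrq t) (mrq ts) (C t) (C ts)
  (@resp_diff_integral _ _ _ _ r0 om0 Ots om_le V3r mV 0 1 t q _ _ Dt mq q1)
  (@resp_diff_integral _ _ _ _ r0 om0 Ots om_le V3r mV (pmu ts) (-1) t q
    _ _ Dt mq q1).
rewrite -mulrDl (_ : palpha ts + (1 - palpha ts) = 1); last by ring.
rewrite mul1r [pop_gain _ _ _ * _]mulrC; apply.
- by move=> u u'; rewrite !mul1r; exact: slog_lipschitz_left.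
- move=> t' Dt'; under eq_integral => x _ do rewrite mul1r.
  exact: (tilt_integral_zero r0 om0 Ots om_le V3r mV Dt').
- by move=> u u'; rewrite !mulN1r; exact: slog_lipschitz_right.
- move=> t' Dt'; under eq_integral => x _ do rewrite mulN1r.
  exact: (tilt_integral_mu r0 om0 Ots om_le V3r mV Dt').
Qed.

End PopulationStats.

(** * Weak laws of large numbers *)

Section SquareIntegrable.
Context {R : realType} {d : measure_display} {T : measurableType d}.
Variable P : probability T R.
Implicit Types f g : T -> R.

Definition square_integrable f : Prop :=
  measurable_fun setT f /\ P.-integrable setT (fun w => (f w ^+ 2)%:E).

Lemma square_integrable_mul f g :
    square_integrable f -> square_integrable g ->
  P.-integrable setT (fun w => (f w * g w)%:E).
Proof.
move=> [mf f2] [mg g2].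
apply: (le_integrable measurableT _ _ (integrableD measurableT f2 g2)).
  by apply/measurable_EFinP; exact: measurable_funM.
move=> w _ /=; rewrite lee_fin [leRHS]ger0_norm ?addr_ge0 ?sqr_ge0//.
have h1 := sqr_ge0 (f w + g w); have h2 := sqr_ge0 (f w - g w).
have h3 := sqr_ge0 (f w); have h4 := sqr_ge0 (g w).
by rewrite ler_norml; apply/andP; split; lra.
Qed.

Lemma square_integrable_add f g :
    square_integrable f -> square_integrable g ->
  square_integrable (fun w => f w + g w).
Proof.
move=> sf sg; have [mf f2] := sf; have [mg g2] := sg.
split; first exact: measurable_funD.
have fg := square_integrable_mul sf sg.
have h := integrableD measurableT (integrableD measurableT f2
  (integrableD measurableT fg fg)) g2.
apply: eq_integrable h => // w _ /=; rewrite -!EFinD; congr (_%:E); ring.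
Qed.

Lemma square_integrable0 : square_integrable (fun=> 0).
Proof.
split=> //; apply: (eq_integrable _ (EFin \o (fun=> 0))) => //.
  by move=> w _ /=; rewrite expr0n.
exact: finite_measure_integrable_cst.
Qed.

Lemma square_integrable_integrable f : square_integrable f ->
  P.-integrable setT (fun w => (f w)%:E).
Proof.
move=> sf; have s1 : square_integrable (fun=> 1).
  split=> //; apply: (eq_integrable _ (EFin \o (fun=> 1))) => //.
    by move=> w _ /=; rewrite expr1n.
  exact: finite_measure_integrable_cst.
have := square_integrable_mul sf s1; apply: eq_integrable => // w _.
by rewrite mulr1.
Qed.

Lemma chebyshev_square f (e K : R) : square_integrable f -> 0 < e ->
  \int[P]_w (f w ^+ 2) <= K ->
  (P [set w | e <= `|f w|]%R <= (K / e ^+ 2)%:E)%E.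
Proof.
move=> [mf f2] e0 fK; set A := [set w | _].
have mA : measurable A.
  have -> : A = (fun w => `|f w|) @^-1` `[e, +oo[%classic.
    by apply/seteqP; split => w /=; rewrite in_itv/= andbT.
  rewrite -[X in measurable X]setTI.
  have : measurable_fun setT (fun w => `|f w|) by exact: measurableT_comp.
  by apply => //; exact: measurable_itv.
have e2 : 0 < e ^+ 2 by rewrite exprn_gt0.
have h : ((e ^+ 2)%:E * P A <= K%:E)%E.
  rewrite -integral_cst//.
  apply: (@le_trans _ _ (\int[P]_(w in A) (f w ^+ 2)%:E)%E).
    apply: ge0_le_integral => //.
    - by move=> w _; rewrite lee_fin ltW.
    - apply/measurable_EFinP; apply: measurable_funTS; exact: measurable_funX.
    - move=> w Aw; rewrite lee_fin -[leRHS]real_normK ?num_real//.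
      by apply: lerXn2r; rewrite ?nnegrE// ltW.
  apply: (@le_trans _ _ (\int[P]_w (f w ^+ 2)%:E)%E).
    apply: ge0_subset_integral => //.
    - by apply/measurable_EFinP; exact: measurable_funX.
    - by move=> w _; rewrite lee_fin sqr_ge0.
  by rewrite -EFin_Rintegral// lee_fin.
have Pfin : P A \is a fin_num by exact: fin_num_measure.
move: h; rewrite -(fineK Pfin) -EFinM !lee_fin ler_pdivlMr//.
by rewrite mulrC.
Qed.

(** Variances of orthogonal variables add. The induction also carries the orthogonality of each
    partial sum to all later terms. *)
Lemma sum_orthogonal (Y : nat -> T -> R) (K : R) (n : nat) :
    (forall i, square_integrable (Y i)) ->
    (forall i j, i != j -> \int[P]_w (Y i w * Y j w) = 0) ->
    (forall i, \int[P]_w (Y i w ^+ 2) <= K) ->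
  square_integrable (fun w => \sum_(i < n) Y i w) /\
  \int[P]_w ((\sum_(i < n) Y i w) ^+ 2) <= n%:R * K.
Proof.
move=> sY oY YK.
suff H : [/\ square_integrable (fun w => \sum_(i < n) Y i w),
    \int[P]_w ((\sum_(i < n) Y i w) ^+ 2) <= n%:R * K &
    forall j, (n <= j)%N -> \int[P]_w ((\sum_(i < n) Y i w) * Y j w) = 0].
  by have [] := H.
elim: n => [|n [IH1 IH2 IH3]].
  have E : (fun w => \sum_(i < 0) Y i w) = (fun=> 0).
    by apply/funext => w; rewrite big_ord0.
  split.
  - by rewrite E; exact: square_integrable0.
  - under eq_Rintegral do rewrite big_ord0 expr0n/=.
    by rewrite Rintegral_prob_cst mul0r.
  - move=> j _; under eq_Rintegral do rewrite big_ord0 mul0r.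
    by rewrite Rintegral_prob_cst.
have E : (fun w => \sum_(i < n.+1) Y i w) =
    (fun w => (\sum_(i < n) Y i w) + Y n w).
  by apply/funext => w; rewrite big_ord_recr.
have i1 := square_integrable_mul IH1 (sY n).
have i2 : P.-integrable setT (EFin \o (fun w => 2 * ((\sum_(i < n) Y i w) * Y n w))).
  exact: (integrableZl measurableT 2 i1).
have i3 : P.-integrable setT (EFin \o (fun w =>
    2 * ((\sum_(i < n) Y i w) * Y n w) + Y n w ^+ 2)).
  exact: (integrableD measurableT i2 (sY n).2).
split.
- by rewrite E; exact: square_integrable_add.
- under eq_Rintegral do rewrite big_ord_recr/=.
  rewrite (@eq_Rintegral _ _ _ P _ (fun w => (\sum_(i < n) Y i w) ^+ 2 +
    (2 * ((\sum_(i < n) Y i w) * Y n w) + Y n w ^+ 2))); last first.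
    by move=> w _; ring.
  rewrite (RintegralD measurableT IH1.2 i3).
  rewrite (RintegralD measurableT i2 (sY n).2).
  rewrite (RintegralZl _ measurableT i1) IH3// mulr0 add0r.
  by rewrite -natr1 mulrDl mul1r; apply: lerD.
- move=> j nj; under eq_Rintegral do rewrite big_ord_recr/= mulrDl.
  rewrite RintegralD//; last 2 first.
  + exact: square_integrable_mul.
  + exact: square_integrable_mul.
  rewrite IH3 ?(ltnW nj)// oY ?addr0// neq_ltn nj//.
Qed.

End SquareIntegrable.

(** * Independence and the law of large numbers for one function *)

Section Independence.
Context {R : realType} {d : measure_display} {T : measurableType d}.
Variables (P : probability T R) (X : nat -> {RV P >-> R}).
Hypothesis indep : mutually_independent X.

Lemma independent_pair (i j : nat) (A B : set R) : i != j ->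
    measurable A -> measurable B ->
  P ((X i @^-1` A) `&` (X j @^-1` B)) = (P (X i @^-1` A) * P (X j @^-1` B))%E.
Proof.
move=> ij mA mB; pose C k := if k == i then A else B.
have Ci : C i = A by rewrite /C eqxx.
have Cj : C j = B by rewrite /C eq_sym (negbTE ij).
have mC k : measurable (C k) by rewrite /C; case: ifP.
have u : uniq [:: i; j] by rewrite /= inE ij.
have := indep u mC; rewrite !big_cons big_nil mule1 Ci Cj => <-.
congr (P _); apply/seteqP; split=> w /=.
- move=> [Aw Bw] k /=; rewrite !inE => /orP[] /eqP ->; first by rewrite Ci.
  by rewrite Cj.
- move=> h; split.
    by rewrite -Ci; apply: h; rewrite /= inE eqxx.
  by rewrite -Cj; apply: h; rewrite /= !inE eqxx orbT.
Qed.

(** The joint law agrees with the product of the marginals on rectangles, hence everywhere; Fubini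
    then integrates the centred factor first. *)
Lemma independent_mul_integral (i j : nat) (f : R -> R) : i != j ->
    measurable_fun [set: R] f ->
    square_integrable P (fun w => f (X i w)) ->
    square_integrable P (fun w => f (X j w)) ->
    \int[P]_w f (X j w) = 0 ->
  \int[P]_w (f (X i w) * f (X j w)) = 0.
Proof.
move=> ij mf sfi sfj fj0.
pose Z (w : T) : R * R := (X i w, X j w).
have mZ : measurable_fun setT Z by apply: measurable_fun_pair.
pose Z' : {mfun T >-> (R * R)%type} :=
  HB.pack Z (isMeasurableFun.Build _ _ _ _ Z mZ).
pose m1 := distribution P (X i); pose m2 := distribution P (X j).
have prodE (S : set (R * R)) : measurable S -> (m1 \x m2)%E S = distribution P Z' S.
  apply: product_measure_unique => A B mA mB.
  by rewrite /m1 /m2 -independent_pair.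
pose H (z : R * R) : \bar R := (f z.1 * f z.2)%:E.
have mH : measurable_fun setT H.
  apply/measurable_EFinP; apply: measurable_funM.
    by apply: measurableT_comp.
  by apply: measurableT_comp.
have iH : P.-integrable setT (H \o Z) by exact: square_integrable_mul.
have eH (G : R * R -> \bar R) :
    (\int[m1 \x m2]_z G z = \int[distribution P Z']_z G z)%E.
  by apply: eq_measure_integral => A mA _; exact: prodE.
have iH' : (m1 \x m2)%E.-integrable setT H.
  apply/integrableP; split=> //; rewrite eH.
  by have /integrableP[] := @integrable_pushforward _ _ _ _ _ _ mZ P setT H mH iH measurableT.
have fjE : (\int[m2]_y (f y)%:E = 0)%E.
  rewrite /m2 integral_distribution//; last 2 first.
  - exact/measurable_EFinP.
  - exact: square_integrable_integrable.
  have -> : (\int[P]_x (EFin \o f \o X j) x)%E = (\int[P]_w f (X j w))%:E.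
    by rewrite EFin_Rintegral//; exact: square_integrable_integrable.
  by rewrite fj0.
rewrite /Rintegral.
have -> : (\int[P]_w (f (X i w) * f (X j w))%:E = 
    \int[distribution P Z']_z H z)%E.
  by rewrite integral_distribution.
rewrite -eH -(integral12_prod_meas1 iH') /=.
rewrite integral0_eq// => x _; rewrite /fubini_F /H/=.
under eq_integral do rewrite EFinM.
rewrite integralZl//; first by rewrite fjE mule0.
apply: (@integrable_pushforward _ _ _ _ _ _ (measurable_funPT (X j)) P setT _ _ _ measurableT).
- exact/measurable_EFinP.
- exact: square_integrable_integrable.
Qed.

End Independence.

Section WeakLaw.
Context {R : realType} {d : measure_display} {T : measurableType d}.
Variables (P : probability T R) (X : nat -> {RV P >-> R}) (ts : 'rV[R]_3).
Hypothesis Ots : Omega ts.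
Hypothesis iid : iid_mixture X ts.

Let indep : mutually_independent X. Proof. by have [] := iid. Qed.
Let law i (A : set R) : measurable A -> distribution P (X i) A = mixture ts A.
Proof. by have [_] := iid; apply. Qed.

Definition mean_of (h : R -> R) : R := \int[P]_w h (X 0%N w).

(** Quadratic growth, so that the square stays within the quartic growth that is known to be
    integrable. *)
Definition moderate (h : R -> R) : Prop :=
  measurable_fun [set: R] h /\ exists C, forall x, `|h x| <= C * (1 + x ^+ 2).

Let quad_ge1 (x : R) : 1 <= 1 + x ^+ 2.
Proof. by rewrite lerDl sqr_ge0. Qed.

Lemma moderate_quartic h : moderate h ->
  exists C, forall x, `|h x| <= C * (1 + x ^+ 2) ^+ 2.
Proof.
move=> [_ [C hC]]; exists C => x; rewrite (le_trans (hC x))//.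
have C0 : 0 <= C.
  by have := le_trans (normr_ge0 _) (hC 0); rewrite expr0n/= addr0 mulr1.
apply: ler_wpM2l => //; rewrite expr2; apply: ler_peMr; last exact: quad_ge1.
exact: le_trans (quad_ge1 x).
Qed.

Lemma moderate_integrable h i : moderate h ->
  P.-integrable setT (fun w => (h (X i w))%:E).
Proof.
move=> mh; have [C hC] := moderate_quartic mh.
exact: (mixture_integrable Ots (@law i) mh.1 hC).
Qed.

Lemma moderate_shift h c : moderate h -> moderate (fun x => h x - c).
Proof.
move=> [mh [C hC]]; split; first exact: measurable_funB.
exists (C + `|c|) => x; rewrite (le_trans (ler_normB _ _))// mulrDl.
by apply: lerD => //; rewrite ler_peMr.
Qed.

Lemma moderate_square_integrable h i : moderate h ->
  square_integrable P (fun w => h (X i w)).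
Proof.
move=> [mh [C hC]]; split; first exact: measurableT_comp.
apply: (mixture_integrable Ots (@law i) (f := fun x => h x ^+ 2) (C := C ^+ 2)).
  exact: measurable_funX.
move=> x; rewrite normrX -exprMn; apply: lerXn2r; rewrite ?nnegrE//.
exact: le_trans (hC x).
Qed.

Lemma same_mean h i : measurable_fun [set: R] h ->
    (forall k, P.-integrable setT (fun w => (h (X k w))%:E)) ->
  \int[P]_w h (X i w) = mean_of h.
Proof.
move=> mh ih; rewrite /mean_of /Rintegral.
have E k : (\int[P]_w (h (X k w))%:E = \int[distribution P (X k)]_x (h x)%:E)%E.
  rewrite integral_distribution//; last exact: ih.
  exact/measurable_EFinP.
rewrite !E; congr fine; apply: eq_measure_integral => A mA _.
exact: (etrans (law i mA) (esym (law 0 mA))).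
Qed.

Lemma weak_law h (e del : R) : moderate h -> 0 < e -> 0 < del ->
  exists N, forall n, (N <= n)%N ->
  (P [set w | e <= `|smean n (fun i => X i w) h - mean_of h|]%R <= del%:E)%E.
Proof.
move=> mh e0 del0; set c := mean_of h.
have mh' := moderate_shift c mh.
pose Y i w := h (X i w) - c.
have sY i : square_integrable P (Y i).
  exact: (@moderate_square_integrable (fun x => h x - c)).
have Y0 i : \int[P]_w Y i w = 0.
  rewrite RintegralB//; last 2 first.
  - exact: moderate_integrable.
  - exact: finite_measure_integrable_cst.
  rewrite Rintegral_prob_cst (same_mean i mh.1) ?subrr// => k.
  exact: moderate_integrable.
pose K := mean_of (fun x => (h x - c) ^+ 2).
have mh2 : measurable_fun [set: R] (fun x => (h x - c) ^+ 2).
  by apply: measurable_funX; exact: mh'.1.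
have YK i : \int[P]_w (Y i w ^+ 2) <= K.
  rewrite (@same_mean (fun x => (h x - c) ^+ 2) i mh2)// => k.
  exact: (sY k).2.
have oY i j : i != j -> \int[P]_w (Y i w * Y j w) = 0.
  move=> ij.
  exact: (independent_mul_integral indep ij mh'.1 (sY i) (sY j) (Y0 j)).
pose N0 : nat := (Num.truncn (K / (e ^+ 2 * del))).+1.
exists N0 => n nN.
have e2 : 0 < e ^+ 2 by rewrite exprn_gt0.
have n0 : (0 < n)%N by apply: leq_trans nN.
have nr0 : 0 < n%:R :> R by rewrite ltr0n.
have [sS SK] := sum_orthogonal n sY oY YK.
have ne0 : 0 < n%:R * e by rewrite mulr_gt0.
have := chebyshev_square sS ne0 SK.
have -> : [set w | (n%:R * e <= `|\sum_(i < n) Y i w|)%R] =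
    [set w | (e <= `|smean n (fun i => X i w) h - c|)%R].
  apply/seteqP; suff E w : (n%:R * e <= `|\sum_(i < n) Y i w|) =
      (e <= `|smean n (fun i => X i w) h - c|).
    by split => w /=; rewrite E.
  have -> : \sum_(i < n) Y i w = n%:R * (smean n (fun i => X i w) h - c).
    rewrite sumrB sumr_const card_ord /smean mulrBr mulrA divff ?gt_eqF// mul1r.
    by rewrite mulr_natl.
  by rewrite normrM ger0_norm ?ler_pM2l// ltW.
move=> /le_trans; apply; rewrite lee_fin exprMn.
have -> : n%:R * K / (n%:R ^+ 2 * e ^+ 2) = K / e ^+ 2 / n%:R.
  by field; rewrite !gt_eqF.
rewrite ler_pdivrMr// [leRHS]mulrC -ler_pdivrMr//.
have -> : K / e ^+ 2 / del = K / (e ^+ 2 * del).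
  by field; rewrite !gt_eqF.
by rewrite (le_trans (ltW (truncnS_gt _)))// ler_nat.
Qed.

Lemma measurable_smean n h : measurable_fun [set: R] h ->
  measurable_fun setT (fun w => smean n (fun i => X i w) h).
Proof.
move=> mh; apply: measurable_funM => //; apply: measurable_sum => i.
exact: measurableT_comp.
Qed.

(** Union bound: the head of the list receives half of the allowed failure probability and the tail
    the other half. *)
Lemma weak_law_seq (hs : seq (R -> R)) (e del : R) :
    (forall h, List.In h hs -> moderate h) -> 0 < e -> 0 < del ->
  exists N, forall n, (N <= n)%N -> exists E : set T,
    [/\ measurable E, (P (~` E) <= del%:E)%E & forall w, E w ->
      forall h, List.In h hs ->
        `|smean n (fun i => X i w) h - mean_of h| <= e].
Proof.
move=> mhs e0; elim: hs del mhs => [|h hs IH] del mhs del0.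
  exists 0%N => n _; exists setT; split => //.
  by rewrite setCT measure0 lee_fin ltW.
have del2 : 0 < del / 2 by rewrite divr_gt0.
have mh : moderate h by apply: mhs; left.
have [N1 H1] := weak_law mh e0 del2.
have [N2 H2] := IH _ (fun h' hh' => mhs h' (or_intror hh')) del2.
exists (maxn N1 N2) => n; rewrite geq_max => /andP[n1 n2].
have [E [mE PE HE]] := H2 n n2.
set A := [set w | (e <= `|smean n (fun i => X i w) h - mean_of h|)%R].
have mA : measurable A.
  have -> : A = (fun w => `|smean n (fun i => X i w) h - mean_of h|) @^-1`
      `[e, +oo[%classic.
    by apply/seteqP; split => w /=; rewrite in_itv/= andbT.
  rewrite -[X in measurable X]setTI.
  have : measurable_fun setT (fun w => `|smean n (fun i => X i w) h - mean_of h|).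
    apply: measurableT_comp => //; apply: measurable_funB => //.
    by apply: measurable_smean; exact: mh.1.
  by apply => //; exact: measurable_itv.
exists (E `&` ~` A); split.
- by apply: measurableI => //; exact: measurableC.
- rewrite setCI setCK; apply: (le_trans (measureU2 P _ _)) => //.
    exact: measurableC.
  by rewrite [X in (_ <= X%:E)%E](splitr del) EFinD; apply: leeD => //; exact: H1.
- move=> w [Ew Aw] h' [<-|hh']; last exact: HE.
  by move/negP: Aw; rewrite -ltNge => /ltW.
Qed.

End WeakLaw.

(** * Finite nets and uniformity in the parameter *)

Section Net.
Context {R : realType}.

(** The points stay inside the interval because the Lipschitz bounds are available only within the
    box. *)
Lemma interval_net (lo hi rho : R) : lo <= hi -> 0 < rho ->
  exists s : seq R, (forall y, y \in s -> lo <= y <= hi) /\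
    forall y, lo <= y <= hi -> exists2 z, z \in s & `|y - z| <= rho.
Proof.
move=> lohi rho0.
have H N : exists s : seq R, (forall y, y \in s -> lo <= y <= hi) /\
    forall y, lo <= y <= hi -> y <= lo + N%:R * rho ->
      exists2 z, z \in s & `|y - z| <= rho.
  elim: N => [|N [s [s1 s2]]].
    exists [:: lo]; split => [y|y /andP[y1 y2]].
      by rewrite inE => /eqP ->; rewrite lexx.
    rewrite mul0r addr0 => y3; exists lo; rewrite ?inE//.
    by rewrite (_ : y = lo) ?subrr ?normr0 ?ltW//; apply/eqP; rewrite eq_le y1 y3.
  have [hN|hN] := leP (lo + N%:R * rho) hi.
    exists ((lo + N%:R * rho) :: s); split => [y|y yh y3].
      rewrite inE => /orP[/eqP ->|/s1//]; rewrite hN andbT lerDl mulr_ge0// ltW//.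
    have [/s2[//|z zs zy]|yN] := leP y (lo + N%:R * rho).
      by exists z => //; rewrite inE zs orbT.
    exists (lo + N%:R * rho); first by rewrite inE eqxx.
    have h : 0 <= y - (lo + N%:R * rho) by rewrite subr_ge0 ltW.
    by rewrite (ger0_norm h) lerBlDl; move: y3; rewrite -natr1; lra.
  exists s; split => // y yh _; apply: s2 => //.
  by move: yh => /andP[_ yh]; rewrite (le_trans yh)// ltW.
have [s [s1 s2]] := H (Num.truncn ((hi - lo) / rho)).+1.
exists s; split => // y yh; apply: s2 => //.
move: yh => /andP[_ yh]; rewrite (le_trans yh)// -lerBlDl -ler_pdivrMr//.
by rewrite ltW// truncnS_gt.
Qed.

Definition mk3 (x y z : R) : 'rV[R]_3 := \row_i nth 0 [:: x; y; z] i.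

Lemma palpha_mk3 x y z : palpha (mk3 x y z) = x.
Proof. by rewrite /palpha mxE. Qed.

Lemma pmu_mk3 x y z : pmu (mk3 x y z) = y.
Proof. by rewrite /pmu mxE. Qed.

Lemma pvar_mk3 x y z : pvar (mk3 x y z) = z.
Proof. by rewrite /pvar mxE. Qed.

Lemma param_box_net (om r B B' rho : R) (t0 : 'rV[R]_3) :
    param_box om r B B' t0 -> 0 < rho ->
  exists s : seq 'rV[R]_3, (forall t, t \in s -> param_box om r B B' t) /\
    forall t, param_box om r B B' t -> exists2 t', t' \in s & norm2 (t - t') <= rho.
Proof.
move=> [/andP[a1 a2] mB /andP[v1 v2]] rho0.
(* One third for each coordinate, by [norm2_le_sum]. *)
have rho3 : 0 < rho / 3 by rewrite divr_gt0.
have BB : - B <= B by have := le_trans (normr_ge0 _) mB; lra.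
have [sa [sa1 sa2]] := interval_net (le_trans a1 a2) rho3.
have [sm [sm1 sm2]] := interval_net BB rho3.
have [sv [sv1 sv2]] := interval_net (le_trans v1 v2) rho3.
exists [seq mk3 x.1 x.2.1 x.2.2 | x <- [seq (x, yz) | x <- sa, yz <- [seq (y, z) | y <- sm, z <- sv]]].
split.
- move=> t /mapP[[x [y z]]] /allpairsP[[x' yz'] /= [xs yzs [ex eyz]]].
  move: yzs; rewrite -eyz => /allpairsP[[y' z'] /= [ys zs [ey ez]]] ->.
  rewrite ex ey ez.
  rewrite /param_box palpha_mk3 pmu_mk3 pvar_mk3; split; first exact: sa1.
    by rewrite ler_norml; exact: sm1.
  exact: sv1.
- move=> t [ta tm tv]; rewrite ler_norml in tm.
  have [x xs xd] := sa2 _ ta; have [y ys yd] := sm2 _ tm.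
  have [z zs zd] := sv2 _ tv.
  exists (mk3 x y z).
    apply/mapP; exists (x, (y, z)) => //; apply/allpairsP; exists (x, (y, z)).
    by split => //=; apply/allpairsP; exists (y, z).
  rewrite (le_trans (norm2_le_sum _))// palphaB pmuB pvarB.
  rewrite palpha_mk3 pmu_mk3 pvar_mk3; lra.
Qed.

End Net.

Lemma dist_triangle3 {R : realFieldType} (u1 u2 u3 u4 p q z e : R) :
    `|u1 - u2| <= p -> `|u2 - u3| <= q -> `|u3 - u4| <= z -> p + q + z <= e ->
  `|u1 - u4| <= e.
Proof.
move=> h1 h2 h3; apply: le_trans.
rewrite (le_trans (ler_distD u3 _ _))//; apply: lerD => //.
by rewrite (le_trans (ler_distD u2 _ _))//; apply: lerD.
Qed.

Section UniformLaw.
Context {R : realType} {d : measure_display} {T : measurableType d}.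
Variables (P : probability T R) (X : nat -> {RV P >-> R}) (ts : 'rV[R]_3).
Hypothesis Ots : Omega ts.
Hypothesis iid : iid_mixture X ts.
Variables (om r B B' : R).
Hypotheses (om0 : 0 < om) (r0 : 0 < r).
Local Notation box := (param_box om r B B').
Local Notation gain := (lodds_gain om r B B').

Lemma smean_dist (n : nat) (x : nat -> R) (f g h : R -> R) (k : R) :
    (forall y, `|f y - g y| <= k * h y) ->
  `|smean n x f - smean n x g| <= k * smean n x h.
Proof.
move=> fg; rewrite /smean -mulrBr -sumrB normrM ger0_norm ?invr_ge0//.
rewrite mulrCA; apply: ler_wpM2l; first by rewrite invr_ge0.
by rewrite mulr_sumr (le_trans (ler_norm_sum _ _ _))//; exact: ler_sum.
Qed.

Let quad (x : R) : R := 1 + x ^+ 2.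

Let moderate_quad : moderate quad.
Proof.
split; first by apply: measurable_funD => //; exact: measurable_funX.
by exists 1 => x; rewrite mul1r ger0_norm// addr_ge0// sqr_ge0.
Qed.

Let linear_weight (q : R -> R) : Prop :=
  measurable_fun [set: R] q /\ forall x, `|q x| <= 1 + `|x|.

Let moderate_resp t q : linear_weight q -> moderate (fun x => resp t x * q x).
Proof.
move=> [mq q1]; split.
  by apply: measurable_funM => //; exact: measurable_resp.
exists 2 => x; rewrite normrM (ger0_norm (resp_ge0 _ _)).
apply: (@le_trans _ _ (1 * (1 + `|x|))).
  by apply: ler_pM => //; [exact: resp_ge0|exact: resp_le1].
have := sqr_ge0 (`|x| - 1); rewrite -[x ^+ 2]real_normK ?num_real// => h.
by have := sqr_ge0 `|x|; lra.
Qed.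

Let resp_dist t t' q x : box t -> box t' -> linear_weight q ->
  `|resp t x * q x - resp t' x * q x| <= norm2 (t - t') * (4 * gain) * quad x.
Proof.
move=> bt bt' [_ q1]; rewrite -mulrBl normrM.
have g0 := lodds_gain_ge0 om0 r0 bt; have D0 := norm2_ge0 (t - t').
apply: (@le_trans _ _ (norm2 (t - t') * (2 * gain) * (1 + `|x|) * (1 + `|x|))).
  by apply: ler_pM => //; exact: resp_lipschitz.
have -> : norm2 (t - t') * (2 * gain) * (1 + `|x|) * (1 + `|x|) =
  norm2 (t - t') * (2 * gain) * (1 + `|x|) ^+ 2 by ring.
have -> : norm2 (t - t') * (4 * gain) * quad x =
  norm2 (t - t') * (2 * gain) * (2 * quad x) by ring.
apply: ler_wpM2l; first by rewrite mulr_ge0// mulr_ge0.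
have := sqr_ge0 (`|x| - 1); rewrite /quad -[x ^+ 2]real_normK ?num_real//; lra.
Qed.

Let mean_dist t t' q : box t -> box t' -> linear_weight q ->
  `|mean_of X (fun x => resp t x * q x) - mean_of X (fun x => resp t' x * q x)|
    <= norm2 (t - t') * (4 * gain) * mean_of X quad.
Proof.
move=> bt bt' lq.
have i1 := moderate_integrable Ots iid 0 (moderate_resp t lq).
have i2 := moderate_integrable Ots iid 0 (moderate_resp t' lq).
have i3 := moderate_integrable Ots iid 0 moderate_quad.
rewrite /mean_of -(RintegralB measurableT i1 i2).
have i4 := integrableB measurableT i1 i2.
rewrite -(RintegralZl _ measurableT i3).
apply: (le_trans (le_normr_Rintegral measurableT i4)).
apply: le_Rintegral => //.
- exact: (integrable_norm i4).
- exact: (integrableZl measurableT _ i3).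
- by move=> w _; exact: resp_dist.
Qed.

(** Between net points the empirical mean moves by a Lipschitz constant that is itself an empirical
    mean, that of 1 + x^2. This function therefore joins the finite list, so the constant is
    controlled on the same event. *)
Lemma uniform_weak_law (e del : R) : 0 < e -> 0 < del -> 
  exists N, forall n, (N <= n)%N -> exists E : set T,
  [/\ measurable E, (P (~` E) <= del%:E)%E & forall w, E w ->
    (forall t, box t ->
      `|smean n (fun i => X i w) (resp t) - mean_of X (resp t)| <= e /\
      `|smean n (fun i => X i w) (fun y => resp t y * y) -
        mean_of X (fun y => resp t y * y)| <= e) /\
    `|smean n (fun i => X i w) (fun y => y ^+ 2) -
        mean_of X (fun y => y ^+ 2)| <= e].
Proof.
move=> e0 del0.
have lq1 : linear_weight (fun=> 1) by split=> // x; rewrite normr1 lerDl.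
have lqx : linear_weight (fun x => x) by split=> // x; rewrite lerDr.
have msq : moderate (fun x : R => x ^+ 2).
  split; first exact: measurable_funX.
  by exists 1 => x; rewrite mul1r ger0_norm ?sqr_ge0// lerDr.
(* An empty box leaves only the second moment to treat. *)
have [[t0 bt0]|nb] := pselect (exists t, box t); last first.
  have [N HN] := weak_law_seq Ots iid (hs := [:: (fun x : R => x ^+ 2)])
    (fun h hh => match hh with or_introl E => eq_ind _ _ msq _ E
                 | or_intror F => False_ind _ F end) e0 del0.
  exists N => n /HN[E [mE PE HE]]; exists E; split => // w Ew; split.
    by move=> t bt; exfalso; apply: nb; exists t.
  by apply: HE => //; left.
(* The bound e / 2 is for the net points; the bound 1 keeps the empirical mean of [quad] below S +
   1. *)
pose S := mean_of X quad; pose e' := Num.min (e / 2) 1.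
have e'0 : 0 < e' by rewrite lt_min ltr01 divr_gt0.
have e'1 : e' <= 1 by rewrite ge_min lexx orbT.
have e'2 : e' <= e / 2 by rewrite ge_min lexx.
have g0 := lodds_gain_ge0 om0 r0 bt0.
have S0 : 0 <= S by apply: Rintegral_ge0 => w _; rewrite addr_ge0// sqr_ge0.
(* The factor 2 S + 1 adds the empirical contribution S + 1 and the population contribution S. *)
pose K := 4 * gain * (2 * S + 1).
have K0 : 0 <= K by rewrite !mulr_ge0// addr_ge0// mulr_ge0.
pose rho := e / 2 / (K + 1).
have K1 : 0 < K + 1 by rewrite ltr_wpDl.
have rho0 : 0 < rho by rewrite !divr_gt0.
have rhoK : rho * K <= e / 2.
  rewrite /rho mulrAC ler_pdivrMr//; apply: ler_wpM2l; last by rewrite lerDl.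
  by rewrite divr_ge0// ltW.
have [s [s1 s2]] := param_box_net bt0 rho0.
pose hs := quad :: (fun x : R => x ^+ 2) ::
  [seq (fun x => resp t x * 1) | t <- s] ++ [seq (fun x => resp t x * x) | t <- s].
have Inmap (F : 'rV[R]_3 -> R -> R) t : t \in s -> List.In (F t) [seq F t | t <- s].
  elim: (s) => //= u l IH; rewrite inE => /orP[/eqP ->|/IH]; first by left.
  by right.
have Incat (h : R -> R) l1 l2 : List.In h (l1 ++ l2) <->
    List.In h l1 \/ List.In h l2.
  elim: l1 => /= [|u l IH]; first by split; [right|case].
  by split=> [[->|/IH[]]|[[->|]|]]; tauto.
have Inof (F : 'rV[R]_3 -> R -> R) l h : List.In h [seq F t | t <- l] ->
    exists t, h = F t.
  elim: l => //= u l IH [<-|/IH//]; by exists u.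
have mhs h : List.In h hs -> moderate h.
  move=> /= [<-|[<-|]]; [exact: moderate_quad|exact: msq|].
  move=> /Incat[/Inof[t ->]|/Inof[t ->]]; first exact: (moderate_resp t lq1).
  exact: (moderate_resp t lqx).
have [N HN] := weak_law_seq Ots iid mhs e'0 del0.
exists N => n /HN[E [mE PE HE]]; exists E; split => // w Ew.
have hq := HE w Ew quad (or_introl erefl).
set x := (fun i => X i w) in hq *.
have unif q : linear_weight q ->
    (forall t, t \in s -> `|smean n x (fun y => resp t y * q y) -
       mean_of X (fun y => resp t y * q y)| <= e') ->
    forall t, box t -> `|smean n x (fun y => resp t y * q y) -
       mean_of X (fun y => resp t y * q y)| <= e.
  move=> lq hs' t bt; have [t' t's tt'] := s2 t bt.
  have bt' := s1 _ t's.
  have d1 := @smean_dist n x (fun y => resp t y * q y)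
    (fun y => resp t' y * q y) quad _ (fun y => resp_dist y bt bt' lq).
  have d2 := hs' t' t's.
  have d3 := mean_dist bt' bt lq.
  set u1 := smean n x _ in d1 *; set u2 := smean n x _ in d1 d2.
  set u3 := mean_of X _ in d2 d3; set u4 := mean_of X _ in d3 *.
  have D0 := norm2_ge0 (t - t').
  have Dsym : norm2 (t' - t) = norm2 (t - t').
    rewrite -[t' - t]opprB -scaleN1r /norm2; congr Num.sqrt.
    by apply: eq_bigr => i _; rewrite mxE mulN1r sqrrN.
  rewrite Dsym in d3.
  have hq' : smean n x quad <= S + 1.
    by rewrite -lerBlDl (le_trans (ler_norm _))// (le_trans hq).
  have c0 : 0 <= norm2 (t - t') * (4 * gain) by rewrite mulr_ge0// mulr_ge0.
  have d1' : `|u1 - u2| <= norm2 (t - t') * (4 * gain) * (S + 1).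
    by apply: (le_trans d1); exact: ler_wpM2l.
  have dK : norm2 (t - t') * K <= e / 2.
    by apply: le_trans rhoK; exact: ler_wpM2r.
  apply: (dist_triangle3 d1' d2 d3).
  have -> : norm2 (t - t') * (4 * gain) * (S + 1) + e' +
    norm2 (t - t') * (4 * gain) * mean_of X quad = norm2 (t - t') * K + e'.
    by rewrite /K -/S; ring.
  by rewrite [leRHS]splitr; apply: lerD.
split; last by apply: (le_trans (HE w Ew _ (or_intror (or_introl erefl)))); lra.
have fE t : (fun y => resp t y * 1) = resp t.
  by apply/funext => y; rewrite mulr1.
move=> t bt; split.
- rewrite -fE; apply: (unif (fun=> 1)) => // t' t's; apply: HE => //=.
  by right; right; apply/Incat; left; exact: (Inmap (fun t x => resp t x * 1)).
- apply: (unif (fun y => y)) => // t' t's; apply: HE => //=.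
  by right; right; apply/Incat; right; exact: (Inmap (fun t x => resp t x * x)).
Qed.

End UniformLaw.

(** * The overlap rate *)

(** [k n] is the largest j <= n such that 1 / (j + 1) is good at n. As [good] need not be monotone
    in the level, it matters that a nonempty maximum is attained. The empty maximum is 0, harmless
    since level 1 is eventually good. *)
Lemma diagonal_rate {R : realType} (good : nat -> R -> Prop) :
    (forall e, 0 < e -> exists N, forall n, (N <= n)%N -> good n e) ->
  exists eta : nat -> R, [/\ forall n, 0 <= eta n, eta @ \oo --> (0 : R) &
    exists N, forall n, (N <= n)%N -> good n (eta n)].
Proof.
move=> H; pose k n := (\max_(j < n.+1 | `[< good n j.+1%:R^-1 >]) j)%N.
have kP j : exists N, forall n, (N <= n)%N ->
    (j <= k n)%N /\ good n (k n).+1%:R^-1.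
  have [|N HN] := H (j.+1%:R^-1 : R); first by rewrite invr_gt0.
  exists (maxn N j) => n; rewrite geq_max => /andP[Nn jn].
  have jn1 : (j < n.+1)%N by [].
  have gj : `[< good n (Ordinal jn1).+1%:R^-1 >] by apply/asboolP; exact: HN.
  split; first exact: (leq_bigmax_cond (Ordinal jn1) gj).
  have c0 : (0 < #|[pred j : 'I_n.+1 | `[< good n j.+1%:R^-1 >]]|)%N.
    by apply/card_gt0P; exists (Ordinal jn1).
  have [i gi ki] := eq_bigmax_cond (fun j : 'I_n.+1 => j : nat) c0.
  have -> : k n = i by rewrite -ki.
  exact/asboolP.
exists (fun n => (k n).+1%:R^-1); split.
- by move=> n; rewrite invr_ge0.
- apply/cvgrPdist_le => e e0.
  have [N HN] := kP (Num.truncn e^-1).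
  exists N => // n /= /HN[kn _].
  rewrite sub0r normrN ger0_norm ?invr_ge0// invf_ple ?posrE//.
  by rewrite (le_trans (ltW (truncnS_gt _)))// ler_nat.
- by have [N HN] := kP 0%N; exists N => n /HN[].
Qed.

Section Rate.
Context {R : realType}.
Variables (r om : R).
Hypotheses (r0 : 0 < r) (om0 : 0 < om).

(* With 3/512 from tilt_exponents, m/V above this threshold makes the overlap
   factor at most exp (- m - m / (3 r)). *)
Definition separation : R := Num.max 8 ((1 + (3 * r)^-1) * (512 / 3)).

(** What remains of [noise_gain * pop_gain] once the exponential and a factor (1 + m)^2 from each of
    the noise, the log odds and the tilted integral are removed. *)
Definition gain_cst : R :=
  4 * (2 / om + 6 / r ^+ 2) * (3 / om) * (2 / om + 2 * ((1 + r) / r) ^+ 2).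

(** The middle factor comes from (1 + m)^6 <= 6! exp (1 + m). The last one gives, besides the bound
    by gamma, the bound by gamma (1 - a) / (4 r) that the invariance of the range of alpha
    requires. *)
Definition rate_cst (a : R) : R :=
  gain_cst * (6`!%:R * expR 1) * (1 + 4 * r / (1 - a)).

(* gamma < nu fails in the first two cases, because nu <= 4 always and nu <= 0
   when v <= 3 r. *)
Definition gamma_rate (a m v : R) : R :=
  if m / v <= separation then 8 else if v <= 3 * r then 0 else
  rate_cst a * expR (- (m / (3 * r))).

Lemma gain_cst_ge0 : 0 <= gain_cst.
Proof.
have h1 : 0 <= 2 / om by rewrite divr_ge0// ltW.
have h2 : 0 <= 3 / om by rewrite divr_ge0// ltW.
have h3 : 0 <= 6 / r ^+ 2 by rewrite divr_ge0// sqr_ge0.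
have h4 : 0 <= 2 * ((1 + r) / r) ^+ 2 by rewrite mulr_ge0// sqr_ge0.
by rewrite /gain_cst; apply: mulr_ge0; [apply: mulr_ge0 => //;
  apply: mulr_ge0|]; rewrite ?addr_ge0.
Qed.

Lemma rate_cst_ge0 a : a < 1 -> 0 <= rate_cst a.
Proof.
move=> a1; have g0 := gain_cst_ge0; have b0 : 0 < 1 - a by rewrite subr_gt0.
rewrite /rate_cst; apply: mulr_ge0.
  by apply: mulr_ge0.
by rewrite addr_ge0// divr_ge0 ?ltW// mulr_gt0.
Qed.

Lemma gamma_rate_ge0 a m v : a < 1 -> 0 <= gamma_rate a m v.
Proof.
move=> a1; rewrite /gamma_rate; case: ifP => // _; case: ifP => // _.
by rewrite mulr_ge0 ?expR_ge0// rate_cst_ge0.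
Qed.

(** In the remaining case v > 3 r, so m / (3 r) dominates (m - r) / (v + r), and m^5 / v^4 = m (m /
    v)^4 >= m >= 3 r. Large m / v alone thus suffices, uniformly in v. *)
Lemma gamma_rate_bigO a : a < 1 -> bigO_rate r (gamma_rate a).
Proof.
move=> a1; have G0 := rate_cst_ge0 a1.
have r30 : 0 < 3 * r by rewrite mulr_gt0.
exists (rate_cst a / (3 * r)), separation => m v v0 Kmv.
have C0 : 0 <= rate_cst a / (3 * r) by rewrite divr_ge0// ltW.
rewrite /gamma_rate [m / v <= _]leNgt Kmv /=; have [_|vr] := leP v (3 * r).
  by rewrite normr0 mulr_ge0.
have K8 : 8 <= separation by rewrite le_max lexx.
have mv8 : 8 * v <= m by rewrite -ler_pdivlMr// (le_trans K8)// ltW.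
have m0 : 0 < m by lra.
rewrite (ger0_norm (mulr_ge0 G0 (expR_ge0 _))).
have q0 : 0 < m ^+ 5 / v ^+ 4 by rewrite divr_gt0// exprn_gt0.
rewrite (gtr0_norm (mulr_gt0 q0 (expR_gt0 _))) -mulrA.
apply: ler_wpM2l => //; rewrite mulrA -[leLHS]mul1r; apply: ler_pM => //.
- have -> : m ^+ 5 / v ^+ 4 = m * (m / v) ^+ 4 by field; rewrite gt_eqF.
  rewrite ler_pdivlMl// mulr1; apply: (@le_trans _ _ m); first lra.
  apply: ler_peMr; first exact: ltW.
  by rewrite exprn_ege1// ler_pdivlMr//; lra.
- rewrite ler_expR lerN2; apply: (@le_trans _ _ (m / (v + r))).
    by rewrite ler_pM2r ?invr_gt0; have := r0; lra.
  by rewrite ler_pM2l// lef_pV2 ?posrE//; have := r0; lra.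
Qed.

(** The polynomial (1 + m)^6 costs a factor exp m, which the separation of the components recovers
    from the Gaussian exponent together with exp (- m / (3 r)). *)
Lemma noise_pop_gain_le (ts : 'rV[R]_3) : 3 * r < pvar ts ->
    separation < pmu ts / pvar ts ->
  noise_gain r om ts * pop_gain r om ts <=
    gain_cst * (6`!%:R * expR 1) * expR (- (pmu ts / (3 * r))).
Proof.
set m := pmu ts; set V := pvar ts => V3 KmV; have rr := r0; have oo := om0.
have V0 : 0 < V by lra.
have K8 : 8 <= separation by rewrite le_max lexx.
have mV : separation * V <= m by rewrite -ler_pdivlMr// ltW.
have mV8 : 8 * V <= m by rewrite (le_trans _ mV)// ler_pM2r.
have m0 : 0 < m by lra.
have o1 : 0 < om^-1 by rewrite invr_gt0.
have i2 : 0 < (r ^+ 2)^-1 by rewrite invr_gt0 exprn_gt0.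
have ng : noise_gain r om ts <=
    (2 / om + 2 * ((1 + r) / r) ^+ 2) * (1 + m) ^+ 2.
  rewrite /noise_gain -/m (gtr0_norm m0); set y := (1 + m + r) / r.
  have y1 : 1 <= y by rewrite ler_pdivlMr//; lra.
  have y2 : y <= y ^+ 2 by rewrite expr2; apply: ler_peMr => //; lra.
  have y3 : y <= (1 + r) / r * (1 + m).
    rewrite /y mulrAC ler_pM2r ?invr_gt0//.
    by have := mulr_gt0 m0 rr; lra.
  have y4 : y ^+ 2 <= ((1 + r) / r) ^+ 2 * (1 + m) ^+ 2.
    by rewrite -exprMn; apply: lerXn2r; rewrite ?nnegrE//; lra.
  have m1 : 1 <= (1 + m) ^+ 2 by rewrite exprn_ege1//; lra.
  have : 2 / om <= 2 / om * (1 + m) ^+ 2.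
    by apply: ler_peMr => //; rewrite mulr_ge0// ltW.
  lra.
have lg : lodds_gain om r (2 * m) (2 * m) <= (2 / om + 6 / r ^+ 2) * (1 + m) ^+ 2.
  rewrite /lodds_gain -/m.
  have -> : (2 * (2 * m) * (2 * m) + (2 * m) ^+ 2) / (2 * r ^+ 2) =
    6 * m ^+ 2 / r ^+ 2 by field; rewrite gt_eqF.
  have m1 : 1 <= (1 + m) ^+ 2 by rewrite exprn_ege1//; lra.
  have e1 : 2 / om <= 2 / om * (1 + m) ^+ 2.
    by apply: ler_peMr => //; rewrite mulr_ge0// ltW.
  have e2 : (2 * m + 2 * m + 6 * m ^+ 2) / r ^+ 2 <= 6 * (1 + m) ^+ 2 / r ^+ 2.
    by rewrite ler_pM2r//; lra.
  by move: e1 e2; lra.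
have lg0 : 0 <= lodds_gain om r (2 * m) (2 * m).
  rewrite /lodds_gain; apply: addr_ge0; first apply: addr_ge0.
  - by rewrite divr_ge0// ltW.
  - by apply: divr_ge0; [lra|exact: sqr_ge0].
  - apply: divr_ge0; first by have := sqr_ge0 m; lra.
    by apply: mulr_ge0 => //; exact: sqr_ge0.
have ng0 : 0 <= noise_gain r om ts.
  have h : 0 <= 1 + `|pmu ts| + r by rewrite !addr_ge0// ltW.
  by rewrite /noise_gain !addr_ge0 ?sqr_ge0// divr_ge0// ltW.
have ex : (1 + m) ^+ 6 * expR (- (3 / 512 * (m ^+ 2 / V))) <=
    6`!%:R * expR 1 * expR (- (m / (3 * r))).
  have c60 : 0 < 6`!%:R :> R by rewrite ltr0n fact_gt0.
  have e1 : (1 + m) ^+ 6 <= 6`!%:R * expR (1 + m).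
    have m10 : 0 <= 1 + m by lra.
    rewrite mulrC -ler_pdivrMr//.
    by apply: le_trans (@expR_ge1Dxn R (1 + m) 5 m10); rewrite lerDr.
  move: (6`!%:R : R) c60 e1 => c6 c60 e1.
  apply: (@le_trans _ _ (c6 * expR (1 + m) * expR (- (3 / 512 * (m ^+ 2 / V))))).
    exact: (ler_wpM2r (expR_ge0 _) e1).
  rewrite -!mulrA -!expRD ler_pM2l// ler_expR.
  have : (1 + (3 * r)^-1) * m <= 3 / 512 * (m ^+ 2 / V).
    have -> : 3 / 512 * (m ^+ 2 / V) = (3 / 512 * (m / V)) * m.
      by field; rewrite gt_eqF.
    rewrite ler_pM2r//.
    have : (1 + (3 * r)^-1) * (512 / 3) <= m / V.
      by apply: (le_trans _ (ltW KmV)); rewrite le_max lexx orbT.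
    lra.
  lra.
pose w := (1 + m) ^+ 2; have w0 : 0 <= w by exact: sqr_ge0.
pose ee := expR (- (3 / 512 * (m ^+ 2 / V))); have ee0 : 0 <= ee by exact: expR_ge0.
apply: (@le_trans _ _ (gain_cst * ((1 + m) ^+ 6 * ee))); last first.
  by rewrite -mulrA; apply: ler_wpM2l => //; exact: gain_cst_ge0.
have -> : gain_cst * ((1 + m) ^+ 6 * ee) =
  ((2 / om + 2 * ((1 + r) / r) ^+ 2) * w) *
  ((4 * ((2 / om + 6 / r ^+ 2) * w)) * (om^-1 * ee * (3 * w))).
  by rewrite /gain_cst /w; ring.
apply: ler_pM => //.
  rewrite /pop_gain /tilt_bound -/m -/V -/ee -/w.
  apply: mulr_ge0; first exact: mulr_ge0.
  exact: (mulr_ge0 (mulr_ge0 (ltW o1) ee0) (mulr_ge0 (ler0n _ 3) w0)).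
rewrite /pop_gain /tilt_bound -/m -/V -/ee -/w.
apply: ler_wpM2r; last by rewrite ler_pM2l.
exact: (mulr_ge0 (mulr_ge0 (ltW o1) ee0) (mulr_ge0 (ler0n _ 3) w0)).
Qed.

End Rate.

(** * Assembly of the statistical bounds *)

Section EmpiricalStats.
Context {R : realType} {d : measure_display} {T : measurableType d}.
Variables (P : probability T R) (X : nat -> {RV P >-> R}).
Variables (r om : R) (ts : 'rV[R]_3).
Hypotheses (r0 : 0 < r) (om0 : 0 < om) (Ots : Omega ts).
Hypothesis om_le : om <= (1 - palpha ts) / 2.
Hypothesis iid : iid_mixture X ts.
Hypotheses (V3r : 3 * r < pvar ts) (mV : 8 * pvar ts <= pmu ts).

(** Split each error at the population mean for t: the uniform law controls the first part, the
    small Lipschitz constant the second, and at [ts] the population means are exactly the target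
    values. *)
Lemma stats_close_with_prob (delta e : R) : 0 < delta -> 0 < e ->
  exists N, forall n, (N <= n)%N ->
  with_prob_ge P (1 - delta)
    [set w | stats_close r om ts n (fun i => X i w) (pop_gain r om ts) e].
Proof.
move=> d0 e0; have law := iid.2 0%N.
have [N HN] := @uniform_weak_law R d T P X ts Ots iid om r (2 * pmu ts)
  (2 * pmu ts) om0 r0 e delta e0 d0.
exists N => n /HN[E [mE PE HE]]; exists E; split => //; last first.
  move: PE; rewrite probability_setC// => PE.
  have Pfin : P E \is a fin_num by exact: fin_num_measure.
  move: PE; rewrite -(fineK Pfin) -EFinB !lee_fin; lra.
move=> w Ew t Dt; have [/(_ t)HEt HE2] := HE w Ew.
have [|h0 h1] := HEt; first exact: (em_domain_box r0 V3r mV Dt).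
have l1 := @population_resp_lipschitz R d T P (X 0%N) r om ts r0 om0 Ots om_le
  law V3r mV t (fun=> 1) Dt.
have lx := @population_resp_lipschitz R d T P (X 0%N) r om ts r0 om0 Ots om_le
  law V3r mV t (fun x => x) Dt.
have tri (u v z p q : R) : `|u - v| <= e -> `|v - z| <= p -> p <= q ->
    `|u - z| <= q + e.
  move=> uv vz pq; have -> : u - z = (u - v) + (v - z) by ring.
  rewrite (le_trans (ler_normD _ _))// addrC.
  by apply: lerD => //; exact: le_trans pq.
split.
- apply: (tri _ _ _ _ _ h0 _ (lexx _)).
  rewrite -(resp_mean Ots law).
  have mul1 t' : \int[P]_w0 (resp t' (X 0%N w0) * 1) = \int[P]_w0 resp t' (X 0%N w0).
    by apply: eq_Rintegral => w' _; rewrite mulr1.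
  rewrite /mean_of -(mul1 t) -(mul1 ts); apply: l1 => // x.
  by rewrite normr1 lerDl.
- apply: (tri _ _ _ _ _ h1 _ (lexx _)).
  rewrite -(resp_first_moment Ots law).
  by apply: lx => // x; rewrite lerDr.
- rewrite -(mixture_second_moment Ots law).
  have bt := em_domain_box r0 V3r mV Dt.
  have gg : 0 <= pop_gain r om ts * norm2 (t - ts).
    have l0 := l1 _ _; apply: (le_trans (normr_ge0 _) (l0 _ _)) => //.
    by move=> x; rewrite normr1 lerDl.
  by apply: (le_trans HE2); rewrite lerDr.
Qed.

End EmpiricalStats.
Theorem theorem2 (R : realType) (r delta om : R)
    (r_gt0 : 0 < r) (delta01 : 0 < delta < 1) (om_gt0 : 0 < om) :
  exists gamma : R -> R -> R -> R,
    [/\ (forall theta_s : 'rV[R]_3, Omega theta_s ->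
           0 <= gamma (palpha theta_s) (pmu theta_s) (pvar theta_s)),
        (forall a : R, 2^-1 < a < 1 -> bigO_rate r (gamma a)) &
        forall (d : measure_display) (T : measurableType d)
          (P : probability T R) (xi : nat -> {RV P >-> R})
          (theta_s : 'rV[R]_3),
        Omega theta_s -> iid_mixture xi theta_s ->
        (* "om arbitrarily small", see also the condition on theta0 *)
        om <= (1 - palpha theta_s) / 2 ->
        let g := gamma (palpha theta_s) (pmu theta_s) (pvar theta_s) in
        let nu := nu_const r theta_s in
        let L := L_const r om theta_s in
        0 <= g -> g < nu -> nu <= L ->
        exists eps : nat -> {RV P >-> R},
          {ae P, forall w : T, (fun n => eps n w) @ \oo --> (0 : R)} /\
          \forall n \near \oo, forall theta0 : 'rV[R]_3,
            ball2 r theta_s theta0 -> om <= 1 - palpha theta0 ->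
            with_prob_ge P (1 - delta)
              [set w : T | forall t : nat,
                norm2 (em_iter (2 / (L + nu)) n (fun i => xi i w) theta0 t
                       - theta_s)
                <= (1 - (2 * nu - 2 * g) / (L + nu)) ^+ t
                     * norm2 (theta0 - theta_s)
                   + eps n w]].
Proof.
have [delta0 _] := andP delta01.
exists (gamma_rate r om); split.
- by move=> ts [/andP[_ a1] _]; exact: gamma_rate_ge0.
- by move=> a /andP[_ a1]; exact: gamma_rate_bigO.
move=> d T P xi ts Ots iid om_le g nu L g0 gnu nuL.
have nu0 : 0 < nu by exact: le_lt_trans gnu.
have V3r : 3 * r < pvar ts by exact: var_gt3r nu0.
have V0 : 0 < pvar ts by have [] := Ots.
have [/andP[a_gt a1] _] := Ots.
have b0 : 0 < 1 - palpha ts by rewrite subr_gt0.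
have nu4 : nu <= 4 by exact: nu_const_le4.
have sep : separation r < pmu ts / pvar ts.
  rewrite ltNge; apply/negP => h; move: gnu.
  by rewrite /g /gamma_rate h => gnu; lra.
have mV : 8 * pvar ts <= pmu ts.
  by rewrite -ler_pdivlMr// (le_trans _ (ltW sep))// le_max lexx.
set lam := pop_gain r om ts; set Z := noise_gain r om ts.
have Z0 : 0 <= Z by exact: noise_gain_ge0.
(* It yields Z lam <= g for the contraction and Z lam r <= g (1 - a) / 4 for the range of alpha. *)
have gE : Z * lam * (1 + 4 * r / (1 - palpha ts)) <= g.
  rewrite /g /gamma_rate (leNgt (pmu ts / _)) sep /= (leNgt (pvar ts)) V3r /=.
  rewrite /rate_cst [leRHS]mulrAC.
  apply: ler_wpM2r; last exact: noise_pop_gain_le.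
  by rewrite addr_ge0// divr_ge0 ?ltW// mulr_gt0.
have lam0 : 0 <= lam.
  have ts_in := ts_domain (r := r) r_gt0 om_gt0 Ots om_le.
  have bt := em_domain_box r_gt0 V3r mV ts_in.
  rewrite /lam /pop_gain /tilt_bound; apply: mulr_ge0.
    by rewrite mulr_ge0// (lodds_gain_ge0 om_gt0 r_gt0 bt).
  apply: mulr_ge0; first by rewrite mulr_ge0 ?expR_ge0// invr_ge0 ltW.
  by apply: mulr_ge0 => //; exact: sqr_ge0.
have ZL0 : 0 <= Z * lam by rewrite mulr_ge0.
have q0 : 0 <= 4 * r / (1 - palpha ts) by rewrite divr_ge0 ?ltW// mulr_gt0.
have Gg : Z * lam <= g by apply: le_trans gE; apply: ler_peMr => //; rewrite lerDl.
have Gr : Z * lam * r <= g * (1 - palpha ts) / 4.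
  have : Z * lam * (4 * r / (1 - palpha ts)) <= g.
    by apply: le_trans gE; apply: ler_wpM2l => //; rewrite lerDr.
  rewrite mulrA ler_pdivrMr//; lra.
pose s := 2 / (L + nu).
have Lnu : 0 < L + nu by rewrite addr_gt0// (lt_le_trans nu0).
have s0 : 0 < s by rewrite divr_gt0.
have sE : s * (L + nu) = 2 by rewrite divfK// gt_eqF.
have d0 : 0 < nu - g by rewrite subr_gt0.
have [eta [eta0 eta_cvg [N HN]]] := @diagonal_rate R (fun n e =>
  with_prob_ge P (1 - delta) [set w | stats_close r om ts n (fun i => xi i w) lam e])
  (fun e e0 => stats_close_with_prob r_gt0 om_gt0 Ots om_le iid V3r mV delta0 e0).
pose c n : R := Z * eta n / (nu - g).
exists (fun n => cst (c n)); split.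
  apply: aeW => w /=.
  have : (fun n => (Z / (nu - g)) * eta n) @ \oo --> (Z / (nu - g) * 0 : R).
    by apply: cvgMr; exact: eta_cvg.
  by rewrite mulr0; apply: cvg_trans; apply: near_eq_cvg; near=> n;
    rewrite /c mulrAC.
(* The first bound keeps the iterates in the ball. The second adds to g (1 - a) / 4 to give at most
   nu (1 - a) / 2, which is below nu (1 - a - om) by the choice of [om]. *)
pose tol := Num.min ((nu - g) * r) (nu * (1 - palpha ts) / 4).
have tol0 : 0 < tol by rewrite lt_min !mulr_gt0// invr_gt0.
have eta_small : \forall n \near \oo, Z * eta n <= tol.
  have t0 : 0 < tol / (Z + 1) by rewrite divr_gt0// ltr_wpDl.
  have /cvgrPdist_le/(_ _ t0) := eta_cvg.
  apply: filterS => n; rewrite sub0r normrN ger0_norm// => h.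
  apply: (@le_trans _ _ ((Z + 1) * eta n)).
    by apply: ler_wpM2r => //; rewrite lerDl.
  by rewrite mulrC -ler_pdivlMr// ltr_wpDl.
near=> n => theta0 [[/andP[al_gt al_lt] v0] theta0r] om0.
have nN : (N <= n)%N by near: n; exists N.
have n0 : (0 < n)%N by near: n; exists 1%N.
have small : Z * eta n <= tol by near: n; exact: eta_small.
have [E [mE EA PE]] := HN n nN; exists E; split => // w Ew t.
have H0 : 0 <= Z * eta n by rewrite mulr_ge0.
have Hr : Z * eta n <= (nu - g) * r by rewrite (le_trans small)// ge_min lexx.
have Hb : Z * eta n <= nu * (1 - palpha ts) / 4.
  by rewrite (le_trans small)// ge_min lexx orbT.
have GH : Z * lam * r + Z * eta n <= nu * (1 - palpha ts - om).
  have : g * (1 - palpha ts) <= nu * (1 - palpha ts) by rewrite ler_pM2r// ltW.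
  have : nu * om <= nu * ((1 - palpha ts) / 2) by rewrite ler_pM2l.
  by move: Gr Hb; lra.
have inv : em_invariant r om ts theta0.
  split; last by left; exact: ltW.
  by split => //; apply/andP; split; lra.
have := em_iter_bound r_gt0 om_gt0 Ots om_le nu0 nuL n0 s0 sE g0 gnu lam0
  (EA _ Ew) Gg GH H0 Hr t inv.
rewrite /c /s (_ : 1 - 2 / (L + nu) * (nu - g) = 1 - (2 * nu - 2 * g) / (L + nu))//.
by ring.
Unshelve. all: by end_near. Qed.
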